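(* Let $h>0$, let $\phi:\mathbb{R}\to[0,\infty)$ be locally Lipschitz, and let $L>0$. Assume the initial values $(U_0^N(a): a\in\mathcal{A}_N, N\ge 2)$ are i.i.d. real random variables with $\mathbb{P}(|U_0^N(a)|\le L)=1$. For $N\ge2$ let $(U^N_t(a))_{a\in\mathcal{A}_N,t\ge 0}$ be the $N$-actor system described in the context, and let $((U_t(a))_{t\ge0}: a\in\mathcal{A}_N)$ be the $N$ independent copies of the limit equation driven by the same Poisson measures and with $U_0(a)=U_0^N(a)$, namely $$U_t(a)=U_0^N(a)-\sum_{o \in \mathcal{O}}\int_0^t \int_0^{\infty} U_{s-}(a)\mathbf{1}\{z \leq \phi(oU_{s-}(a))\}\mathbf{N}^{a,o}(ds,dz)+h\sum_{o\in \mathcal{O}}o \int_0^t \mathbb{E}[\phi(oU_{s}(a))]ds.$$ Then for any $T>0$ there exists a constant $C=C(L,T,h,\phi)>0$ such that for all $t\le T$, all $N\ge 2$ and any $a\in\mathcal{A}_N$, $$\mathbb{E}\Big(\sup_{s\le t}|U_s^N(a)-U_s(a)|\Big)\le C N^{-1/2}.$$ Moreover, $C(L,T,h,\phi)$ is increasing in $L$, $h$ and $T$ (and depends on $\phi$).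
   Context: $\mathcal{A}_N=\{1,\dots,N\}$, $\mathcal{O}=\{-1,+1\}$. $(\mathbf{N}^{a,o}: a\in\mathcal{A}_N,o\in\mathcal{O})$ is an i.i.d. family of Poisson random measures on $\mathbb{R}^+\times\mathbb{R}^+$ with intensity $ds\,dz$, independent of the initial values. The $N$-actor system is the solution of, for each $a\in\mathcal{A}_N$, $$U_t^{N}(a)=U_0^{N}(a)-\sum_{o \in \mathcal{O}}\int_0^t \int_0^{\infty} U_{s-}^{N}(a)\mathbf{1}\{z \leq \phi(o U_{s-}^{N}(a))\}\mathbf{N}^{a, o}(ds,dz)+ \frac{h}{N}\sum_{o \in \mathcal{O}}\sum_{b\neq a}\int_0^t \int_0^{\infty} o\,\mathbf{1}\{z \leq \phi(oU_{s-}^{N}(b))\}\mathbf{N}^{b,o}(ds,dz).$$ *)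

(* Defs.v *)
From HB Require Import structures.
From mathcomp Require Import all_boot all_order all_algebra.
From mathcomp Require Import all_classical all_reals all_analysis.
From mathcomp Require Import measurable_realfun.
Set Implicit Arguments. Unset Strict Implicit. Unset Printing Implicit Defensive.
Import Order.TTheory GRing.Theory Num.Theory.
Import numFieldNormedType.Exports.
Local Open Scope classical_set_scope.
Local Open Scope ring_scope.

Section Defs.
Context {R : realType} {d : measure_display} {Omega : measurableType d}.
Variable P : probability Omega R.

(* o in O = {-1,+1}, encoded by a boolean: true = +1, false = -1 *)
Definition sgnO (o : bool) : R := if o then 1 else -1.

Definition mutual_indep (I : eqType) (D : set I) (F : I -> set (set Omega)) :=
  forall (J : seq I) (E : I -> set Omega), uniq J ->
    (forall j, j \in J -> D j /\ F j (E j)) ->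
    P (\big[setI/setT]_(j <- J) E j) = (\prod_(j <- J) P (E j))%E.

Definition sigmaRV (X : Omega -> R) : set (set Omega) :=
  [set X @^-1` B | B in [set B : set R | measurable B]].

Definition rmeasure := Omega -> {measure set (R * R)%type -> \bar R}.

Definition sigmaRM (N : rmeasure) : set (set Omega) :=
  smallest (sigma_algebra setT)
   [set E | exists (A : set (R * R)%type) (B : set (\bar R)),
      measurable A /\ measurable B /\ E = (fun w => N w A) @^-1` B].

Definition Icc0 (t : R) : set R := `[0, t].

Definition quadrant : set (R * R)%type := [set x | 0 <= x.1 /\ 0 <= x.2].

Definition intensity (A : set (R * R)%type) : \bar R :=
  ((@lebesgue_measure R) \x (@lebesgue_measure R)) (A `&` quadrant).

Definition poisson_random_measure (N : rmeasure) :=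
  (forall w, N w (~` quadrant) = 0%E) /\
  (forall A, measurable A -> (intensity A < +oo)%E ->
     measurable_fun setT (fun w => N w A) /\
     forall k : nat,
       P [set w | N w A = (k%:R)%:E] =
       (expR (- fine (intensity A)) * fine (intensity A) ^+ k / (k`!)%:R)%:E) /\
  (forall (n : nat) (A : 'I_n -> set (R * R)%type),
     (forall i, measurable (A i) /\ (intensity (A i) < +oo)%E) ->
     (forall i j, i != j -> A i `&` A j = set0) ->
     mutual_indep (@setT 'I_n)
       (fun i => [set (fun w => N w (A i)) @^-1` B | B in
                  [set B : set (\bar R) | measurable B]])).

Definition cadlag (f : R -> R) :=
  (forall t, 0 <= t -> f x @[x --> at_right t] --> f t) /\
  (forall t, 0 < t -> cvg (f x @[x --> at_left t])).

(* left limit f(s-), with the convention f(0-) = f(0) *)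
Definition leftlim (f : R -> R) (s : R) : R :=
  if 0 < s then lim (f x @[x --> at_left s]) else f s.

Definition dom2 (t : R) : set (R * R)%type := [set x | 0 <= x.1 <= t /\ 0 <= x.2].

Definition pint (mu : {measure set (R * R)%type -> \bar R}) (t : R) (g : R * R -> R) : R :=
  fine (\int[mu]_(x in dom2 t) (g x)%:E)%E.

Definition pintegrable (mu : {measure set (R * R)%type -> \bar R}) (t : R) (g : R * R -> R) :=
  mu.-integrable (dom2 t) (fun x => (g x)%:E).

Definition own_jump (phi : R -> R) (o : bool) (f : R -> R) (x : R * R) : R :=
  leftlim f x.1 * (if x.2 <= phi (sgnO o * leftlim f x.1) then 1 else 0).

Definition spike (phi : R -> R) (o : bool) (f : R -> R) (x : R * R) : R :=
  if x.2 <= phi (sgnO o * leftlim f x.1) then 1 else 0.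

Definition is_actor_system (phi : R -> R) (h : R) (N : nat)
    (PN : nat -> bool -> rmeasure) (U0 : nat -> Omega -> R)
    (UN : nat -> R -> Omega -> R) :=
  (forall a t, (1 <= a <= N)%N -> 0 <= t -> measurable_fun setT (UN a t)) /\
  {ae P, forall w, forall a, (1 <= a <= N)%N ->
     cadlag (fun t => UN a t w) /\
     forall t, 0 <= t ->
       (forall o, pintegrable (PN a o w) t (own_jump phi o (fun s => UN a s w))) /\
       (forall o b, (1 <= b <= N)%N -> b != a ->
          pintegrable (PN b o w) t (spike phi o (fun s => UN b s w))) /\
       UN a t w = U0 a w
         - \sum_(o : bool) pint (PN a o w) t (own_jump phi o (fun s => UN a s w))
         + h / N%:R * \sum_(o : bool) \sum_(1 <= b < N.+1 | b != a)
              sgnO o * pint (PN b o w) t (spike phi o (fun s => UN b s w))}.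

Definition Ephi (phi : R -> R) (o : bool) (U : R -> Omega -> R) (s : R) : R :=
  fine (\int[P]_w (phi (sgnO o * U s w))%:E)%E.

Definition is_limit_solution (phi : R -> R) (h : R)
    (PNa : bool -> rmeasure) (X0 : Omega -> R) (U : R -> Omega -> R) :=
  (forall t, 0 <= t -> measurable_fun setT (U t)) /\
  (forall o s, 0 <= s -> P.-integrable setT (fun w => (phi (sgnO o * U s w))%:E)) /\
  (forall o t, 0 <= t ->
     (@lebesgue_measure R).-integrable (Icc0 t) (fun s => (Ephi phi o U s)%:E)) /\
  {ae P, forall w,
     cadlag (fun t => U t w) /\
     forall t, 0 <= t ->
       (forall o, pintegrable (PNa o w) t (own_jump phi o (fun s => U s w))) /\
       U t w = X0 w
         - \sum_(o : bool) pint (PNa o w) t (own_jump phi o (fun s => U s w))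
         + h * \sum_(o : bool) sgnO o *
              fine (\int[@lebesgue_measure R]_(s in Icc0 t) (Ephi phi o U s)%:E)%E}.

Definition Esup_diff (X Y : R -> Omega -> R) (t : R) : \bar R :=
  (\int[P]_w ereal_sup [set (`|X s w - Y s w|)%:E | s in Icc0 t])%E.

End Defs.

Definition locally_lipschitz {R : realType} (phi : R -> R) :=
  forall K : R, exists Lip : R, forall x y, `|x| <= K -> `|y| <= K ->
    `|phi x - phi y| <= Lip * `|x - y|.

(* Main.v *)
Require Import Defs.
From HB Require Import structures.
From mathcomp Require Import all_boot all_order all_algebra.
From mathcomp Require Import all_classical all_reals all_analysis.
From mathcomp Require Import measurable_realfun perm.
From mathcomp Require Import ring lra zify.
Import Order.TTheory GRing.Theory Num.Theory.
Import numFieldNormedType.Exports.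
Local Open Scope classical_set_scope.
Local Open Scope ring_scope.
Set Implicit Arguments. Unset Strict Implicit. Unset Printing Implicit Defensive.

(* Cut ]0, T] into 2^n strips and each strip into cells of height 2^-n.  Almost
   surely, for n large, a strip carries at most one atom of the Poisson measures
   below a given level, so that the N-actor system and the limit process follow,
   up to O(2^-n), recursive schemes driven by the rounded initial values and by
   the occupation indicators of the cells.  These inputs are independent, and
   all estimates take place on a finite product probability space.

   There, the reference process is the self-consistent scheme whose drift is
   the expectation of its own input.  It resets together with
   the N-actor scheme, unless the atom falls between their two rates, so the
   distance is controlled by itself and by the fluctuation of the accumulated
   inputs; Doob's L2 inequality for the latter yields N^(-1/2), and a discrete
   Gronwall argument concludes.  This requires bounded potentials.  A spike at a
   potential above 4h removes more than twice what it sends out, hence the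
   potentials are at most 2L + 4hZ/N, where Z counts the atoms at levels below
   sup phi on [-4h, 4h]; Z/N is bounded outside an event of probability O(1/N),
   on which the linear bound in Z/N is enough.

   The limit solution is compared with the self-consistent scheme in the same
   way, with an error vanishing as n grows, and Fatou's lemma passes to the
   limit.  The constant depends only on an integer bound of L, T and h; summing
   these constants over the smaller integers makes it monotone. *)

(** * Finite product probability spaces *)

(** Finitely many independent coordinates replace filtrations, predictable integrands and
    compensators by sets of coordinates: a spike minus its firing probability is orthogonal to every
    function of the coordinates outside its strip. The obstacle is that [phi] is only locally
    Lipschitz, while the given limit solution comes without an explicit bound in terms of L, T and
    h. Its bound [limit_B] involves the solution itself, so neither it nor the clipping level [kap]
    built on it may enter the constant; they occur only in errors that vanish with the mesh. The
    constant sees the self-consistent scheme alone. That scheme never leaves the interval of radius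
    [good_level], so it is the same for both clippings of the rate and links the two comparisons. *)

Section ProductExpectation.
Variables (R : realType) (I V : finType) (p : I -> V -> R).
Implicit Types (c : {ffun I -> V}) (F G : {ffun I -> V} -> R) (A : pred I).

Definition prod_wt c : R := \prod_i p i (c i).
Definition Ex F : R := \sum_c prod_wt c * F c.

Lemma eq_Ex F G : F =1 G -> Ex F = Ex G.
Proof. by move=> FG; apply: eq_bigr => c _; rewrite FG. Qed.

Lemma ExD F G : Ex (fun c => F c + G c) = Ex F + Ex G.
Proof. by rewrite /Ex -big_split; apply: eq_bigr => c _; rewrite mulrDr. Qed.

Lemma ExZ a F : Ex (fun c => a * F c) = a * Ex F.
Proof. by rewrite /Ex mulr_sumr; apply: eq_bigr => c _; rewrite mulrCA. Qed.

Lemma ExN F : Ex (fun c => - F c) = - Ex F.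
Proof. by rewrite /Ex -sumrN; apply: eq_bigr => c _; rewrite mulrN. Qed.

Lemma ExB F G : Ex (fun c => F c - G c) = Ex F - Ex G.
Proof. by rewrite ExD ExN. Qed.

Lemma Ex_sum (J : Type) (r : seq J) (P : pred J) (H : J -> {ffun I -> V} -> R) :
  Ex (fun c => \sum_(j <- r | P j) H j c) = \sum_(j <- r | P j) Ex (H j).
Proof.
by rewrite /Ex exchange_big /=; apply: eq_bigr => c _; rewrite mulr_sumr.
Qed.

Lemma Ex_reindex (s : I -> I) F : bijective s -> (forall i, p (s i) = p i) ->
  Ex (fun c => F [ffun i => c (s i)]) = Ex F.
Proof.
move=> [s' sK s'K] ps; rewrite {2}/Ex.
rewrite (reindex (fun c => [ffun i => c (s i)] : {ffun I -> V})) /=; last first.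
  exists (fun c => [ffun i => c (s' i)]) => c _; apply/ffunP => i;
    by rewrite !ffunE ?sK ?s'K.
apply: eq_bigr => c _; congr (_ * _).
rewrite /prod_wt (reindex s) /=; last by exists s'=> i _; rewrite ?sK ?s'K.
by apply: eq_bigr => i _; rewrite ffunE ps.
Qed.

Hypothesis p_ge0 : forall i v, 0 <= p i v.
Hypothesis p_sum1 : forall i, \sum_v p i v = 1.

Lemma prod_wt_ge0 c : 0 <= prod_wt c.
Proof. exact: prodr_ge0. Qed.

Lemma Ex_cst a : Ex (fun=> a) = a.
Proof.
rewrite /Ex -mulr_suml /prod_wt -(bigA_distr_bigA (fun i v => p i v)) /=.
by rewrite big1 ?mul1r // => i _; rewrite p_sum1.
Qed.

Lemma le_Ex F G : (forall c, F c <= G c) -> Ex F <= Ex G.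
Proof. by move=> FG; apply: ler_sum => c _; rewrite ler_wpM2l ?prod_wt_ge0. Qed.

Lemma Ex_ge0 F : (forall c, 0 <= F c) -> 0 <= Ex F.
Proof. by move=> F0; apply: sumr_ge0 => c _; rewrite mulr_ge0 ?prod_wt_ge0. Qed.

Lemma normr_Ex F : `|Ex F| <= Ex (fun c => `|F c|).
Proof.
apply: le_trans (ler_norm_sum _ _ _) _.
by apply: ler_sum => c _; rewrite normrM ger0_norm ?prod_wt_ge0.
Qed.

Definition depends_on (T : Type) A (F : {ffun I -> V} -> T) :=
  forall c c', (forall i, A i -> c i = c' i) -> F c = F c'.

Let mix A c c' : {ffun I -> V} := [ffun i => if A i then c i else c' i].

(* Exchanging the A-coordinates of two independent samples preserves their
   joint law. *)
Lemma Ex_indep A F G : depends_on A F -> depends_on (predC A) G ->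
  Ex (fun c => F c * G c) = Ex F * Ex G.
Proof.
move=> dF dG.
have -> : Ex F * Ex G = \sum_(u : {ffun I -> V} * {ffun I -> V})
    prod_wt u.1 * prod_wt u.2 * (F u.1 * G u.2).
  rewrite -(pair_bigA _ (fun c c' => prod_wt c * prod_wt c' * (F c * G c'))) /=.
  rewrite /Ex mulr_suml; apply: eq_bigr => c _.
  by rewrite mulr_sumr; apply: eq_bigr => c' _; rewrite mulrACA.
have -> : Ex (fun c => F c * G c) = \sum_(u : {ffun I -> V} * {ffun I -> V})
    prod_wt u.1 * prod_wt u.2 * (F u.1 * G u.1).
  rewrite -(pair_bigA _ (fun c c' => prod_wt c * prod_wt c' * (F c * G c))) /=.
  apply: eq_bigr => c _; rewrite -[LHS]mulr1 -(Ex_cst 1) /Ex mulr_sumr.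
  by apply: eq_bigr => c' _; rewrite mulr1 mulrAC.
have mixK : involutive (fun u => (mix A u.1 u.2, mix A u.2 u.1)).
  move=> [c c'] /=; congr pair; apply/ffunP => i; rewrite !ffunE;
    by case: (A i).
rewrite (reindex _ (onW_bij _ (inv_bij mixK))) /=; apply: eq_bigr => -[c c'] _ /=.
congr (_ * (_ * _)).
- rewrite /prod_wt -!big_split /=; apply: eq_bigr => i _.
  by rewrite !ffunE; case: ifP => // _; rewrite mulrC.
- by apply: dF => i Ai; rewrite ffunE Ai.
- by apply: dG => i /negbTE nAi; rewrite ffunE nAi.
Qed.

Lemma Ex_pair_indep A F G : depends_on A F -> depends_on (predC A) G ->
  Ex (fun c => (F c - Ex F) * (G c - Ex G)) = 0.
Proof.
move=> dF dG; rewrite (Ex_indep (A := A)); first by rewrite ExB Ex_cst subrr mul0r.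
- by move=> c c' cc'; rewrite (dF c c').
- by move=> c c' cc'; rewrite (dG c c').
Qed.

End ProductExpectation.

(** * Running maxima and a discrete Gronwall lemma *)

Section RunningMax.
Variable R : realType.

Fixpoint runmax (M : nat -> R) n : R :=
  if n is n'.+1 then Num.max (runmax M n') (M n'.+1) else M 0%N.

Lemma runmax_ge M n k : (k <= n)%N -> M k <= runmax M n.
Proof.
elim: n => [|n IH]; first by rewrite leqn0 => /eqP ->.
rewrite leq_eqVlt => /orP[/eqP ->|kn] /=; first by rewrite le_max lexx orbT.
by rewrite le_max IH.
Qed.

Lemma runmax_le M n B : (forall k, (k <= n)%N -> M k <= B) -> runmax M n <= B.
Proof.
elim: n => [|n IH] H /=; first exact: H.
by rewrite ge_max IH ?H // => k kn; apply: H; apply: leqW.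
Qed.

Lemma runmax_ext M M' n : (forall k, (k <= n)%N -> M k = M' k) -> runmax M n = runmax M' n.
Proof.
elim: n => [|n IH] H /=; first exact: H.
by rewrite IH ?H // => k kn; apply: H; apply: leqW.
Qed.

(* Pathwise form of Doob's L2 inequality: the last sum is a martingale
   transform, so it has mean zero when [M] is a martingale. *)
Lemma runmax_sqr_le (M : nat -> R) n : M 0%N = 0 ->
  (runmax M n) ^+ 2 <=
  4 * (M n) ^+ 2 - 4 * \sum_(k < n) runmax M k * (M k.+1 - M k).
Proof.
move=> M0.
(* Summation by parts: when the maximum moves it moves to the current value of [M], and the slack
   gained there is the square of its increase. *)
have : (runmax M n) ^+ 2 <=
  2 * (runmax M n * M n) - 2 * \sum_(k < n) runmax M k * (M k.+1 - M k).
  elim: n => [|n IH] /=; first by rewrite big_ord0 M0; lra.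
  rewrite big_ord_recr /=; move: IH.
  set S := runmax M n; set m := M n; set m' := M n.+1; set s := \sum_(_ < _) _.
  move=> IH; rewrite maxEle; case: ifP => _.
  - have := sqr_ge0 (m' - S); move: IH; rewrite !expr2; nra.
  - by move: IH; rewrite !expr2; nra.
set S := runmax M n; set s := \sum_(_ < _) _ => H.
(* [2 S M <= S^2 / 2 + 2 M^2]: half of the left side is absorbed, and doubling gives the constant
   4. *)
have := sqr_ge0 (S - 2 * M n); move: H; rewrite !expr2; nra.
Qed.

End RunningMax.

(* A Gronwall argument for a family of sequences, each of them controlled by
   the maximum over the family. *)
Lemma discrete_gronwall (R : realType) (T : Type) (g : T -> nat -> R) (m : nat) (A c : R) :
  (forall k (u : nat -> R), (k <= m)%N ->
     (forall i b, (i < k)%N -> g b i <= u i) ->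
     forall a, g a k <= A + c * \sum_(i < k) u i) ->
  forall k a, (k <= m)%N -> g a k <= A * (1 + c) ^+ k.
Proof.
move=> H k; elim/ltn_ind: k => k IH a km.
apply: le_trans (H k (fun i => A * (1 + c) ^+ i) km _ a) _.
  by move=> i b ik; apply: IH => //; apply: leq_trans km; apply: ltnW.
(* The geometric sequence solves the recursion with equality. *)
rewrite le_eqVlt; apply/orP; left; apply/eqP.
elim: k {IH km} => [|k IH]; first by rewrite big_ord0 mulr0 addr0 expr0 mulr1.
rewrite big_ord_recr /= mulrDr addrA IH exprS; ring.
Qed.

(** * Grid schemes *)

Section Schemes.
Variable R : realType.
Implicit Types (thr : R -> nat) (x h : R).

Lemma normr_sgnO o : `|sgnO o : R| = 1.
Proof. by case: o; rewrite /sgnO ?normrN normr1. Qed.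

Lemma normr_sgnOM o x : `|sgnO o * x| = `|x|.
Proof. by rewrite normrM normr_sgnO mul1r. Qed.

Lemma sum_bool (F : bool -> R) : \sum_(o : bool) F o = F true + F false.
Proof. by rewrite big_bool. Qed.

(* [oc o j]: an atom of sign [o] is present in the [j]-th level cell; [thr x] is
   the number of level cells lying below the rate at [x]. *)
Definition spikes thr x (oc : bool -> nat -> bool) (o : bool) : bool :=
  has (oc o) (iota 0 (thr (sgnO o * x))).

Definition fires thr x oc := spikes thr x oc true || spikes thr x oc false.

(* A firing strip forgets its own drift, which costs O(2^-n) since the atoms of
   a strip are eventually unique. *)
Fixpoint limit_scheme thr (D : nat -> R) x0 (oc : bool -> nat -> nat -> bool) k : R :=
  if k is k'.+1 then
    let x := limit_scheme thr D x0 oc k' in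
    if fires thr x (fun o => oc o k') then 0 else x + D k'
  else x0.

Definition input (A : finType) thr h (y : A -> R) (oc : A -> bool -> nat -> bool) (a : A) : R :=
  h / #|A|%:R * \sum_(o : bool) \sum_(b | b != a) sgnO o * (spikes thr (y b) (oc b) o)%:R.

Fixpoint actor_scheme (A : finType) thr h (x0 : A -> R)
    (oc : A -> bool -> nat -> nat -> bool) k (a : A) : R :=
  if k is k'.+1 then
    let y := actor_scheme thr h x0 oc k' in
    if fires thr (y a) (fun o => oc a o k') then 0
    else y a + input thr h y (fun b o => oc b o k') a
  else x0 a.

(** * Pathwise bound on the actor scheme *)

Section ActorBound.
Variables (A : finType) (thr : R -> nat) (h L : R) (x0 : A -> R)
  (oc : A -> bool -> nat -> nat -> bool) (J0 : nat).
Hypothesis h_gt0 : 0 < h.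
Hypothesis x0L : forall a, `|x0 a| <= L.
Hypothesis thrJ0 : forall x, `|x| <= 4 * h -> (thr x <= J0)%N.

Let Y := actor_scheme thr h x0 oc.
Let sp k b o := spikes thr (Y k b) (fun o => oc b o k) o.
Let c k : R := \sum_b \sum_(o : bool) (sp k b o)%:R.

(* With [J0] bounding [thr] on [-4h, 4h], this bounds the number of spikes
   emitted from potentials in that interval. *)
Definition small_cells k : R :=
  \sum_(i < k) \sum_(b : A) \sum_(o : bool) \sum_(j < J0) (oc b o i j)%:R.

Let c_ge0 k : 0 <= c k.
Proof. by apply: sumr_ge0 => b _; apply: sumr_ge0 => o _; rewrite ler0n. Qed.

Lemma normr_input (y : A -> R) ock a :
  `|input thr h y ock a| <= h / #|A|%:R * \sum_b \sum_o (spikes thr (y b) (ock b) o)%:R.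
Proof.
have g0 : 0 <= h / #|A|%:R by rewrite divr_ge0 ?ler0n ?ltW.
rewrite /input normrM (ger0_norm g0) ler_wpM2l // exchange_big /=.
apply: le_trans (ler_norm_sum _ _ _) _; rewrite [leRHS](bigD1 a) //=.
rewrite ler_wpDl //; first by apply: sumr_ge0 => o _; rewrite ler0n.
apply: ler_sum => b _; apply: le_trans (ler_norm_sum _ _ _) _.
by apply: ler_sum => o _; rewrite normr_sgnOM ger0_norm ?ler0n.
Qed.

Lemma spikes_small_le (x : R) (ock : bool -> nat -> bool) o : `|x| <= 4 * h ->
  (spikes thr x ock o)%:R <= \sum_(j < J0) (ock o j)%:R :> R.
Proof.
move=> x4; rewrite -natr_sum ler_nat; case: (boolP (spikes _ _ _ _)) => // /hasP[j].
rewrite mem_iota /= add0n => jt oj.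
have jJ : (j < J0)%N by apply: leq_trans jt (thrJ0 _); rewrite normr_sgnOM.
by rewrite (bigD1 (Ordinal jJ)) //= oj.
Qed.

(** Balance of one actor in one strip. Both signs may be occupied in the same strip, so a reset has
    to pay for two spikes at the price [2h] each: this is where the level [4h] comes from. Below
    that level the spikes are charged to the occupied small cells. *)
Let step_b k b :
  (if fires thr (Y k b) (fun o => oc b o k) then 0 else `|Y k b|)
    + 2 * h * \sum_o (sp k b o)%:R
  <= `|Y k b| + 4 * h * \sum_o \sum_(j < J0) (oc b o k j)%:R.
Proof.
have s0 : 0 <= \sum_(o : bool) \sum_(j < J0) (oc b o k j)%:R :> R.
  by apply: sumr_ge0 => o _; apply: sumr_ge0 => j _; rewrite ler0n.
case: (lerP `|Y k b| (4 * h)) => y4.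
  have : \sum_o (sp k b o)%:R <= \sum_o \sum_(j < J0) (oc b o k j)%:R :> R.
    by apply: ler_sum => o _; apply: (spikes_small_le (fun o => oc b o k)).
  move: s0; set s := \sum_o \sum_j _; set t := \sum_o _.
  have t0 : 0 <= t by apply: sumr_ge0 => o _; rewrite ler0n.
  move=> s0 ts; have : h * t <= h * s by rewrite ler_wpM2l // ltW.
  have : 0 <= h * t by rewrite mulr_ge0 // ltW.
  have := normr_ge0 (Y k b); case: ifP => _; lra.
have hs : 0 <= h * \sum_o \sum_(j < J0) (oc b o k j)%:R by rewrite mulr_ge0 // ltW.
move: s0 hs y4; set s := \sum_o \sum_j _; set y := `|Y k b| => s0 hs y4.
rewrite sum_bool /sp /fires; have := h_gt0.
do 2! case: spikes => /=; rewrite ?addr0 ?add0r ?mulr0 ?mulr1; lra.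
Qed.

(** Energy balance. [step_b] sets [2h] aside for each spike, and a spike hands at most [h] to the
    whole population; the [h] left over per spike bounds the total number of spikes. *)
Let total_le k : \sum_a `|Y k a| + h * \sum_(i < k) c i <= #|A|%:R * L + 4 * h * small_cells k.
Proof.
elim: k => [|k IH].
  rewrite /small_cells !big_ord0 !mulr0 !addr0 mulr_natl -sumr_const.
  by apply: ler_sum => a _; apply: x0L.
have A0 (a : A) : (0 : R) < #|A|%:R by rewrite ltr0n; apply/card_gt0P; exists a.
have h1 : \sum_a `|Y k.+1 a| <=
    \sum_a (if fires thr (Y k a) (fun o => oc a o k) then 0 else `|Y k a|) + h * c k.
  have -> : h * c k = \sum_(a : A) (h / #|A|%:R * c k).
    rewrite sumr_const -[RHS]mulr_natl; case: (pickP (mem A)) => [a _|A1].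
      by rewrite mulrA mulrCA divff ?mulr1 ?lt0r_neq0 ?A0.
    by rewrite /c big1 ?mulr0 // => a _; have := A1 a.
  rewrite -big_split /=; apply: ler_sum => a _.
  have gc0 : 0 <= h / #|A|%:R * c k by rewrite mulr_ge0 ?divr_ge0 ?ler0n ?c_ge0 ?ltW.
  rewrite /Y /= -/Y; case: ifP => _; first by rewrite normr0 add0r.
  apply: le_trans (ler_normD _ _) _; rewrite lerD2l.
  exact: (normr_input (Y k) (fun b o => oc b o k)).
have h2 : \sum_a (if fires thr (Y k a) (fun o => oc a o k) then 0 else `|Y k a|)
    + 2 * h * c k <= \sum_a `|Y k a| +
    4 * h * \sum_b \sum_o \sum_(j < J0) (oc b o k j)%:R.
  by rewrite /c !mulr_sumr -!big_split /=; apply: ler_sum => b _; apply: step_b.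
rewrite /small_cells !big_ord_recr /= !mulrDr; move: IH h1 h2; rewrite /small_cells.
clear A0; lra.
Qed.

Lemma small_cells_homo i k : (i <= k)%N -> small_cells i <= small_cells k.
Proof.
move=> ik; rewrite /small_cells -!(big_mkord xpredT (fun i => \sum_b \sum_o \sum_(j < J0) (oc b o i j)%:R)).
rewrite [leRHS](big_cat_nat (n := i)) //= lerDl; apply: sumr_ge0 => l _.
by do 3! (apply: sumr_ge0 => ? _); rewrite ler0n.
Qed.

(** One actor receives at most [h / N] per spike, and [total_le] divided by N bounds this sum by
    another [L] plus the term in the small cells. *)
Lemma actor_scheme_bound k a :
  `|actor_scheme thr h x0 oc k a| <= 2 * L + 4 * h / #|A|%:R * small_cells k.
Proof.
have A0 : (0 : R) < #|A|%:R by rewrite ltr0n; apply/card_gt0P; exists a.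
have g0 : 0 <= h / #|A|%:R by rewrite divr_ge0 ?ler0n ?ltW.
have : `|Y k a| <= L + h / #|A|%:R * \sum_(i < k) c i.
  elim: k => [|k IH]; first by rewrite big_ord0 mulr0 addr0 x0L.
  rewrite /Y /= -/Y big_ord_recr /= mulrDr.
  have gc0 : 0 <= h / #|A|%:R * c k by rewrite mulr_ge0.
  have s0 : 0 <= h / #|A|%:R * \sum_(i < k) c i by rewrite mulr_ge0 ?sumr_ge0.
  case: ifP => _.
    rewrite normr0; have := le_trans (normr_ge0 _) IH; lra.
  apply: le_trans (ler_normD _ _) _; rewrite addrA lerD //.
  exact: (normr_input (Y k) (fun b o => oc b o k)).
move=> /le_trans; apply.
have := total_le k; rewrite -(ler_pM2l (x := #|A|%:R^-1)) ?invr_gt0 //.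
have : 0 <= #|A|%:R^-1 * \sum_a `|Y k a|.
  by rewrite mulr_ge0 ?invr_ge0 ?ler0n ?sumr_ge0.
rewrite !mulrDr (mulKf (lt0r_neq0 A0)).
have -> : 4 * h / #|A|%:R * small_cells k = #|A|%:R^-1 * (4 * h * small_cells k) by ring.
have -> : h / #|A|%:R * \sum_(i < k) c i = #|A|%:R^-1 * (h * \sum_(i < k) c i) by ring.
lra.
Qed.

End ActorBound.

Lemma eq_spikes thr thr' (x : R) oc oc' o :
  (forall o, thr (sgnO o * x) = thr' (sgnO o * x)) ->
  (forall o j, (j < thr (sgnO o * x)%R)%N -> oc o j = oc' o j) ->
  spikes thr x oc o = spikes thr' x oc' o.
Proof.
move=> ht ho; rewrite /spikes -ht; apply: eq_in_has => j.
by rewrite mem_iota add0n => /andP[_]; apply: ho.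
Qed.

Lemma eq_fires thr thr' (x : R) oc oc' :
  (forall o, thr (sgnO o * x) = thr' (sgnO o * x)) ->
  (forall o j, (j < thr (sgnO o * x)%R)%N -> oc o j = oc' o j) ->
  fires thr x oc = fires thr' x oc'.
Proof. by move=> ht ho; rewrite /fires; do 2! rewrite (eq_spikes _ ht ho). Qed.

(** A scheme confined to the range where two thresholds agree cannot tell them apart; this is how
    the clipping level of the rate is changed. *)
Lemma eq_actor_scheme (A : finType) thr thr' h (x0 : A -> R) oc oc' n B :
  (forall k a, (k < n)%N -> `|actor_scheme thr h x0 oc k a| <= B) ->
  (forall x, `|x| <= B -> thr x = thr' x) ->
  (forall k a o j x, (k < n)%N -> (j < thr x)%N -> oc a o k j = oc' a o k j) ->
  forall k a, (k <= n)%N -> actor_scheme thr h x0 oc k a = actor_scheme thr' h x0 oc' k a.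
Proof.
move=> HB ht ho k; elim: k => //= k IH a kn.
have E b o : spikes thr (actor_scheme thr h x0 oc k b) (fun o => oc b o k) o =
    spikes thr' (actor_scheme thr' h x0 oc' k b) (fun o => oc' b o k) o.
  rewrite -IH ?(ltnW kn) //; apply: eq_spikes => [ o'|o' j jt].
    by apply: ht; rewrite normr_sgnOM HB.
  exact: ho jt.
rewrite /fires !E IH ?(ltnW kn) //; case: ifP => // _; congr (_ + _ * _).
by apply: eq_bigr => o _; apply: eq_bigr => b _; rewrite E.
Qed.

Lemma limit_scheme_bound thr D x0 oc L k : `|x0| <= L ->
  `|limit_scheme thr D x0 oc k| <= L + \sum_(i < k) `|D i|.
Proof.
move=> x0L; elim: k => [|k IH] /=; first by rewrite big_ord0 addr0.
rewrite big_ord_recr /= addrA; case: ifP => _.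
  by rewrite normr0 addr_ge0 // (le_trans _ IH).
by rewrite (le_trans (ler_normD _ _)) // lerD2r.
Qed.

End Schemes.

(* After a common reset the two sequences differ by a difference of partial
   sums of [d - e]; a reset of only one of them is paid by the crude bound [B]. *)
Lemma reset_comparison (R : realType) (x y d e : nat -> R) (f g : nat -> bool) (n : nat) (B P : R) :
  (forall k, x k.+1 = if f k then 0 else x k + d k) ->
  (forall k, y k.+1 = if g k then 0 else y k + e k) ->
  0 <= B -> (forall k, (k <= n)%N -> `|x k - y k| <= B) ->
  (forall k, (k <= n)%N -> `|\sum_(i < k) (d i - e i)| <= P) ->
  forall k, (k <= n)%N ->
  `|x k - y k| <= `|x 0%N - y 0%N| + 2 * P + B * \sum_(i < k) (f i != g i)%:R.
Proof.
move=> xS yS B0 xyB HP.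
have P0 : 0 <= P by apply: le_trans (HP 0%N _).
pose S k := \sum_(i < k) (d i - e i).
(* Either a mismatch has occurred, or there was no reset so far, or [r] marks the last common reset.
   The third case involves two partial sums, hence the factor 2 of [P]. *)
have key k : (k <= n)%N -> 1 <= \sum_(i < k) (f i != g i)%:R :> R \/
    (x k - y k = x 0%N - y 0%N + S k) \/ exists2 r, (r <= k)%N & x k - y k = S k - S r.
  elim: k => [|k IH] kn; first by right; left; rewrite /S big_ord0 addr0.
  rewrite big_ord_recr /=; have [fg|fg] := eqVneq (f k) (g k); last first.
    by left; rewrite lerDr; apply: sumr_ge0 => i _; rewrite ler0n.
  rewrite addr0 xS yS -fg; case: (IH (ltnW kn)) => [H|H]; [by left|right].
  case: (f k); first by right; exists k.+1; rewrite ?subrr.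
  have SS : S k.+1 = S k + (d k - e k) by rewrite /S big_ord_recr.
  case: H => [H|[r rk H]]; [left|right; exists r; first exact: leqW].
    by rewrite SS addrA -H; ring.
  have -> : x k + d k - (y k + e k) = (x k - y k) + (d k - e k) by ring.
  by rewrite H SS; ring.
move=> k kn.
have s0 : 0 <= \sum_(i < k) (f i != g i)%:R :> R by apply: sumr_ge0 => i _; rewrite ler0n.
have Bs0 := mulr_ge0 B0 s0.
have n0 := normr_ge0 (x 0%N - y 0%N).
case: (key k kn) => [H|[H|[r rk H]]].
- apply: le_trans (xyB k kn) _; have := ler_wpM2l B0 H; rewrite mulr1; lra.
- rewrite H; apply: le_trans (ler_normD _ _) _; have := HP k kn; rewrite -/(S k); lra.
- rewrite H; apply: le_trans (ler_normB _ _) _.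
  have := HP k kn; have := HP r (leq_trans rk kn); rewrite -/(S k) -/(S r); lra.
Qed.

(** * The self-consistent scheme on random inputs *)

Section RandomSchemes.
Variables (R : realType) (A : finType) (m J q : nat).
Let Idx : finType := (A * option (bool * 'I_m * 'I_J))%type.
Let V : finType := 'I_q.+2.
Implicit Types (c : {ffun Idx -> V}) (a b : A).

Variables (p0 : option (bool * 'I_m * 'I_J) -> V -> R) (rate : R).
Let p (i : Idx) := p0 i.2.
Hypothesis p0_ge0 : forall i v, 0 <= p0 i v.
Hypothesis p0_sum1 : forall i, \sum_v p0 i v = 1.
Hypothesis p0_rate : forall x, \sum_(v | v != ord0) p0 (Some x) v = rate.

Let p_ge0 i v : 0 <= p i v. Proof. exact: p0_ge0. Qed.
Let p_sum1 i : \sum_v p i v = 1. Proof. exact: p0_sum1. Qed.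

(** Strips and levels are natural numbers, as the schemes expect; outside the finite grid no cell is
    occupied. *)
Definition occ c a o k j : bool :=
  match insub k : option 'I_m, insub j : option 'I_J with
  | Some k', Some j' => c (a, Some (o, k', j')) != ord0
  | _, _ => false
  end.

Lemma occE c a o (k : 'I_m) (j : 'I_J) : occ c a o k j = (c (a, Some (o, k, j)) != ord0).
Proof. by rewrite /occ !valK. Qed.

(** [before k] plays the role of the sigma-algebra at the start of the strip [k]. [off_strip a k] is
    larger, with the other actors and the future included, but remains independent of the cells that
    decide whether [a] spikes in the strip [k]. *)
Definition off_strip a k : pred Idx :=
  fun i => if i is (a', Some (_, k', _)) then ~~ ((a' == a) && (k' == k :> nat)) else true.

Definition before k : pred Idx :=
  fun i => if i is (_, Some (_, k', _)) then (k' < k)%N else true.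

Lemma occ_eq (Q : pred Idx) c c' a o k j : (forall i, Q i -> c i = c' i) ->
  (forall (k' : 'I_m) (j' : 'I_J), k' = k :> nat -> j' = j :> nat -> Q (a, Some (o, k', j'))) ->
  occ c a o k j = occ c' a o k j.
Proof.
move=> cc' H; rewrite /occ; case: insubP => // k' _ k'k; case: insubP => // j' _ j'j.
by rewrite cc' // H.
Qed.

Lemma before_off a k : {subset before k <= off_strip a k}.
Proof.
move=> [a' [[[ o k'] j]|]] //; rewrite /in_mem /= => kk.
by rewrite negb_and orbC neq_ltn kk.
Qed.

Lemma depends_onS (T : Type) (Q Q' : pred Idx) (F : {ffun Idx -> V} -> T) :
  {subset Q <= Q'} -> depends_on Q F -> depends_on Q' F.
Proof. by move=> QQ' dF c c' cc'; apply: dF => i Qi; apply: cc'; apply: QQ'. Qed.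

Hypothesis rate01 : 0 <= rate <= 1.
Let rate_ge0 : 0 <= rate. Proof. by case/andP: rate01. Qed.
Let rate_le1 : rate <= 1. Proof. by case/andP: rate01. Qed.

Lemma Ex_occ a o k j : (k < m)%N -> (j < J)%N ->
  Ex p (fun c => (occ c a o k j)%:R) = rate.
Proof.
move=> km jJ; pose i : Idx := (a, Some (o, Ordinal km, Ordinal jJ)).
pose f : V -> R := fun v => (v != ord0)%:R.
have -> : Ex p (fun c => (occ c a o k j)%:R) = Ex p (fun c => f (c i)).
  by apply: eq_Ex => c; rewrite -[k]/(nat_of_ord (Ordinal km)) -[j]/(nat_of_ord (Ordinal jJ)) occE.
rewrite /Ex /prod_wt.
pose g (i' : Idx) (v : V) := if i' == i then p i' v * f v else p i' v.
transitivity (\sum_(c : {ffun Idx -> V}) \prod_i' g i' (c i')).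
  apply: eq_bigr => c _; rewrite (bigD1 i) //= [RHS](bigD1 i) //= /g eqxx.
  rewrite mulrAC; congr (_ * _).
  by apply: eq_bigr => i' ni; rewrite (negbTE ni).
rewrite -(bigA_distr_bigA g) (bigD1 i) //= [X in _ * X]big1 ?mulr1; last first.
  by move=> i' ni; rewrite /g (negbTE ni) p_sum1.
rewrite /g eqxx -(p0_rate (o, Ordinal km, Ordinal jJ)) [RHS]big_mkcond /=.
by apply: eq_bigr => v _; rewrite /f; case: ifP => _; rewrite ?mulr1 ?mulr0.
Qed.

Lemma Ex_occM F a o (k : 'I_m) (j : 'I_J) :
  depends_on [pred i : Idx | i != (a, Some (o, k, j))] F ->
  Ex p (fun c => F c * (occ c a o k j)%:R) = Ex p F * rate.
Proof.
move=> dF; rewrite (Ex_indep p_sum1 (A := [pred i : Idx | i != (a, Some (o, k, j))])) //.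
  by rewrite Ex_occ.
by move=> c c' cc'; rewrite !occE cc' //= negbK.
Qed.

Variable thr : R -> nat.
Hypothesis thrJ : forall x, (thr x <= J)%N.

(** The probability that one at least of [thr x] independent cells is occupied. *)
Definition fire_prob (x : R) : R := 1 - (1 - rate) ^+ thr x.

Lemma Ex_no_occ F a o (k : 'I_m) v : (v <= J)%N -> depends_on (off_strip a k) F ->
  Ex p (fun c => F c * \prod_(j < v) (1 - (occ c a o k j)%:R)) = Ex p F * (1 - rate) ^+ v.
Proof.
move=> + dF; elim: v => [|v IH] vJ.
  by rewrite expr0 mulr1; apply: eq_Ex => c; rewrite big_ord0 mulr1.
pose G c := F c * \prod_(j < v) (1 - (occ c a o k j)%:R).
transitivity (Ex p (fun c => G c - G c * (occ c a o k (Ordinal vJ))%:R)).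
  by apply: eq_Ex => c; rewrite big_ord_recr /= mulrA mulrBr mulr1.
rewrite ExB Ex_occM; last first.
  move=> c c' cc'; rewrite /G; congr (_ * _).
    apply: dF => i H; apply: cc'; apply: contraTneq H => -> /=.
    by rewrite !eqxx.
  apply: eq_bigr => j _; congr (1 - _%:R); congr nat_of_bool.
  apply: (occ_eq cc') => k' j' kk jj /=; apply/eqP => -[_ jv].
  by have := ltn_ord j; rewrite -jj jv /= ltnn.
by rewrite IH ?(ltnW vJ) // exprS; ring.
Qed.

Lemma spikes_prod c a (k : nat) o (x : R) :
  (spikes thr x (fun o => occ c a o k) o)%:R =
  1 - \prod_(j < thr (sgnO o * x)) (1 - (occ c a o k j)%:R) :> R.
Proof.
case: (boolP (spikes _ _ _ _)) => [/hasP[j]|/hasPn H].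
  rewrite mem_iota add0n /= => jt oj.
  by rewrite (bigD1 (Ordinal jt)) //= oj subrr mul0r subr0.
rewrite big1 ?subrr // => j _; rewrite (negbTE (H j _)) ?subr0 //.
by rewrite mem_iota add0n /=.
Qed.

(** The compensator identity. The number of cells to be read is random, but it is determined outside
    the strip: on each event where it takes a given value [v], the [v] cells are independent of
    everything else in the integrand. *)
Lemma Ex_spikesM F (x : {ffun Idx -> V} -> R) a o (k : 'I_m) :
  depends_on (off_strip a k) F -> depends_on (off_strip a k) x ->
  Ex p (fun c => F c * (spikes thr (x c) (fun o => occ c a o k) o)%:R) =
  Ex p (fun c => F c * fire_prob (sgnO o * x c)).
Proof.
move=> dF dx; pose t c := thr (sgnO o * x c).
have H1 : Ex p (fun c => F c * \prod_(j < t c) (1 - (occ c a o k j)%:R)) =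
          Ex p (fun c => F c * (1 - rate) ^+ t c).
  transitivity (Ex p (fun c => \sum_(v < J.+1)
      (F c * (t c == v)%:R) * \prod_(j < v) (1 - (occ c a o k j)%:R))).
    apply: eq_Ex => c; have tJ : (t c < J.+1)%N by rewrite ltnS thrJ.
    rewrite (bigD1 (Ordinal tJ)) //= eqxx mulr1 [X in _ = _ + X]big1 ?addr0 // => v vt.
    rewrite (_ : (t c == v) = false) ?mulr0 ?mul0r //.
    by apply: contraNF vt => /eqP tv; apply/eqP/val_inj.
  transitivity (Ex p (fun c => \sum_(v < J.+1) (F c * (t c == v)%:R) * (1 - rate) ^+ v)).
    rewrite !Ex_sum; apply: eq_bigr => v _.
    have dt : depends_on (off_strip a k) (fun c => F c * (t c == v)%:R).
      by move=> c c' cc'; rewrite /t (dF _ _ cc') (dx _ _ cc').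
    have vJ : (v <= J)%N by rewrite -ltnS.
    rewrite (Ex_no_occ o vJ dt) mulrC -ExZ; apply: eq_Ex => c; exact: mulrC.
  apply: eq_Ex => c; have tJ : (t c < J.+1)%N by rewrite ltnS thrJ.
  rewrite (bigD1 (Ordinal tJ)) //= eqxx mulr1 [X in _ + X]big1 ?addr0 // => v vt.
  rewrite (_ : (t c == v) = false) ?mulr0 ?mul0r //.
  by apply: contraNF vt => /eqP tv; apply/eqP/val_inj.
transitivity (Ex p F - Ex p (fun c => F c * \prod_(j < t c) (1 - (occ c a o k j)%:R))).
  by rewrite -ExB; apply: eq_Ex => c; rewrite spikes_prod mulrBr mulr1.
by rewrite H1 -ExB; apply: eq_Ex => c; rewrite /fire_prob mulrBr mulr1.
Qed.

Lemma Ex_spikes (x : {ffun Idx -> V} -> R) a o (k : 'I_m) :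
  depends_on (off_strip a k) x ->
  Ex p (fun c => (spikes thr (x c) (fun o => occ c a o k) o)%:R) =
  Ex p (fun c => fire_prob (sgnO o * x c)).
Proof.
move=> dx; transitivity (Ex p (fun c => 1 * (spikes thr (x c) (fun o => occ c a o k) o)%:R)).
  by apply: eq_Ex => c; rewrite mul1r.
by rewrite Ex_spikesM //; apply: eq_Ex => c; rewrite mul1r.
Qed.

Lemma fire_prob_ge0 x : 0 <= fire_prob x.
Proof. by rewrite subr_ge0 exprn_ile1 ?subr_ge0 // gerBl. Qed.

Lemma fire_prob_dist x y :
  `|fire_prob x - fire_prob y| <= rate * `|(thr x)%:R - (thr y)%:R|.
Proof.
have u0 : 0 <= 1 - rate by rewrite subr_ge0.
have u1 : 1 - rate <= 1 by rewrite gerBl.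
have key n l : (1 - rate) ^+ n - (1 - rate) ^+ (n + l) <= rate * l%:R.
  elim: l => [|l IH]; first by rewrite addn0 subrr mulr0.
  rewrite addnS exprSr -addn1 natrD.
  have : (1 - rate) ^+ (n + l) * rate <= rate.
    by rewrite ler_piMl // exprn_ile1.
  move: IH; lra.
have mono n l : (1 - rate) ^+ (n + l) <= (1 - rate) ^+ n by rewrite ler_wiXn2l // leq_addr.
rewrite /fire_prob; case: (leqP (thr x) (thr y)) => [le|/ltnW le].
  have := key (thr x) (thr y - thr x)%N; have := mono (thr x) (thr y - thr x)%N.
  rewrite subnKC // natrB // => h1 h2.
  rewrite distrC ger0_norm; last by move: h1; lra.
  rewrite [`|_%:R - _|]distrC [`|_%:R - _|]ger0_norm ?subr_ge0 ?ler_nat //; move: h2; lra.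
have := key (thr y) (thr x - thr y)%N; have := mono (thr y) (thr x - thr y)%N.
rewrite subnKC // natrB // => h1 h2.
rewrite ger0_norm; last by move: h1; lra.
rewrite [`|_%:R - _|]ger0_norm ?subr_ge0 ?ler_nat //; move: h2; lra.
Qed.

Lemma fire_prob_le x : fire_prob x <= rate * (thr x)%:R.
Proof.
have u1 : 1 - rate <= 1 by rewrite gerBl.
have u0 : 0 <= 1 - rate by rewrite subr_ge0.
rewrite /fire_prob; elim: (thr x) => [|n IH]; first by rewrite expr0 subrr mulr0.
have : (1 - rate) ^+ n * rate <= rate by rewrite ler_piMl // exprn_ile1.
rewrite exprSr -addn1 natrD; move: IH; lra.
Qed.

(** Two decisions read off the same cells differ only if a cell between the two thresholds is
    occupied, and this band of cells is determined outside the strip. *)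
Lemma Ex_spikes_dist (x y : {ffun Idx -> V} -> R) a o (k : 'I_m) :
  depends_on (off_strip a k) x -> depends_on (off_strip a k) y ->
  Ex p (fun c => (spikes thr (x c) (fun o => occ c a o k) o
                 != spikes thr (y c) (fun o => occ c a o k) o)%:R) <=
  Ex p (fun c => rate * `|(thr (sgnO o * x c))%:R - (thr (sgnO o * y c))%:R|).
Proof.
move=> dx dy; pose tx c := thr (sgnO o * x c); pose ty c := thr (sgnO o * y c).
pose B c (j : 'I_J) : bool := (minn (tx c) (ty c) <= j < maxn (tx c) (ty c))%N.
apply: (@le_trans _ _ (Ex p (fun c => \sum_(j < J) (B c j)%:R * (occ c a o k j)%:R))).
  apply: le_Ex => // c.
  have S0 : 0 <= \sum_(j < J) (B c j)%:R * (occ c a o k j)%:R :> R.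
    by apply: sumr_ge0 => j _; rewrite mulr_ge0 ?ler0n.
  case: eqVneq => //= neq.
  have [j Bj oj] : exists2 j : 'I_J, B c j & occ c a o k j.
    have aux u v : has (fun j => occ c a o k j) (iota 0 (thr u)) ->
        ~~ has (fun j => occ c a o k j) (iota 0 (thr v)) ->
        exists2 j : 'I_J, (minn (thr u) (thr v) <= j < maxn (thr u) (thr v))%N & occ c a o k j.
      move=> /hasP[j]; rewrite mem_iota add0n /= => ju oj /hasPn H.
      have jJ : (j < J)%N by apply: leq_trans ju (thrJ _).
      exists (Ordinal jJ) => //=; rewrite geq_min leq_max ju /= andbT orbC leqNgt.
      have -> : (j < thr v)%N = false; last by [].
      by apply/negP => jv; have := H j; rewrite mem_iota add0n /= jv oj => /(_ isT).
    move: neq; rewrite /spikes.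
    case: (boolP (has _ _)) => H1; case: (boolP (has _ _)) => H2 // _.
      exact: aux.
    by have [j Bj oj] := aux _ _ H2 H1; exists j; rewrite // /B minnC maxnC.
  rewrite (bigD1 j) //= Bj oj mulr1 lerDl.
  by apply: sumr_ge0 => i _; rewrite mulr_ge0 ?ler0n.
rewrite Ex_sum ExZ.
have -> : Ex p (fun c => `|(tx c)%:R - (ty c)%:R|) = \sum_(j < J) Ex p (fun c => (B c j)%:R).
  rewrite -Ex_sum; apply: eq_Ex => c; rewrite -natr_sum.
  have -> : (\sum_(j < J) B c j = maxn (tx c) (ty c) - minn (tx c) (ty c))%N.
    rewrite -(big_mkord xpredT (fun j => nat_of_bool (minn (tx c) (ty c) <= j < maxn (tx c) (ty c))%N)).
    rewrite -big_mkcond /= sum1_count -[RHS](size_iota (minn (tx c) (ty c))).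
    rewrite -size_filter; apply: perm_size; apply: uniq_perm.
    - by rewrite filter_uniq // iota_uniq.
    - by rewrite iota_uniq.
    - move=> j; rewrite mem_filter !mem_iota add0n subn0 /= subnKC; last first.
        by rewrite leq_max geq_min leqnn.
      rewrite andbC; case: (boolP (_ && (j < maxn _ _)%N)) => //=; rewrite ?andbF // => /andP[_ jm].
      by rewrite andbT (leq_trans jm) // geq_max !thrJ.
  case: (leqP (tx c) (ty c)) => [le|/ltnW le].
    by rewrite natrB // distrC ger0_norm // subr_ge0 ler_nat.
  by rewrite natrB // ger0_norm // subr_ge0 ler_nat.
rewrite mulr_sumr; apply: ler_sum => j _.
have dB : depends_on [pred i : Idx | i != (a, Some (o, k, j))] (fun c => (B c j)%:R : R).
  move=> c c' cc'.
  have cc'' i : off_strip a k i -> c i = c' i.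
    by move=> H; apply: cc'; apply: contraTneq H => -> /=; rewrite !eqxx.
  by rewrite /B /tx /ty (dx c c' cc'') (dy c c' cc'').
by rewrite (Ex_occM dB) mulrC.
Qed.

Variables (x0 : V -> R) (L h : R).
Hypothesis x0L : forall v, `|x0 v| <= L.
Hypothesis h_gt0 : 0 < h.

Definition init c a : R := x0 (c (a, None)).

(* The limit equation on the grid: the expectation under [p] is that of the
   scheme itself. *)
Fixpoint mean_field k c a : R :=
  if k is k'.+1 then
    if fires thr (mean_field k' c a) (fun o => occ c a o k') then 0
    else mean_field k' c a +
      h * \sum_(o : bool) sgnO o * Ex p (fun c => fire_prob (sgnO o * mean_field k' c a))
  else init c a.

Definition mf_drift a k : R :=
  h * \sum_(o : bool) sgnO o * Ex p (fun c => fire_prob (sgnO o * mean_field k c a)).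

Lemma mean_field_limit k c a :
  mean_field k c a = limit_scheme thr (mf_drift a) (init c a) (occ c a) k.
Proof. by elim: k => //= k ->. Qed.

Lemma fires_eq (Q : pred Idx) c c' a k (x : R) : (forall i, Q i -> c i = c' i) ->
  (forall o (k' : 'I_m) (j' : 'I_J), k' = k :> nat -> Q (a, Some (o, k', j'))) ->
  (forall o, spikes thr x (fun o => occ c a o k) o = spikes thr x (fun o => occ c' a o k) o).
Proof.
move=> cc' HQ o; apply: eq_spikes => // o' j _.
by apply: (occ_eq cc') => k' j' kk _; apply: HQ.
Qed.

Lemma limit_scheme_depends (Q : pred Idx) D k a : Q (a, None) ->
  (forall o (k' : 'I_m) (j' : 'I_J), (k' < k)%N -> Q (a, Some (o, k', j'))) ->
  depends_on Q (fun c => limit_scheme thr D (init c a) (occ c a) k).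
Proof.
move=> Q0; elim: k => [|k IH] HQ c c' cc' /=; first by rewrite /init cc'.
rewrite (IH _ c c' cc'); last by move=> o k' j' kk; apply: HQ; apply: ltnW.
set x := limit_scheme _ _ _ _ _.
have E o : spikes thr x (fun o => occ c a o k) o = spikes thr x (fun o => occ c' a o k) o.
  by apply: (fires_eq _ cc') => o' k' j' kk; apply: HQ; rewrite kk.
by rewrite /fires !E.
Qed.

Lemma mean_field_depends (Q : pred Idx) k a : Q (a, None) ->
  (forall o (k' : 'I_m) (j' : 'I_J), (k' < k)%N -> Q (a, Some (o, k', j'))) ->
  depends_on Q (fun c => mean_field k c a).
Proof.
by move=> Q0 HQ c c' cc'; rewrite !mean_field_limit; apply: limit_scheme_depends cc'.
Qed.

Lemma actor_scheme_depends k a :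
  depends_on (before k) (fun c => actor_scheme thr h (init c) (occ c) k a).
Proof.
elim: k a => [|k IH] a c c' cc' /=; first by rewrite /init cc'.
have cck i : before k i -> c i = c' i.
  move=> H; apply: cc'; move: i H => [a' [[[ o i] j]|]] //=.
  by move/leqW.
have E b o : spikes thr (actor_scheme thr h (init c) (occ c) k b) (fun o => occ c b o k) o =
    spikes thr (actor_scheme thr h (init c') (occ c') k b) (fun o => occ c' b o k) o.
  rewrite (IH b c c' cck); apply: (fires_eq (a := b) _ cc').
  by move=> o' k' j' /= ->.
rewrite /fires !E (IH a c c' cck); case: ifP => // _; congr (_ + _ * _).
by apply: eq_bigr => o _; apply: eq_bigr => b _; rewrite E.
Qed.

Let sw a b (i : Idx) : Idx := (tperm a b i.1, i.2).

(** Exchangeability: the weights do not look at the actor, so the drift, being an expectation, is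
    common to all actors, and the scheme of [a] on exchanged inputs is that of [b]. *)
Lemma mean_field_swap a b k c : mean_field k [ffun i => c (sw a b i)] a = mean_field k c b.
Proof.
have swK : involutive (sw a b) by move=> [a' x]; rewrite /sw /= tpermK.
elim: k c => [|k IH] c /=; first by rewrite /init ffunE /sw /= tpermL.
have E o : Ex p (fun c => fire_prob (sgnO o * mean_field k c a)) =
           Ex p (fun c => fire_prob (sgnO o * mean_field k c b)).
  rewrite -[LHS](Ex_reindex (s := sw a b)) //; last exact: inv_bij.
  by apply: eq_Ex => c'; rewrite IH.
rewrite IH; under eq_bigr do rewrite E.
have oc o j : occ [ffun i => c (sw a b i)] a o k j = occ c b o k j.
  rewrite /occ; case: insub => // k'; case: insub => // j'.
  by rewrite ffunE /sw /= tpermL.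
by rewrite (eq_fires (thr' := thr) (oc' := fun o => occ c b o k)).
Qed.

Lemma Ex_mean_field_swap a b k (F : R -> R) :
  Ex p (fun c => F (mean_field k c a)) = Ex p (fun c => F (mean_field k c b)).
Proof.
have swK : involutive (sw a b) by move=> [a' x]; rewrite /sw /= tpermK.
rewrite -[LHS](Ex_reindex (s := sw a b)) //; last exact: inv_bij.
by apply: eq_Ex => c'; rewrite mean_field_swap.
Qed.

(** * Bound on the self-consistent scheme *)

Section MeanFieldBound.
Variable s0 : R.
Hypothesis s0P : forall x, `|x| <= 4 * h -> rate * (thr x)%:R <= s0.

(* A spike at potential larger than [4 h] removes more than twice what it
   sends out on average. *)
Lemma mf_drift_sum a k : (k <= m)%N ->
  h * \sum_(i < k) \sum_(o : bool) Ex p (fun c => fire_prob (sgnO o * mean_field i c a))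
  <= L + 4 * h * k%:R * s0.
Proof.
move=> km; pose e i := \sum_(o : bool) Ex p (fun c => fire_prob (sgnO o * mean_field i c a)).
(* The mean potential is kept in the induction: it is the reserve out of which the drift is paid. *)
suff : Ex p (fun c => `|mean_field k c a|) + h * \sum_(i < k) e i <= L + 4 * h * k%:R * s0.
  by apply: le_trans; rewrite lerDr; apply: Ex_ge0.
elim: k km => [|k IH] km.
  rewrite big_ord0 !mulr0 mul0r !addr0 -(Ex_cst p_sum1 L).
  by apply: le_Ex => // c; apply: x0L.
have e0 : 0 <= e k by apply: sumr_ge0 => o _; apply: Ex_ge0 => // c; apply: fire_prob_ge0.
have Dk : `|mf_drift a k| <= h * e k.
  rewrite /mf_drift normrM (gtr0_norm h_gt0) ler_wpM2l ?(ltW h_gt0) //.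
  apply: le_trans (ler_norm_sum _ _ _) _; apply: ler_sum => o _.
  rewrite normr_sgnOM ger0_norm //; apply: Ex_ge0 => // c; exact: fire_prob_ge0.
have off : depends_on (off_strip a (Ordinal km)) (fun c => mean_field k c a).
  by apply: mean_field_depends => // o k' j' kk; rewrite /= eqxx /= neq_ltn kk.
have offn : depends_on (off_strip a (Ordinal km)) (fun c => `|mean_field k c a|).
  by move=> c c' cc'; rewrite (off c c' cc').
(* Above [4h] the loss at a reset is worth [4h] per unit of firing probability; below, the
   probability itself is at most [s0]. *)
have H o : 4 * h * Ex p (fun c => fire_prob (sgnO o * mean_field k c a)) - 4 * h * s0 <=
   Ex p (fun c => `|mean_field k c a| * (spikes thr (mean_field k c a) (fun o => occ c a o k) o)%:R).
  rewrite (Ex_spikesM o offn off) -ExZ -(Ex_cst p_sum1 (4 * h * s0)) -ExB.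
  apply: le_Ex => // c; set x := mean_field k c a.
  have f0 := fire_prob_ge0 (sgnO o * x).
  case: (lerP `|x| (4 * h)) => xh.
    have : fire_prob (sgnO o * x) <= s0.
      by apply: le_trans (fire_prob_le _) (s0P _); rewrite normr_sgnOM.
    move=> fs; have : 0 <= `|x| * fire_prob (sgnO o * x) by rewrite mulr_ge0.
    have : 4 * h * fire_prob (sgnO o * x) <= 4 * h * s0.
      by rewrite ler_wpM2l // mulr_ge0 // ltW.
    lra.
  have : 4 * h * fire_prob (sgnO o * x) <= `|x| * fire_prob (sgnO o * x).
    by rewrite ler_wpM2r // ltW.
  have : 0 <= 4 * h * s0.
    have h0 : 0 <= 4 * h by rewrite mulr_ge0 // ltW.
    rewrite mulr_ge0 //.
    by apply: le_trans (s0P (x := 0) _); rewrite ?normr0 // mulr_ge0.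
  lra.
(* When both signs spike the sum counts the loss twice, hence the factor 1/2. In the mean this
   removes [2h] per unit of rate, against at most [h] brought by the drift. *)
have step : Ex p (fun c => `|mean_field k.+1 c a|) <= Ex p (fun c => `|mean_field k c a|
    - 2^-1 * \sum_o `|mean_field k c a| * (spikes thr (mean_field k c a) (fun o => occ c a o k) o)%:R
    + `|mf_drift a k|).
  apply: le_Ex => // c; rewrite /= -/(mf_drift a k) sum_bool.
  have n0 := normr_ge0 (mean_field k c a); have d0 := normr_ge0 (mf_drift a k).
  rewrite /fires; case: (spikes _ _ _ true); case: (spikes _ _ _ false);
    rewrite /= ?normr0 ?mulr1 ?mulr0; try lra.
  by have := ler_normD (mean_field k c a) (mf_drift a k); lra.
move: step; rewrite ExD ExB ExZ Ex_sum (Ex_cst p_sum1) !sum_bool => step.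
have := H true; have := H false.
have eE : e k = Ex p (fun c => fire_prob (sgnO true * mean_field k c a)) +
                Ex p (fun c => fire_prob (sgnO false * mean_field k c a)).
  by rewrite /e sum_bool.
have he : h * e k = h * Ex p (fun c => fire_prob (sgnO true * mean_field k c a)) +
                h * Ex p (fun c => fire_prob (sgnO false * mean_field k c a)).
  by rewrite eE mulrDr.
have kk : k.+1%:R = k%:R + 1 :> R by rewrite -addn1 natrD.
have := IH (ltnW km); rewrite big_ord_recr [h * (_ + _)]mulrDr kk.
move: step Dk he; lra.
Qed.

(** The drift is deterministic, so the bound obtained in the mean on its accumulated size holds
    along every path; resets can only help. *)
Lemma mean_field_bound a k c : (k <= m)%N ->
  `|mean_field k c a| <= 2 * L + 4 * h * m%:R * s0.
Proof.
move=> km; rewrite mean_field_limit; apply: le_trans (limit_scheme_bound _ _ _ _ (x0L _)) _.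
have : \sum_(i < k) `|mf_drift a i| <= L + 4 * h * k%:R * s0.
  apply: le_trans (mf_drift_sum a km); rewrite mulr_sumr; apply: ler_sum => i _.
  rewrite /mf_drift normrM (gtr0_norm h_gt0) ler_wpM2l ?(ltW h_gt0) //.
  apply: le_trans (ler_norm_sum _ _ _) _; apply: ler_sum => o _.
  rewrite normr_sgnOM ger0_norm //; apply: Ex_ge0 => // c'; exact: fire_prob_ge0.
have : 4 * h * k%:R * s0 <= 4 * h * m%:R * s0.
  have h0 : 0 <= 4 * h by rewrite mulr_ge0 // ltW.
  rewrite ler_wpM2r //; last by rewrite ler_wpM2l // ler_nat.
  by apply: le_trans (s0P (x := 0) _); rewrite ?normr0 // mulr_ge0.
lra.
Qed.

End MeanFieldBound.

(** * Comparison with the self-consistent scheme *)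

Section Comparison.
Variables (lp beta : R).
Hypothesis lp_ge0 : 0 <= lp.
Hypothesis thr_lip : forall x y, rate * `|(thr x)%:R - (thr y)%:R| <= lp * `|x - y| + beta.

Lemma fires_neq_le (x y : R) oc :
  (fires thr x oc != fires thr y oc)%:R <=
  \sum_(o : bool) (spikes thr x oc o != spikes thr y oc o)%:R :> R.
Proof.
rewrite sum_bool /fires -natrD ler_nat.
by do 4! case: spikes.
Qed.

Lemma sgnO_dist o (x y : R) : `|sgnO o * x - sgnO o * y| = `|x - y|.
Proof. by rewrite -mulrBr normr_sgnOM. Qed.

Lemma Ex_thr_lip (x y : {ffun Idx -> V} -> R) o :
  Ex p (fun c => rate * `|(thr (sgnO o * x c))%:R - (thr (sgnO o * y c))%:R|) <=
  lp * Ex p (fun c => `|x c - y c|) + beta.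
Proof.
rewrite -ExZ -[X in _ <= _ + X](Ex_cst p_sum1) -ExD; apply: le_Ex => // c.
by apply: le_trans (thr_lip _ _) _; rewrite sgnO_dist.
Qed.

(** How far a scheme with prescribed drift is from being self-consistent; it vanishes for
    [mf_drift]. *)
Definition drift_defect (D : nat -> R) a : R :=
  \sum_(i < m) `|D i - h * \sum_(o : bool) sgnO o *
    Ex p (fun c => fire_prob (sgnO o * limit_scheme thr D (init c a) (occ c a) i))|.

(** [reset_comparison] leaves two costs. The drifts differ by the defect plus [2h] times the
    Lipschitz error of one step, and this counts twice; mismatched resets cost [B] for either sign.
    Hence the coefficient [4h + 2B], on which Gronwall acts. *)
Lemma limit_mean_field_dist (D : nat -> R) a (B : R) : 0 <= B ->
  (forall c k, (k <= m)%N ->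
     `|limit_scheme thr D (init c a) (occ c a) k - mean_field k c a| <= B) ->
  Ex p (fun c => runmax (fun k =>
    `|limit_scheme thr D (init c a) (occ c a) k - mean_field k c a|) m) <=
  (2 * drift_defect D a + (4 * h + 2 * B) * m%:R * beta) * (1 + (4 * h + 2 * B) * lp) ^+ m.
Proof.
move=> B0 XB; set rho := drift_defect D a.
pose X k c := limit_scheme thr D (init c a) (occ c a) k.
pose g (_ : unit) k := Ex p (fun c => runmax (fun k => `|X k c - mean_field k c a|) k).
suff H : forall k (u : nat -> R), (k <= m)%N ->
    (forall i (b : unit), (i < k)%N -> g b i <= u i) ->
    forall b : unit, g b k <= (2 * rho + (4 * h + 2 * B) * m%:R * beta) +
       (4 * h + 2 * B) * lp * \sum_(i < k) u i.
  exact: (discrete_gronwall H tt (leqnn m)).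
move=> k u km gu [].
have Xoff i (ki : (i < m)%N) : depends_on (off_strip a (Ordinal ki)) (X i).
  by apply: limit_scheme_depends => // o k' j' kk; rewrite /= eqxx /= neq_ltn kk.
have moff i (ki : (i < m)%N) : depends_on (off_strip a (Ordinal ki)) (fun c => mean_field i c a).
  by apply: mean_field_depends => // o k' j' kk; rewrite /= eqxx /= neq_ltn kk.
have beta0 : 0 <= beta by have := thr_lip 0 0; rewrite !subrr !normr0 !mulr0 add0r.
have Eu i : (i < k)%N -> Ex p (fun c => `|X i c - mean_field i c a|) <= u i.
  move=> ik; apply: le_trans (gu i tt ik); apply: le_Ex => // c.
  exact: (@runmax_ge _ (fun k => `|X k c - mean_field k c a|)).
have lpu i : (i < k)%N -> lp * Ex p (fun c => `|X i c - mean_field i c a|) <= lp * u i.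
  by move=> ik; rewrite ler_wpM2l // Eu.
pose P := \sum_(i < k) `|D i - mf_drift a i|.
have PH : P <= rho + \sum_(i < k) 2 * h * (lp * u i + beta).
  apply: (@le_trans _ _ (\sum_(i < k) (`|D i - h * \sum_(o : bool) sgnO o *
      Ex p (fun c => fire_prob (sgnO o * X i c))| + 2 * h * (lp * u i + beta)))).
    apply: ler_sum => i _.
    set d := h * \sum_o _.
    rewrite (_ : D i - mf_drift a i = (D i - d) + (d - mf_drift a i)); last by ring.
    apply: le_trans (ler_normD _ _) _; rewrite lerD2l /d /mf_drift -mulrBr normrM.
    rewrite (gtr0_norm h_gt0) -sumrB (mulrC 2 h) -mulrA ler_wpM2l ?(ltW h_gt0) //.
    apply: le_trans (ler_norm_sum _ _ _) _.
    have E o : `|sgnO o * Ex p (fun c => fire_prob (sgnO o * X i c)) -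
       sgnO o * Ex p (fun c => fire_prob (sgnO o * mean_field i c a))| <= lp * u i + beta.
      rewrite sgnO_dist -ExB; apply: le_trans (normr_Ex p_ge0 _) _.
      apply: le_trans (_ : _ <= lp * Ex p (fun c => `|X i c - mean_field i c a|) + beta) _.
        apply: le_trans (Ex_thr_lip (X i) (fun c => mean_field i c a) o).
        by apply: le_Ex => // c; apply: fire_prob_dist.
      by rewrite lerD2r lpu.
    rewrite sum_bool; have := E true; have := E false; lra.
  rewrite big_split /= lerD2r /rho /drift_defect.
  rewrite -!(big_mkord xpredT (fun i => `|D i - h * \sum_(o : bool) sgnO o *
      Ex p (fun c => fire_prob (sgnO o * X i c))|)).
  by rewrite [leRHS](big_cat_nat (n := k)) //= lerDl sumr_ge0.
have PW c : runmax (fun k => `|X k c - mean_field k c a|) k <= 2 * P +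
    B * \sum_(i < k) \sum_(o : bool)
      (spikes thr (X i c) (fun o => occ c a o i) o !=
       spikes thr (mean_field i c a) (fun o => occ c a o i) o)%:R.
  apply: runmax_le => j jk.
  have := @reset_comparison R (fun j => X j c) (fun j => mean_field j c a) D (mf_drift a)
    (fun i => fires thr (X i c) (fun o => occ c a o i))
    (fun i => fires thr (mean_field i c a) (fun o => occ c a o i)) k B P.
  move=> /(_ _ _ B0 _ _ j jk) H; apply: le_trans (H _ _ _ _) _ => //.
  - by move=> l lk; apply: XB; apply: leq_trans km.
  - move=> l lk; apply: le_trans (ler_norm_sum _ _ _) _.
    rewrite /P -!(big_mkord xpredT (fun i => `|D i - mf_drift a i|)).
    by rewrite [leRHS](big_cat_nat (n := l)) //= lerDl sumr_ge0.
  rewrite /X /= subrr normr0 add0r lerD2l ler_wpM2l //.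
  rewrite -!(big_mkord xpredT (fun i => \sum_(o : bool)
      (spikes thr (X i c) (fun o => occ c a o i) o !=
       spikes thr (mean_field i c a) (fun o => occ c a o i) o)%:R)).
  rewrite [leRHS](big_cat_nat (n := j)) //= ler_wpDr //.
    by apply: sumr_ge0 => i _; apply: sumr_ge0 => o _; rewrite ler0n.
  by rewrite big_mkord; apply: ler_sum => i _; apply: fires_neq_le.
apply: le_trans (le_Ex p_ge0 PW) _.
rewrite ExD (Ex_cst p_sum1) ExZ Ex_sum.
have SH : \sum_(i < k) Ex p (fun c => \sum_(o : bool)
      (spikes thr (X i c) (fun o => occ c a o i) o !=
       spikes thr (mean_field i c a) (fun o => occ c a o i) o)%:R) <=
    \sum_(i < k) 2 * (lp * u i + beta).
  apply: ler_sum => i _; have im : (i < m)%N by apply: leq_trans km.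
  have E o := le_trans (Ex_spikes_dist o (Xoff i im) (moff i im)) (Ex_thr_lip _ _ o).
  rewrite Ex_sum sum_bool; have := E true; have := E false; have := lpu i (ltn_ord i).
  rewrite /=; lra.
have Su (d : R) : \sum_(i < k) d * (lp * u i + beta) = d * (lp * \sum_(i < k) u i) + d * (beta * k%:R).
  rewrite -[LHS]mulr_sumr big_split /= -[X in _ * (X + _) = _]mulr_sumr sumr_const card_ord.
  by rewrite mulrDr -[beta *+ k]mulr_natr.
have := ler_wpM2l B0 SH; move: PH; rewrite !Su.
have kb : beta * k%:R <= beta * m%:R by rewrite ler_wpM2l // ler_nat.
have hkb : h * (beta * k%:R) <= h * (beta * m%:R) by rewrite ler_wpM2l // ltW.
have Bkb : B * (beta * k%:R) <= B * (beta * m%:R) by rewrite ler_wpM2l.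
move: hkb Bkb; set s := \sum_(i < k) u i; lra.
Qed.

(** * Fluctuations of the accumulated inputs *)

Variables (kap r : R).
Hypothesis kap_gt0 : 0 < kap.
Hypothesis thr_kap : forall x, rate * (thr x)%:R <= kap.
Hypothesis r_gt0 : 0 < r.
Hypothesis r_sqr : r * r = #|A|%:R.

Let fire_kap x : fire_prob x <= kap.
Proof. exact: le_trans (fire_prob_le _) (thr_kap _). Qed.

(** The spike minus its compensator. It is a martingale increment along the strips and is
    uncorrelated between actors. In what follows [kap] bounds the firing probability in one strip
    and [r] is the square root of the number of actors. *)
Definition comp_spike b o i c : R :=
  (spikes thr (mean_field i c b) (fun o => occ c b o i) o)%:R
  - fire_prob (sgnO o * mean_field i c b).

Lemma comp_spike_depends (Q : pred Idx) b o i : Q (b, None) ->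
  (forall o' (k' : 'I_m) (j' : 'I_J), (k' <= i)%N -> Q (b, Some (o', k', j'))) ->
  depends_on Q (comp_spike b o i).
Proof.
move=> Q0 HQ c c' cc'; rewrite /comp_spike.
have E : mean_field i c b = mean_field i c' b.
  by apply: mean_field_depends cc' => // o' k' j' /ltnW; apply: HQ.
rewrite E; congr (_%:R - _); congr nat_of_bool.
by apply: (fires_eq _ cc') => o' k' j' ki; apply: HQ; rewrite ki.
Qed.

Lemma off_strip_mean_field b (i : 'I_m) : depends_on (off_strip b i) (fun c => mean_field i c b).
Proof. by apply: mean_field_depends => // o k j ki; rewrite /= eqxx /= neq_ltn ki. Qed.

Lemma Ex_comp_spikeM F b o (i : 'I_m) : depends_on (off_strip b i) F ->
  Ex p (fun c => F c * comp_spike b o i c) = 0.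
Proof.
move=> dF; transitivity (Ex p (fun c => F c *
    (spikes thr (mean_field i c b) (fun o => occ c b o i) o)%:R
    - F c * fire_prob (sgnO o * mean_field i c b))).
  by apply: eq_Ex => c; rewrite /comp_spike mulrBr.
by rewrite ExB (Ex_spikesM o dF (@off_strip_mean_field b i)) subrr.
Qed.

(** A Bernoulli variance is at most its mean: as an indicator equals its square, the square of
    [s - e] is at most [s - 2 e (s - e)], and the correction has mean zero because [e] is determined
    outside the strip. *)
Lemma Ex_comp_spike_sqr b o (i : 'I_m) : Ex p (fun c => comp_spike b o i c * comp_spike b o i c) <= kap.
Proof.
have df := @off_strip_mean_field b i.
have dq : depends_on (off_strip b i) (fun c => fire_prob (sgnO o * mean_field i c b)).
  by move=> c c' cc'; rewrite (df c c' cc').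
apply: (@le_trans _ _ (Ex p (fun c =>
    (spikes thr (mean_field i c b) (fun o => occ c b o i) o)%:R -
    2 * (fire_prob (sgnO o * mean_field i c b) * comp_spike b o i c)))).
  apply: le_Ex => // c; rewrite /comp_spike; set e := fire_prob _.
  have := sqr_ge0 e; rewrite expr2; case: spikes; rewrite /=; nra.
rewrite ExB ExZ (Ex_comp_spikeM o dq) mulr0 subr0 (Ex_spikes o df).
by rewrite -[leRHS](Ex_cst p_sum1); apply: le_Ex.
Qed.

Lemma Ex_comp_spike_cross b b' o (i : 'I_m) : b != b' ->
  Ex p (fun c => comp_spike b' o i c * comp_spike b o i c) = 0.
Proof.
move=> bb; apply: Ex_comp_spikeM; apply: comp_spike_depends => // o' k' j' _ /=.
by rewrite eq_sym (negbTE bb).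
Qed.

Definition comp_sum (P : pred A) o i c : R := \sum_(b | P b) comp_spike b o i c.

Lemma Ex_comp_sum_sqr P o (i : 'I_m) :
  Ex p (fun c => comp_sum P o i c * comp_sum P o i c) <= #|A|%:R * kap.
Proof.
have EE : Ex p (fun c => comp_sum P o i c * comp_sum P o i c) =
  \sum_(b | P b) Ex p (fun c => comp_spike b o i c * comp_spike b o i c).
  transitivity (Ex p (fun c => \sum_(b | P b) \sum_(b' | P b') comp_spike b' o i c * comp_spike b o i c)).
    apply: eq_Ex => c; rewrite /comp_sum mulr_sumr; apply: eq_bigr => b _.
    by rewrite mulr_suml.
  rewrite Ex_sum; apply: eq_bigr => b Pb; rewrite Ex_sum (bigD1 b) //=.
  rewrite big1 ?addr0 // => b' /andP[_ bb]; apply: Ex_comp_spike_cross.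
  by rewrite eq_sym.
rewrite EE; apply: (@le_trans _ _ (\sum_(b | P b) kap)).
  by apply: ler_sum => b _; apply: Ex_comp_spike_sqr.
rewrite sumr_const -[leLHS]mulr_natl ler_wpM2r ?(ltW kap_gt0) // ler_nat.
exact: max_card.
Qed.

(** The sign [s] serves to bound the running maximum of the absolute value by those of the
    martingale and of its opposite. *)
Definition comp_mart (s : R) (P : pred A) o k c : R := s * \sum_(i < k) comp_sum P o i c.

Lemma comp_mart_depends s P o k : depends_on (before k) (comp_mart s P o k).
Proof.
move=> c c' cc'; congr (_ * _); apply: eq_bigr => i _; apply: eq_bigr => b _.
by apply: comp_spike_depends cc' => // o' k' j' /=; move=> ki; apply: leq_ltn_trans ki _.
Qed.

(** The martingale property: whatever is determined before the strip is orthogonal to the increment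
    over it. *)
Lemma Ex_before_comp_sum F P o (i : 'I_m) : depends_on (before i) F ->
  Ex p (fun c => F c * comp_sum P o i c) = 0.
Proof.
move=> dF; transitivity (Ex p (fun c => \sum_(b | P b) F c * comp_spike b o i c)).
  by apply: eq_Ex => c; rewrite mulr_sumr.
rewrite Ex_sum big1 // => b _; apply: Ex_comp_spikeM.
exact: depends_onS (@before_off b i) dF.
Qed.

Lemma Ex_comp_mart_sqr s P o k : (k <= m)%N -> s * s = 1 ->
  Ex p (fun c => comp_mart s P o k c * comp_mart s P o k c) <= k%:R * (#|A|%:R * kap).
Proof.
move=> + ss; elim: k => [|k IH] km.
  rewrite mul0r -(Ex_cst p_sum1 0); apply: le_Ex => // c.
  by rewrite /comp_mart big_ord0 mulr0 mul0r.
have -> : Ex p (fun c => comp_mart s P o k.+1 c * comp_mart s P o k.+1 c) =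
  Ex p (fun c => comp_mart s P o k c * comp_mart s P o k c) +
  2 * s * Ex p (fun c => comp_mart s P o k c * comp_sum P o k c) +
  Ex p (fun c => comp_sum P o k c * comp_sum P o k c).
  rewrite -ExZ -!ExD; apply: eq_Ex => c; rewrite /comp_mart big_ord_recr /=.
  set u := \sum_(i < k) _; set v := comp_sum _ _ _ _.
  transitivity (s * u * (s * u) + 2 * s * (s * u * v) + (s * s) * (v * v)); first by ring.
  by rewrite ss mul1r.
have H0 := @Ex_before_comp_sum (comp_mart s P o k) P o (Ordinal km) (@comp_mart_depends s P o k).
have H1 := Ex_comp_sum_sqr P o (Ordinal km).
rewrite [X in _ + _ * X + _]H0 mulr0 addr0.
apply: le_trans (lerD (IH (ltnW km)) H1) _.
by rewrite -(addn1 k) natrD mulrDl mul1r.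
Qed.

Lemma Ex_runmax_comp_mart s P o : s * s = 1 ->
  Ex p (fun c => runmax (fun k => comp_mart s P o k c) m) <= r * (4 * m%:R * kap + 1) / 2.
Proof.
move=> ss; pose S k c := runmax (fun k => comp_mart s P o k c) k.
have S2 : Ex p (fun c => S m c ^+ 2) <= 4 * (m%:R * (#|A|%:R * kap)).
  (* The pathwise Doob inequality; the subtracted transform has mean zero since the running maximum
     is determined by the past. *)
  apply: (@le_trans _ _ (Ex p (fun c => 4 * (comp_mart s P o m c * comp_mart s P o m c) -
     4 * \sum_(k < m) S k c * (comp_mart s P o k.+1 c - comp_mart s P o k c)))).
    apply: le_Ex => // c; have := @runmax_sqr_le _ (fun k => comp_mart s P o k c) m.
    by rewrite /comp_mart big_ord0 mulr0 => /(_ erefl); rewrite [_ ^+ 2 in X in _ <= X -> _]expr2.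
  rewrite ExB !ExZ Ex_sum big1 ?mulr0 ?subr0.
    by rewrite ler_pM2l // Ex_comp_mart_sqr.
  move=> k _; transitivity (s * Ex p (fun c => S k c * comp_sum P o k c)).
    rewrite -ExZ; apply: eq_Ex => c; rewrite /comp_mart big_ord_recr /=; ring.
  rewrite Ex_before_comp_sum ?mulr0 // => c c' cc'; apply: runmax_ext => j jk.
  apply: (depends_onS _ (@comp_mart_depends s P o j) cc').
  by move=> [a' [[[ o' i] j']|]] //; rewrite /in_mem /= => ij; apply: leq_trans jk.
(* Young's inequality with weight [r] stands in for Cauchy-Schwarz, the second moment being of order
   [r^2]. *)
apply: (@le_trans _ _ (Ex p (fun c => 2^-1 * (r^-1 * S m c ^+ 2) + 2^-1 * r))).
  apply: le_Ex => // c; rewrite -/(S m c); have := sqr_ge0 (S m c - r).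
  have ri : 0 < r^-1 by rewrite invr_gt0.
  move=> /(mulr_ge0 (ltW ri)); rewrite sqrrB.
  have -> : r^-1 * (S m c ^+ 2 - S m c * r *+ 2 + r ^+ 2) =
     r^-1 * S m c ^+ 2 - 2 * S m c + r by field; rewrite lt0r_neq0.
  lra.
rewrite ExD !ExZ (Ex_cst p_sum1).
have : r^-1 * Ex p (fun c => S m c ^+ 2) <= r^-1 * (4 * (m%:R * (#|A|%:R * kap))).
  by rewrite ler_wpM2l // invr_ge0 ltW.
have -> : r^-1 * (4 * (m%:R * (#|A|%:R * kap))) = r * (4 * m%:R * kap).
  by rewrite -r_sqr; field; rewrite lt0r_neq0.
set S' := Ex _ _; lra.
Qed.

Lemma Ex_runmax_comp_mart_norm P o :
  Ex p (fun c => runmax (fun k => `|comp_mart 1 P o k c|) m) <= r * (4 * m%:R * kap + 1).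
Proof.
apply: (@le_trans _ _ (Ex p (fun c => runmax (fun k => comp_mart 1 P o k c) m +
   runmax (fun k => comp_mart (-1) P o k c) m))).
  apply: le_Ex => // c; apply: runmax_le => k km.
  have h1 := @runmax_ge _ (fun k => comp_mart 1 P o k c) _ _ km.
  have h2 := @runmax_ge _ (fun k => comp_mart (-1) P o k c) _ _ km.
  (* Both martingales start at 0, so both maxima are nonnegative and their sum dominates each of
     them. *)
  have h3 := @runmax_ge _ (fun k => comp_mart 1 P o k c) _ _ (leq0n m).
  have h4 := @runmax_ge _ (fun k => comp_mart (-1) P o k c) _ _ (leq0n m).
  have z s : comp_mart s P o 0 c = 0 by rewrite /comp_mart big_ord0 mulr0.
  have eN : comp_mart (-1) P o k c = - comp_mart 1 P o k c by rewrite /comp_mart mulN1r mul1r.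
  move: h1 h2 h3 h4; rewrite /= !z eN.
  set u := runmax _ m; set v := runmax _ m.
  by rewrite ler_norml; move=> *; apply/andP; split; lra.
have := Ex_runmax_comp_mart P o (mulr1 1).
have := @Ex_runmax_comp_mart (-1) P o; rewrite mulrNN mulr1 => /(_ erefl).
rewrite ExD; set u := Ex _ _; set v := Ex _ _; lra.
Qed.

Definition centered_rates (P : pred A) o i c : R := \sum_(b | P b)
  (fire_prob (sgnO o * mean_field i c b) - Ex p (fun c => fire_prob (sgnO o * mean_field i c b))).

(** The self-consistent potentials of different actors are functions of disjoint coordinates, so the
    centered rates have no cross terms and their sum is of order [r]; Young's inequality is used
    with weight [kap * r]. *)
Lemma Ex_centered_rates P o i : Ex p (fun c => `|centered_rates P o i c|) <= kap * r.
Proof.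
pose e b c := fire_prob (sgnO o * mean_field i c b).
pose f b c := e b c - Ex p (e b).
have fcross b b' : b != b' -> Ex p (fun c => f b' c * f b c) = 0.
  move=> bb; have ds b1 : depends_on [pred j : Idx | j.1 == b1] (e b1).
    move=> c c' cc'; rewrite /e (mean_field_depends (Q := [pred j : Idx | j.1 == b1]) _ _ cc') //=.
  apply: (@Ex_pair_indep _ _ _ _ p_sum1 [pred j : Idx | j.1 == b']) => //.
  apply: depends_onS (ds b) => j; rewrite !inE => /eqP ->.
  by rewrite (negbTE bb).
have e01 b c : 0 <= e b c <= kap by rewrite fire_prob_ge0 fire_kap.
have Ee b : 0 <= Ex p (e b) <= kap.
  apply/andP; split; first by apply: Ex_ge0 => // c; case/andP: (e01 b c).
  by rewrite -[leRHS](Ex_cst p_sum1); apply: le_Ex => // c; case/andP: (e01 b c).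
have S2 : Ex p (fun c => centered_rates P o i c * centered_rates P o i c) <= #|A|%:R * (kap * kap).
  have -> : Ex p (fun c => centered_rates P o i c * centered_rates P o i c) =
      \sum_(b | P b) Ex p (fun c => f b c * f b c).
    transitivity (Ex p (fun c => \sum_(b | P b) \sum_(b' | P b') f b' c * f b c)).
      apply: eq_Ex => c; rewrite /centered_rates mulr_sumr; apply: eq_bigr => b _.
      by rewrite mulr_suml.
    rewrite Ex_sum; apply: eq_bigr => b Pb; rewrite Ex_sum (bigD1 b) //=.
    rewrite big1 ?addr0 // => b' /andP[_ bb]; apply: fcross.
    by rewrite eq_sym.
  apply: (@le_trans _ _ (\sum_(b | P b) kap * kap)).
    apply: ler_sum => b _; rewrite -[leRHS](Ex_cst p_sum1); apply: le_Ex => // c.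
    have /andP[] := e01 b c; have /andP[] := Ee b; rewrite /f.
    set x := e b c; set y := Ex p (e b) => *.
    have : 0 <= (kap - (x - y)) * (kap + (x - y)) by apply: mulr_ge0; lra.
    nra.
  rewrite sumr_const -[leLHS]mulr_natl ler_wpM2r ?mulr_ge0 ?(ltW kap_gt0) // ler_nat.
  exact: max_card.
have s0 : 0 < kap * r by rewrite mulr_gt0.
apply: (@le_trans _ _ (Ex p (fun c => 2^-1 * ((kap * r)^-1 *
     (centered_rates P o i c * centered_rates P o i c)) + 2^-1 * (kap * r)))).
  apply: le_Ex => // c; set u := centered_rates _ _ _ _.
  have si : 0 < (kap * r)^-1 by rewrite invr_gt0.
  have := sqr_ge0 (`|u| - kap * r).
  move=> /(mulr_ge0 (ltW si)); rewrite sqrrB real_normK ?num_real //.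
  have -> : (kap * r)^-1 * (u ^+ 2 - `|u| * (kap * r) *+ 2 + (kap * r) ^+ 2) =
     (kap * r)^-1 * (u * u) - 2 * `|u| + kap * r.
    by field; rewrite !lt0r_neq0.
  lra.
rewrite ExD !ExZ (Ex_cst p_sum1).
have : (kap * r)^-1 * Ex p (fun c => centered_rates P o i c * centered_rates P o i c) <=
  (kap * r)^-1 * (#|A|%:R * (kap * kap)).
  by rewrite ler_wpM2l // invr_ge0 ltW.
have -> : (kap * r)^-1 * (#|A|%:R * (kap * kap)) = kap * r.
  by rewrite -r_sqr; field; rewrite !lt0r_neq0.
set S' := Ex _ _; lra.
Qed.

(** * Distance between the actor scheme and the self-consistent scheme *)

Section Propagation.
Variables (good : {ffun Idx -> V} -> bool) (B : R).
Let Y k c := actor_scheme thr h (init c) (occ c) k.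
Hypothesis B_ge0 : 0 <= B.
Hypothesis goodB : forall c k a, good c -> (k <= m)%N -> `|Y k c a - mean_field k c a| <= B.
Hypothesis r_ge1 : 1 <= r.
Let pbad := Ex p (fun c => (~~ good c)%:R).

Let dif b o i c : R := (spikes thr (Y i c b) (fun o => occ c b o i) o
   != spikes thr (mean_field i c b) (fun o => occ c b o i) o)%:R.

Let gdist a k : R :=
  Ex p (fun c => (good c)%:R * runmax (fun j => `|Y j c a - mean_field j c a|) k).

(** On good configurations the band between the thresholds is controlled by the distance of the
    potentials. On bad ones each threshold is worth at most [kap], which costs [kap * pbad]. *)
Let Ex_dif b o (i : 'I_m) (u : R) : gdist b i <= u ->
  Ex p (dif b o i) <= lp * u + beta + kap * pbad.
Proof.
move=> gu; have dY : depends_on (off_strip b i) (fun c => Y i c b).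
  exact: depends_onS (@before_off b i) (@actor_scheme_depends i b).
apply: le_trans (Ex_spikes_dist o dY (@off_strip_mean_field b i)) _.
apply: (@le_trans _ _ (Ex p (fun c =>
   lp * ((good c)%:R * runmax (fun j => `|Y j c b - mean_field j c b|) i) + beta
     + kap * (~~ good c)%:R))).
  have beta0 : 0 <= beta by have := thr_lip 0 0; rewrite !subrr !normr0 !mulr0 add0r.
  apply: le_Ex => // c; case: (good c); rewrite /= ?mul1r ?mul0r ?mulr1 ?mulr0 ?addr0 ?add0r.
    apply: le_trans (thr_lip _ _) _; rewrite sgnO_dist lerD2r ler_wpM2l //.
    exact: (@runmax_ge _ (fun j => `|Y j c b - mean_field j c b|)).
  have := thr_kap (sgnO o * Y i c b); have := thr_kap (sgnO o * mean_field i c b).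
  set v := thr _; set v' := thr _ => h1 h2; apply: ler_wpDl => //.
  have w0 (w : nat) : 0 <= rate * w%:R by rewrite mulr_ge0.
  rewrite -{1}(ger0_norm rate_ge0) -normrM mulrBr ler_norml.
  have := w0 v; have := w0 v'; move=> *; apply/andP; split; lra.
rewrite !ExD !ExZ (Ex_cst p_sum1) -/pbad lerD2r lerD2r ler_wpM2l //.
Qed.

(** The spike mismatches are kept up to [k], as they feed the Gronwall recursion; the other terms
    are taken at the horizon [m], where their means are known. *)
Let perr c a k : R := h / #|A|%:R *
  (\sum_(i < k) \sum_b \sum_o dif b o i c
   + \sum_o (runmax (fun j => `|comp_mart 1 (fun b => b != a) o j c|) m
      + \sum_(i < m) `|centered_rates (fun b => b != a) o i c|
      + \sum_(i < m) Ex p (fun c => fire_prob (sgnO o * mean_field i c a)))).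

Let N_gt0 (a : A) : (0 : R) < #|A|%:R.
Proof. by rewrite ltr0n; apply/card_gt0P; exists a. Qed.

Let sum_mono (F : nat -> R) l k : (l <= k)%N -> (forall i, 0 <= F i) ->
  \sum_(i < l) F i <= \sum_(i < k) F i.
Proof.
move=> lk F0; rewrite -(big_mkord xpredT F) -(big_mkord xpredT F).
by rewrite [leRHS](big_cat_nat (n := l)) //= lerDl sumr_ge0.
Qed.

(** Four sources of error: mismatched spikes, compensated spikes, centered rates, and the own rate
    of [a]. The last one appears because the system sums over [b != a], while the drift, by
    exchangeability, is an average over all N actors. *)
Let input_drift c a i : input thr h (Y i c) (fun b o => occ c b o i) a - mf_drift a i =
  h / #|A|%:R * \sum_o sgnO o * (\sum_(b | b != a)
     ((spikes thr (Y i c b) (fun o => occ c b o i) o)%:R -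
      (spikes thr (mean_field i c b) (fun o => occ c b o i) o)%:R)
   + comp_sum (fun b => b != a) o i c + centered_rates (fun b => b != a) o i c
   - Ex p (fun c => fire_prob (sgnO o * mean_field i c a))).
Proof.
have N0 := lt0r_neq0 (N_gt0 a).
rewrite /input /mf_drift.
have hN (x : R) : h * x = h / #|A|%:R * (#|A|%:R * x) by rewrite mulrA divfK.
rewrite [X in _ - X]hN -mulrBr; congr (_ * _).
rewrite mulr_sumr -sumrB; apply: eq_bigr => o _.
rewrite -mulr_sumr [X in _ - X]mulrCA -mulrBr; congr (_ * _).
have -> : centered_rates (fun b => b != a) o i c = \sum_(b | b != a)
  (fire_prob (sgnO o * mean_field i c b)
   - Ex p (fun c => fire_prob (sgnO o * mean_field i c a))).
  apply: eq_bigr => b _; congr (_ - _).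
  exact: (Ex_mean_field_swap b a i (fun x => fire_prob (sgnO o * x))).
set e := Ex p _; rewrite /comp_sum -!big_split /=.
have -> : #|A|%:R * e = \sum_(b | b != a) e + e.
  rewrite mulr_natl -sumr_const (bigD1 a) //= addrC; congr (_ + _).
rewrite opprD addrA -sumrB; congr (_ - _); apply: eq_bigr => b _.
by rewrite /comp_spike; ring.
Qed.

Let perr_bound c a k l : (k <= m)%N -> (l <= k)%N ->
  `|\sum_(i < l) (input thr h (Y i c) (fun b o => occ c b o i) a - mf_drift a i)| <= perr c a k.
Proof.
move=> km lk; under eq_bigr do rewrite input_drift.
have g0 : 0 <= h / #|A|%:R by rewrite divr_ge0 ?ler0n ?ltW.
rewrite -mulr_sumr normrM (ger0_norm g0) ler_wpM2l // exchange_big /=.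
rewrite [X in _ <= X + _](_ : _ = \sum_o \sum_(i < k) \sum_b dif b o i c); last first.
  by rewrite [RHS]exchange_big /=; apply: eq_bigr => i _; rewrite exchange_big.
rewrite -big_split /=; apply: le_trans (ler_norm_sum _ _ _) _; apply: ler_sum => o _.
rewrite -mulr_sumr normr_sgnOM !big_split /= sumrN.
set e1 := \sum_(i < l) _; set e2 := \sum_(i < l) _; set e3 := \sum_(i < l) _.
set e4 := \sum_(i < l) _.
have H1 : `|e1| <= \sum_(i < k) \sum_b dif b o i c.
  apply: le_trans (sum_mono (F := fun i => \sum_b dif b o i c) lk _); last first.
    by move=> i; apply: sumr_ge0.
  apply: le_trans (ler_norm_sum _ _ _) _; apply: ler_sum => i _.
  apply: le_trans (ler_norm_sum _ _ _) _.
  rewrite [leRHS](bigD1 a) //= ler_wpDl // ; apply: ler_sum => b _.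
  rewrite /dif; do 2! case: spikes; rewrite /= ?subrr ?sub0r ?subr0 ?normrN ?normr1 ?normr0 //.
have H2 : `|e2| <= runmax (fun j => `|comp_mart 1 (fun b => b != a) o j c|) m.
  apply: le_trans (@runmax_ge _ (fun j => `|comp_mart 1 (fun b => b != a) o j c|) m l _).
    by rewrite /comp_mart mul1r.
  exact: leq_trans km.
have H3 : `|e3| <= \sum_(i < m) `|centered_rates (fun b => b != a) o i c|.
  apply: le_trans (sum_mono (F := fun i => `|centered_rates (fun b => b != a) o i c|) (leq_trans lk km) _) => //.
  exact: ler_norm_sum.
have q0 i : 0 <= Ex p (fun c => fire_prob (sgnO o * mean_field i c a)).
  by apply: Ex_ge0 => // c'; apply: fire_prob_ge0.
have H4 : `|e4| <= \sum_(i < m) Ex p (fun c => fire_prob (sgnO o * mean_field i c a)).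
  apply: le_trans (sum_mono (F := fun i => Ex p (fun c => fire_prob (sgnO o * mean_field i c a))) (leq_trans lk km) _) => //.
  by rewrite ger0_norm // sumr_ge0.
have := ler_normB (e1 + e2 + e3) e4; have := ler_normD (e1 + e2) e3.
have := ler_normD e1 e2; lra.
Qed.

(** The error [perr] of one actor involves the mismatches of all of them, but averaged with weight
    [1 / N]; the recursion therefore closes on a bound common to all actors, which is the form of
    [discrete_gronwall]. *)
Lemma actor_mean_field_dist a k : (k <= m)%N ->
  Ex p (fun c => (good c)%:R * runmax (fun j =>
    `|actor_scheme thr h (init c) (occ c) j a - mean_field j c a|) k) <=
  ((4 * h + 2 * B) * m%:R * (beta + kap * pbad) + 4 * h / r * (6 * (m%:R * kap) + 1))
   * (1 + (4 * h + 2 * B) * lp) ^+ k.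
Proof.
move=> km; apply: (@discrete_gronwall R A gdist m) => // {a km}k u km gu a.
pose D := beta + kap * pbad.
have pbad0 : 0 <= pbad by apply: Ex_ge0 => // c; rewrite ler0n.
have beta0 : 0 <= beta by have := thr_lip 0 0; rewrite !subrr !normr0 !mulr0 add0r.
have D0 : 0 <= D by rewrite addr_ge0 // mulr_ge0 // ltW.
have g0 : 0 <= h / #|A|%:R by rewrite divr_ge0 ?ler0n ?ltW.
have Edif b o i : (i < k)%N -> Ex p (dif b o i) <= lp * u i + D.
  move=> ik; have im : (i < m)%N by apply: leq_trans km.
  by rewrite /D addrA; apply: (@Ex_dif b o (Ordinal im)); apply: gu.
have W c : (good c)%:R * runmax (fun j => `|Y j c a - mean_field j c a|) k <=
    2 * perr c a k + B * \sum_(i < k) \sum_o dif a o i c.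
  have S0 : 0 <= \sum_(i < k) \sum_o dif a o i c.
    by apply: sumr_ge0 => i _; apply: sumr_ge0.
  have P0 : 0 <= perr c a k by apply: le_trans (@perr_bound c a k 0 km _).
  case: (boolP (good c)) => gc; last by rewrite mul0r addr_ge0 // mulr_ge0.
  rewrite mul1r; apply: runmax_le => j jk.
  have := @reset_comparison R (fun j => Y j c a) (fun j => mean_field j c a)
    (fun i => input thr h (Y i c) (fun b o => occ c b o i) a) (mf_drift a)
    (fun i => fires thr (Y i c a) (fun o => occ c a o i))
    (fun i => fires thr (mean_field i c a) (fun o => occ c a o i)) k B (perr c a k).
  move=> /(_ _ _ B_ge0 _ _ j jk) H; apply: le_trans (H _ _ _ _) _ => //.
  - by move=> l lk; apply: goodB => //; apply: leq_trans km.
  - by move=> l lk; apply: perr_bound.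
  rewrite /= subrr normr0 add0r lerD2l ler_wpM2l //.
  apply: le_trans (sum_mono (F := fun i => \sum_o dif a o i c) jk _).
    by apply: ler_sum => i _; apply: fires_neq_le.
  by move=> i; apply: sumr_ge0.
apply: le_trans (le_Ex p_ge0 W) _; rewrite ExD [X in X + _]ExZ [X in _ + X]ExZ.
pose S := \sum_(i < k) u i.
have Su (d : R) : \sum_(i < k) d * (lp * u i + D) = d * (lp * S) + d * (D * k%:R).
  rewrite -[LHS]mulr_sumr big_split /= -[X in _ * (X + _) = _]mulr_sumr sumr_const card_ord.
  by rewrite mulrDr -[D *+ k]mulr_natr.
have E1 b : Ex p (fun c => \sum_(i < k) \sum_o dif b o i c) <= 2 * (lp * S) + 2 * (D * k%:R).
  rewrite -Su Ex_sum; apply: ler_sum => i _; rewrite Ex_sum sum_bool.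
  have := Edif b true i (ltn_ord i); have := Edif b false i (ltn_ord i); rewrite /=; lra.
have E2 : Ex p (fun c => \sum_(i < k) \sum_b \sum_o dif b o i c) <=
    #|A|%:R * (2 * (lp * S) + 2 * (D * k%:R)).
  rewrite mulr_natl -sumr_const; apply: le_trans (ler_sum _ (fun b _ => E1 b)).
  rewrite -Ex_sum; apply: le_Ex => // c; rewrite exchange_big /=; exact: lexx.
have E3 o : Ex p (fun c => runmax (fun j => `|comp_mart 1 (fun b => b != a) o j c|) m
      + \sum_(i < m) `|centered_rates (fun b => b != a) o i c|
      + \sum_(i < m) Ex p (fun c => fire_prob (sgnO o * mean_field i c a))) <=
    r * (4 * m%:R * kap + 1) + m%:R * (kap * r) + m%:R * kap.
  rewrite 2!ExD (Ex_cst p_sum1) Ex_sum !lerD ?Ex_runmax_comp_mart_norm //.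
  - rewrite mulr_natl -[X in _ *+ X]card_ord -sumr_const.
    by apply: ler_sum => i _; apply: Ex_centered_rates.
  - rewrite mulr_natl -[X in _ *+ X]card_ord -sumr_const.
    by apply: ler_sum => i _; rewrite -[leRHS](Ex_cst p_sum1); apply: le_Ex.
have EP : Ex p (fun c => perr c a k) <= h * (2 * (lp * S) + 2 * (D * k%:R))
    + 2 * h / r * (6 * (m%:R * kap) + 1).
  rewrite ExZ ExD Ex_sum.
  apply: (@le_trans _ _ (h / #|A|%:R * (#|A|%:R * (2 * (lp * S) + 2 * (D * k%:R))
     + 2 * (r * (4 * m%:R * kap + 1) + m%:R * (kap * r) + m%:R * kap)))).
    rewrite ler_wpM2l // lerD // sum_bool; have := E3 true; have := E3 false; lra.
  rewrite mulrDr mulrA divfK ?lt0r_neq0 ?(N_gt0 a) // lerD2l -r_sqr.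
  have r0 := lt0r_neq0 r_gt0.
  (* The own rate is smaller than the fluctuations by a factor [r], and [1 <= r] absorbs it: per
     sign, 4 from Doob, 1 from the centered rates and 1 from the own rate make the 6. *)
  rewrite -(ler_pM2r (mulr_gt0 r_gt0 r_gt0)).
  have -> : h / (r * r) * (2 * (r * (4 * m%:R * kap + 1) + m%:R * (kap * r) + m%:R * kap))
    * (r * r) = h * (r * (10 * (m%:R * kap) + 2)) + h * (2 * (m%:R * kap)) by field.
  have -> : 2 * h / r * (6 * (m%:R * kap) + 1) * (r * r) =
     h * (r * (10 * (m%:R * kap) + 2)) + h * (r * (2 * (m%:R * kap))) by field.
  rewrite lerD2l ler_wpM2l ?(ltW h_gt0) // ler_peMl //.
  by rewrite !mulr_ge0 // ltW.
have := ler_wpM2l B_ge0 (E1 a); move: EP.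
have kD : D * k%:R <= D * m%:R by rewrite ler_wpM2l // ler_nat.
have hkD : h * (D * k%:R) <= h * (D * m%:R) by rewrite ler_wpM2l // ltW.
have BkD : B * (D * k%:R) <= B * (D * m%:R) by rewrite ler_wpM2l.
rewrite -/D -/S; set ep := Ex _ _; set ed := Ex _ _; set z := 2 * h / r * _.
have -> : 4 * h / r * (6 * (m%:R * kap) + 1) = 2 * z by rewrite /z; ring.
move: hkD BkD; lra.
Qed.

End Propagation.

(** * Second-moment bound on the number of occupied small cells *)

Section SmallCells.
Variables (J0 : nat) (mu0 : R).
Hypothesis J0J : (J0 <= J)%N.
Hypothesis N_gt0 : (0 < #|A|)%N.
Hypothesis mu0P : m%:R * (2 * (J0%:R * rate)) <= mu0.

Let Z c : R := small_cells R (occ c) J0 m.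
Let cell : finType := ('I_m * A * bool * 'I_J0)%type.
Let f (x : cell) c : R := (occ c x.1.1.2 x.1.2 x.1.1.1 x.2)%:R.

Let ZE c : Z c = \sum_x f x c.
Proof.
rewrite /Z /small_cells -(pair_bigA _ (fun y j => f (y, j) c)) /=.
rewrite -(pair_bigA _ (fun y o => \sum_j f ((y, o), j) c)) /=.
by rewrite -(pair_bigA _ (fun i b => \sum_o \sum_j f (((i, b), o), j) c)) /=.
Qed.

Let coord (x : cell) : Idx := (x.1.1.2, Some (x.1.2, x.1.1.1, widen_ord J0J x.2)).

Let coord_inj : injective coord.
Proof.
move=> [[[i b] o] j] [[[i' b'] o'] j'] [-> -> -> jj].
by congr (_, _); apply: val_inj.
Qed.

Let fE x c : f x c = (c (coord x) != ord0)%:R.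
Proof. by rewrite /f -[nat_of_ord x.2]/(nat_of_ord (widen_ord J0J x.2)) occE. Qed.

Let Ef x : Ex p (f x) = rate.
Proof. by apply: Ex_occ => //; apply: leq_trans (ltn_ord _) J0J. Qed.

Let mu : R := Ex p Z.

Let muE : mu = \sum_(x : cell) rate.
Proof.
transitivity (Ex p (fun c => \sum_x f x c)); first by apply: eq_Ex => c; rewrite ZE.
by rewrite Ex_sum; apply: eq_bigr => x _; rewrite Ef.
Qed.

Let mu_le : mu <= #|A|%:R * mu0.
Proof.
rewrite muE sumr_const !card_prod !card_ord card_bool -[leLHS]mulr_natl !natrM.
have -> : m%:R * #|A|%:R * 2%:R * J0%:R * rate = #|A|%:R * (m%:R * (2 * (J0%:R * rate))) by ring.
by rewrite ler_wpM2l.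
Qed.

(** Distinct small cells are distinct coordinates, hence independent, and each variance is at most
    the mean. *)
Let var_le : Ex p (fun c => (Z c - mu) * (Z c - mu)) <= #|A|%:R * mu0.
Proof.
have fcross x y : x != y -> Ex p (fun c => (f y c - rate) * (f x c - rate)) = 0.
  move=> xy; rewrite -{1}(Ef y) -(Ef x).
  apply: (@Ex_pair_indep _ _ _ _ p_sum1 [pred i : Idx | i == coord y]).
    by move=> c c' cc'; rewrite !fE cc' /=.
  move=> c c' cc'; rewrite !fE cc' //=; apply: contraNneq xy => /coord_inj ->.
  by rewrite eqxx.
apply: le_trans mu_le; rewrite [leRHS]muE.
have -> : Ex p (fun c => (Z c - mu) * (Z c - mu)) =
    \sum_x Ex p (fun c => (f x c - rate) * (f x c - rate)).
  transitivity (Ex p (fun c => \sum_x \sum_y (f y c - rate) * (f x c - rate))).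
    apply: eq_Ex => c; rewrite ZE muE -sumrB mulr_sumr; apply: eq_bigr => x _.
    by rewrite mulr_suml.
  rewrite Ex_sum; apply: eq_bigr => x _; rewrite Ex_sum (bigD1 x) //=.
  by rewrite big1 ?addr0 // => y yx; apply: fcross; rewrite eq_sym.
apply: ler_sum => x _.
apply: (@le_trans _ _ (Ex p (fun c => (1 - 2 * rate) * f x c + rate * rate))).
  apply: le_Ex => // c; rewrite fE; case: (_ != _) => /=; lra.
rewrite ExD (Ex_cst p_sum1) ExZ Ef.
have := mulr_ge0 rate_ge0 rate_ge0; lra.
Qed.

(** Chebyshev's inequality with a weight that is itself linear in Z. On the bad event
    [x = (Z - mu) / N] is at least 1 and [Z / N] is at most [mu0 + x], so the weight is at most a
    constant times [x^2]; the variance of Z being O(N), this is O(1/N). *)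
Lemma Ex_many_small_cells (al ga : R) : 0 <= al -> 0 <= ga ->
  Ex p (fun c => (~~ (small_cells R (occ c) J0 m <= #|A|%:R * (mu0 + 1)))%:R *
     (al + ga / #|A|%:R * small_cells R (occ c) J0 m)) <=
  (al + ga * (mu0 + 1)) * mu0 / #|A|%:R.
Proof.
move=> al0 ga0; have N0 : (0 : R) < #|A|%:R by rewrite ltr0n.
have mu00 : 0 <= mu0 by apply: le_trans mu0P; rewrite !mulr_ge0.
pose K := (al + ga * (mu0 + 1)) / (#|A|%:R * #|A|%:R).
have K0 : 0 <= K by rewrite divr_ge0 ?mulr_ge0 // addr_ge0 // mulr_ge0 // addr_ge0.
apply: (@le_trans _ _ (Ex p (fun c => K * ((Z c - mu) * (Z c - mu))))).
  apply: le_Ex => // c; rewrite -/(Z c); case: (lerP (Z c) _) => ZG /=.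
    by rewrite mul0r mulr_ge0 // -expr2 sqr_ge0.
  rewrite mul1r; set N := #|A|%:R in N0 K0 ZG *.
  pose x := (Z c - mu) / N.
  have Zx : Z c - mu = x * N by rewrite /x divfK ?lt0r_neq0.
  have x1 : 1 <= x.
    rewrite /x ler_pdivlMr // mul1r; have := mu_le; rewrite -/N; move: ZG; rewrite mulrDr mulr1; lra.
  have Z1 : Z c / N <= mu0 + x.
    rewrite ler_pdivrMr // mulrDl -Zx; have := mu_le; rewrite -/N; lra.
  have -> : K * ((Z c - mu) * (Z c - mu)) = (al + ga * (mu0 + 1)) * (x * x).
    by rewrite Zx /K -/N; field; rewrite lt0r_neq0.
  have xx : 1 <= x * x by rewrite -[1]mulr1 ler_pM.
  have xxx : x <= x * x by rewrite ler_peMl // (le_trans _ x1).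
  have mx : mu0 <= mu0 * (x * x) by rewrite ler_peMr.
  rewrite mulrAC -mulrA.
  have : ga * (Z c / N) <= ga * ((mu0 + 1) * (x * x)) by rewrite ler_wpM2l //; lra.
  have : al <= al * (x * x) by rewrite ler_peMr.
  lra.
rewrite ExZ; apply: le_trans (ler_wpM2l K0 var_le) _.
rewrite le_eqVlt; apply/orP; left; apply/eqP; rewrite /K; field.
by rewrite lt0r_neq0.
Qed.

End SmallCells.

End Comparison.

End RandomSchemes.

(** * Poisson random measures on the grid *)

Section PoissonRandomMeasure.
Context {R : realType} {d : measure_display} {Omega : measurableType d}.
Variables (P : probability Omega R) (N : rmeasure (R := R) (Omega := Omega)).
Hypothesis NP : poisson_random_measure P N.
Variable (A : set (R * R)%type).
Hypothesis mA : measurable A.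
Hypothesis fA : (intensity A < +oo)%E.
Let lam := fine (intensity A).

Let lam_ge0 : 0 <= lam.
Proof. by apply: fine_ge0; apply: measure_ge0. Qed.

Lemma prm_measurable : measurable_fun setT (fun w => N w A).
Proof. by case: NP => _ [/(_ A mA fA)[]]. Qed.

Lemma prm_measurable_preimage (B : set (\bar R)) : measurable B ->
  measurable [set w | B (N w A)].
Proof. by move=> mB; rewrite -[X in measurable X]setTI; apply: prm_measurable. Qed.

Lemma prm_law k : P [set w | N w A = (k%:R)%:E] = (expR (- lam) * lam ^+ k / (k`!)%:R)%:E.
Proof. by case: NP => _ [/(_ A mA fA)[_]]. Qed.

Let nat_ev k : measurable [set w | N w A = (k%:R)%:E].
Proof. exact: (prm_measurable_preimage (emeasurable_set1 _)). Qed.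

(** Integrality comes from the law: the Poisson weights sum to one by the exponential series. *)
Lemma prm_ae_nat : {ae P, forall w, exists k : nat, N w A = (k%:R)%:E}.
Proof.
pose F k := [set w | N w A = (k%:R)%:E].
have mF : measurable (\bigcup_k F k) by apply: bigcup_measurable => k _; apply: nat_ev.
have PF : P (\bigcup_k F k) = 1%E.
  have tF : trivIset setT F.
    move=> i j _ _ [w []]; rewrite /F /= => -> [H].
    by apply/eqP; rewrite -(eqr_nat R) H.
  rewrite measure_bigcup //; last by move=> k _; apply: nat_ev.
  have -> : (fun n => \sum_(0 <= i < n | i \in setT) P (F i))%E =
    EFin \o (fun n => expR (- lam) * series (exp_coeff lam) n).
    apply/funext => n /=; rewrite /series /= mulr_sumr -sumEFin.
    rewrite [LHS](eq_bigl xpredT); last by move=> i; rewrite in_setT.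
    apply: eq_bigr => i _; rewrite prm_law; congr EFin.
    by rewrite /exp_coeff /= mulrA.
  have cv : expR (- lam) * series (exp_coeff lam) n @[n --> \oo] --> (1 : R).
    rewrite [X in _ --> X](_ : 1 = expR (- lam) * expR lam); last first.
      by rewrite expRN mulVf // gt_eqF // expR_gt0.
    by apply: cvgMr; apply: is_cvg_series_exp_coeff.
  rewrite EFin_lim /=; last by apply/cvg_ex; exists 1.
  by congr EFin; apply/cvg_lim.
exists (~` \bigcup_k F k); split; first exact: measurableC.
  by rewrite probability_setC // PF subee.
by move=> w; apply: contra_not => -[k _ Fk]; exists k.
Qed.

Lemma prm_eq0 : P [set w | N w A = 0%E] = (expR (- lam))%:E.
Proof. by have := prm_law 0; rewrite expr0 fact0 divr1 mulr1. Qed.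

Lemma prm_neq0 : P [set w | N w A != 0%E] = (1 - expR (- lam))%:E.
Proof.
have -> : [set w | N w A != 0%E] = ~` [set w | N w A = 0%E].
  by apply/seteqP; split=> w /= /eqP.
by rewrite probability_setC ?prm_eq0 //; apply: (nat_ev 0).
Qed.

Lemma prm_neq0_le : (P [set w | N w A != 0%E] <= lam%:E)%E.
Proof.
rewrite prm_neq0 lee_fin; have := expR_ge1Dx (- lam); lra.
Qed.

Lemma prm_eq1 : P [set w | N w A = 1%E] = (expR (- lam) * lam)%:E.
Proof. by have := prm_law 1; rewrite expr1 -[1`!]/1%N divr1. Qed.

(** From [1 - lam <= exp(-lam)]: the masses at 0 and 1 add up to at least [(1 - lam)(1 + lam)]. *)
Lemma prm_multiple_le :
  (P [set w | ~ (N w A = 0 \/ N w A = 1)%E] <= (lam ^+ 2)%:E)%E.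
Proof.
have m0 : measurable [set w | N w A = 0%E] := nat_ev 0.
have m1 : measurable [set w | N w A = 1%E] := nat_ev 1.
have -> : [set w | ~ (N w A = 0 \/ N w A = 1)%E] =
    ~` ([set w | N w A = 0%E] `|` [set w | N w A = 1%E]) by [].
rewrite probability_setC; last exact: measurableU.
have -> : P ([set w | N w A = 0%E] `|` [set w | N w A = 1%E]) =
    (P [set w | N w A = 0%E] + P [set w | N w A = 1%E])%E.
  apply: measureU => //.
  by rewrite -subset0 => w [/= ->] [/eqP]; rewrite eq_sym oner_eq0.
rewrite prm_eq0 prm_eq1 -!EFinD lee_fin.
have := expR_ge1Dx (- lam) => H.
have : (1 - lam) * (1 + lam) <= expR (- lam) * (1 + lam).
  by rewrite ler_wpM2r ?addr_ge0.
rewrite expr2; lra.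
Qed.

End PoissonRandomMeasure.

Section Boxes.
Context {R : realType}.

Lemma measurable_box (i j : interval R) : measurable ([set` i] `*` [set` j] : set (R * R)%type).
Proof. by apply: measurableX; apply: measurable_itv. Qed.

Lemma intensity_box (i j : interval R) :
  [set` i] `<=` [set x | 0 <= x] -> [set` j] `<=` [set x | 0 <= x] ->
  intensity ([set` i] `*` [set` j]) = (lebesgue_measure [set` i] * lebesgue_measure [set` j])%E.
Proof.
move=> i0 j0; rewrite /intensity setIidl.
  by rewrite product_measure1E //; apply: measurable_itv.
by move=> [x y] [/= /i0 /= ? /j0 /= ?].
Qed.

Lemma intensityS (A B : set (R * R)%type) : measurable A -> measurable B -> A `<=` B ->
  (intensity A <= intensity B)%E.
Proof.
move=> mA mB AB; have mQ : measurable (@quadrant R).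
  rewrite (_ : quadrant = [set` `[0 : R, +oo[] `*` [set` `[0 : R, +oo[]).
    exact: measurable_box.
  by apply/seteqP; split => -[x y] /=; rewrite !in_itv /= !andbT.
apply: le_measure; rewrite ?inE; [exact: measurableI..|exact: setSI].
Qed.
End Boxes.

(** * The dyadic grid *)

Section Grid.
Context {R : realType}.
Variable T : R.
Hypothesis T_gt0 : 0 < T.

Definition grid n k : R := T * k%:R / 2 ^+ n.
(** Open on the left: the increment of an integral between two grid times then involves exactly the
    atoms of the strip. Time 0 belongs to no strip and is treated by [ae_zero_time]. *)
Definition strip n k : interval R := `]grid n k, grid n k.+1].
Definition level n j : interval R := `[j%:R / 2 ^+ n, j.+1%:R / 2 ^+ n[.
Definition cell n k j : set (R * R)%type := [set` strip n k] `*` [set` level n j].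
Definition slab n k (K : nat) : set (R * R)%type := [set` strip n k] `*` [set` `[(0 : R), K%:R[].

Lemma two_gt0 n : 0 < 2 ^+ n :> R. Proof. by rewrite exprn_gt0. Qed.
Hint Resolve two_gt0 : core.

Lemma grid_ge0 n k : 0 <= grid n k.
Proof. by rewrite /grid divr_ge0 ?mulr_ge0 // ltW. Qed.

Lemma gridS n k : grid n k.+1 = grid n k + T / 2 ^+ n.
Proof. by rewrite /grid -addn1 natrD; ring. Qed.

Lemma grid_lt n k : grid n k < grid n k.+1.
Proof. by rewrite gridS ltrDl divr_gt0. Qed.

Lemma grid_le n k l : (k <= l)%N -> grid n k <= grid n l.
Proof.
by move=> kl; rewrite /grid ler_wpM2r ?invr_ge0 ?(ltW (two_gt0 _)) // ler_wpM2l ?ler_nat // ltW.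
Qed.

Lemma grid0 n : grid n 0 = 0. Proof. by rewrite /grid mulr0 mul0r. Qed.

Lemma gridT n : grid n (2 ^ n) = T.
Proof. by rewrite /grid natrX mulfK // gt_eqF. Qed.

Lemma levelS n j : j.+1%:R / 2 ^+ n = j%:R / 2 ^+ n + 1 / 2 ^+ n :> R.
Proof. by rewrite -natr1 mulrDl. Qed.

Lemma measurable_cell n k j : measurable (cell n k j).
Proof. exact: measurable_box. Qed.

Lemma measurable_slab n k K : measurable (slab n k K).
Proof. exact: measurable_box. Qed.

Lemma strip_ge0 n k : [set` strip n k] `<=` [set x | 0 <= x].
Proof.
move=> x /=; rewrite in_itv /= => /andP[h _].
by apply: ltW; apply: le_lt_trans h; apply: grid_ge0.
Qed.

Lemma lebesgue_strip n k : lebesgue_measure [set` strip n k] = (T / 2 ^+ n)%:E.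
Proof. by rewrite lebesgue_measure_itv /= lte_fin grid_lt -EFinB gridS addrC addKr. Qed.

Lemma intensity_cell n k j : intensity (cell n k j) = (T / 2 ^+ n / 2 ^+ n)%:E.
Proof.
rewrite intensity_box //; first last.
- by move=> x /=; rewrite in_itv /= => /andP[h _]; apply: le_trans h; rewrite divr_ge0.
- exact: strip_ge0.
rewrite lebesgue_strip lebesgue_measure_itv /= lte_fin.
rewrite ltr_pM2r ?invr_gt0 // ltr_nat ltnSn -EFinB -EFinM; congr EFin.
by rewrite -mulrBl -[X in X%:R - _]addn1 natrD addrC addKr mul1r.
Qed.

Lemma intensity_slab n k K : intensity (slab n k K) = (T / 2 ^+ n * K%:R)%:E.
Proof.
rewrite intensity_box //; first last.
- by move=> x /=; rewrite in_itv /= => /andP[h _].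
- exact: strip_ge0.
rewrite lebesgue_strip lebesgue_measure_itv /= lte_fin ltr0n.
by case: K => [|K] /=; rewrite ?mulr0 ?mule0 // -EFinB subr0.
Qed.

Lemma cell_cover n (x : R * R) : 0 < x.1 -> 0 <= x.2 ->
  exists k, x.1 \in strip n k /\ x.2 \in level n (Num.truncn (x.2 * 2 ^+ n)).
Proof.
case: x => x y /= x0 y0.
have u0 : 0 < x * 2 ^+ n / T by rewrite divr_gt0 // mulr_gt0.
(* Strips being open on the left, the integer part has to be lowered by one when the quotient is an
   integer. *)
have [k /andP[ku uk]] : exists k : nat, k%:R < x * 2 ^+ n / T <= k.+1%:R.
  have := truncn_itv (ltW u0); set c := Num.truncn _ => /andP[cu uc].
  move: cu; rewrite le_eqVlt => /orP[/eqP cu|cu]; last by exists c; rewrite cu ltW.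
  case: c cu uc => [|c] cu uc; first by move: u0; rewrite -cu ltxx.
  by exists c; rewrite -cu lexx ltr_nat ltnSn.
exists k; rewrite !in_itv /=; split.
  rewrite /grid ltr_pdivrMr // ler_pdivlMr //; move: ku uk.
  by rewrite ltr_pdivlMr // ler_pdivrMr // ![_ * T]mulrC => -> ->.
have y0' : 0 <= y * 2 ^+ n by rewrite mulr_ge0 // ltW.
by have := truncn_itv y0'; rewrite ler_pdivrMr // ltr_pdivlMr.
Qed.

Lemma level_uniq n i j (y : R) : y \in level n i -> y \in level n j -> i = j.
Proof.
rewrite !in_itv /= !ler_pdivrMr // !ltr_pdivlMr // => hi hj.
by rewrite -(truncn_def hi) -(truncn_def hj).
Qed.

Lemma strip_uniq n i j (x : R) : x \in strip n i -> x \in strip n j -> i = j.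
Proof.
rewrite !in_itv /= => /andP[h1 h2] /andP[h3 h4].
apply/eqP; rewrite eqn_leq; apply/andP; split; rewrite leqNgt; apply/negP => ij.
  by have := lt_le_trans h1 (le_trans h4 (grid_le n ij)); rewrite ltxx.
by have := lt_le_trans h3 (le_trans h2 (grid_le n ij)); rewrite ltxx.
Qed.

Lemma cvg_halves (C : R) : C / 2 ^+ n @[n --> \oo] --> (0 : R).
Proof.
rewrite -[X in _ --> X](mulr0 C); apply: cvgMr.
under eq_fun do rewrite -exprVn.
by apply: cvg_expr; rewrite ger0_norm ?invr_ge0 // invf_lt1 // ltr1n.
Qed.

Lemma le_halves0 (x C : R) : (forall n, x <= C / 2 ^+ n) -> x <= 0.
Proof.
move=> H; have C0 := cvg_halves C; rewrite -(cvg_lim (@Rhausdorff R) C0).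
by apply: limr_ge; [apply/cvg_ex; exists 0|apply: nearW].
Qed.

(* Refining the grid, the unit mass of the slab stays in a single cell of each
   generation, and these cells shrink to a point. *)
Lemma unit_mass_atom (mu : {measure set (R * R)%type -> \bar R}) n k K :
  mu (slab n k K) = 1%E ->
  (forall n' k' j', exists i : nat, mu (slab n k K `&` cell n' k' j') = i%:R%:E) ->
  exists p, [/\ slab n k K p, mu [set p] = 1%E & mu (slab n k K `\ p) = 0%E].
Proof.
set S := slab n k K => S1 Hint_.
have mS : measurable S by apply: measurable_slab.
have mC n' k' j' : measurable (S `&` cell n' k' j') by apply: measurableI => //; apply: measurable_cell.
(* The cells of a generation are countably many and cover the slab, so one of them has positive
   mass; being an integer, this mass is at least 1 and nothing is left outside. *)
have /choice[f Hf] : forall n', exists f : nat * nat, mu (S `\` cell n' f.1 f.2) = 0%E.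
  move=> n'.
  have [[k' j'] /= nz] : exists f : nat * nat, mu (S `&` cell n' f.1 f.2) != 0%E.
    apply: contrapT => /forallNP H.
    suff : mu S = 0%E by rewrite S1 => /eqP; rewrite eqe oner_eq0.
    have : mu.-negligible (\bigcup_k' \bigcup_j' (S `&` cell n' k' j')).
      apply: negligible_bigcup => k'; apply: negligible_bigcup => j'.
      apply/negligibleP => //; apply/eqP; apply: contrapT => /negP.
      by have := H (k', j').
    move=> [A [mA A0 SA]]; apply: (subset_measure0 mS mA _ A0).
    apply: subset_trans SA => x Sx.
    have [k' [h1 h2]] : exists k', x.1 \in strip n' k' /\
         x.2 \in level n' (Num.truncn (x.2 * 2 ^+ n')).
      apply: cell_cover; case: Sx => /=; rewrite !in_itv /=.
        by move=> /andP[h _] _; apply: le_lt_trans h; apply: grid_ge0.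
      by move=> _ /andP[].
    by exists k' => //; exists (Num.truncn (x.2 * 2 ^+ n')).
  exists (k', j') => /=; have [i iE] := Hint_ n' k' j'.
  have : mu S = (mu (S `\` cell n' k' j') + mu (S `&` cell n' k' j'))%E.
    by apply: measureDI => //; apply: measurable_cell.
  rewrite S1 iE => E; move: nz; rewrite iE eqe pnatr_eq0 -lt0n => i0.
  have fD : mu (S `\` cell n' k' j') \is a fin_num.
    rewrite ge0_fin_numE // (@le_lt_trans _ _ (mu S)) //; last by rewrite S1 ltry.
    by apply: le_measure; rewrite ?inE //; apply: measurableD => //; apply: measurable_cell.
  have D0 : (0 <= mu (S `\` cell n' k' j'))%E by apply: measure_ge0.
  move: E fD D0; case: (mu _) => // r [E] _; rewrite lee_fin => r0; congr EFin.
  apply/eqP; rewrite eq_le r0 andbT; move: i0; rewrite -(ler_nat R); lra.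
(* The intersection over all generations has full mass, so it is not empty, and it is smaller in
   both directions than every cell. *)
pose D := S `&` \bigcap_n' cell n' (f n').1 (f n').2.
have mD : measurable D.
  by apply: measurableI => //; apply: bigcap_measurable => // n' _; apply: measurable_cell.
have SD0 : mu (S `\` D) = 0%E.
  apply/negligibleP; first exact: measurableD.
  have -> : S `\` D = \bigcup_n' (S `\` cell n' (f n').1 (f n').2).
    apply/seteqP; split => x.
      move=> [Sx nD]; apply: contrapT => H; apply: nD; split => // n' _.
      by apply: contrapT => nC; apply: H; exists n'.
    by move=> [n' _ [Sx nC]]; split => // -[_ H]; apply: nC; apply: H.
  apply: negligible_bigcup => n'; apply/negligibleP; last exact: Hf.
  by apply: measurableD => //; apply: measurable_cell.
have D1 : mu D = 1%E.
  have : mu S = (mu (S `\` D) + mu (S `&` D))%E by apply: measureDI.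
  rewrite S1 SD0 add0e (_ : S `&` D = D) //.
  by apply/setIidr; apply: subIsetl.
have [p Dp] : exists p, D p.
  apply: contrapT => /forallNP H; have : D = set0 by apply/seteqP; split => x // /H.
  by move=> D00; move: D1; rewrite D00 measure0 => /eqP; rewrite eq_sym eqe oner_eq0.
have DE : D = [set p].
  apply/seteqP; split => [x Dx|x ->] //.
  have aux (u v : R) C : (forall n', `|u - v| <= C / 2 ^+ n') -> u = v.
    by move=> /le_halves0; rewrite normr_le0 subr_eq0 => /eqP.
  have near n' : `|x.1 - p.1| <= T / 2 ^+ n' /\ `|x.2 - p.2| <= 1 / 2 ^+ n'.
    have [/= + +] := Dx.2 n' Logic.I; have [/= + +] := Dp.2 n' Logic.I.
    rewrite !in_itv /= gridS levelS.
    move=> /andP[? ?] /andP[? ?] /andP[? ?] /andP[? ?].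
    by split; rewrite ler_norml; apply/andP; split; lra.
  apply/eqP; rewrite -pair_eqE; apply/andP; split; apply/eqP.
    by apply: (aux _ _ T) => n'; case: (near n').
  by apply: (aux _ _ 1) => n'; case: (near n').
by exists p; split; [case: Dp|rewrite -DE|rewrite -DE].
Qed.

End Grid.

Lemma finite_Boole (d : measure_display) (T : measurableType d) (R : realType)
    (mu : {measure set T -> \bar R}) (I : finType) (F : I -> set T) (b : R) :
  (forall i, measurable (F i)) -> (forall i, (mu (F i) <= b%:E)%E) ->
  measurable [set w | exists i, F i w] /\
  (mu [set w | exists i, F i w] <= (#|I|%:R * b)%:E)%E.
Proof.
move=> mF Fb.
have -> : [set w | exists i, F i w] = \big[setU/set0]_(i <- enum I) F i.
  apply/seteqP; split => w.
    move=> [i Fi]; rewrite -bigcup_seq; exists i => //=; by rewrite mem_enum.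
  by rewrite -bigcup_seq => -[i _ Fi]; exists i.
rewrite cardE; elim: (enum I) => [|i s [mU IH]].
  by rewrite big_nil measure0 mul0r.
rewrite big_cons; split; first exact: measurableU.
have U2 : (mu (F i `|` \big[setU/set0]_(j <- s) F j) <=
   mu (F i) + mu (\big[setU/set0]_(j <- s) F j))%E by apply: measureU2.
apply: le_trans U2 _.
by rewrite -natr1 mulrDl mul1r EFinD addeC leeD.
Qed.

Definition indep_inputs {R : realType} {d : measure_display} {Omega : measurableType d}
    (P : probability Omega R) (PN : nat -> bool -> rmeasure (R := R) (Omega := Omega))
    (U0 : nat -> nat -> Omega -> R) : Prop :=
  mutual_indep P
        [set i : ((nat * bool) + (nat * nat))%type |
           match i with
           | inl (a, _) => (1 <= a)%N
           | inr (N, a) => (2 <= N)%N /\ (1 <= a <= N)%N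
           end]
        (fun i => match i with
                  | inl (a, o) => sigmaRM (PN a o)
                  | inr (N, a) => sigmaRV (U0 N a)
                  end).

(** * Almost sure structure of the driving atoms *)

Section Driving.
Context {R : realType} {d : measure_display} {Omega : measurableType d}.
Variables (P : probability Omega R) (PN : nat -> bool -> rmeasure (R := R) (Omega := Omega)).
Variables (U0 : nat -> nat -> Omega -> R).
Hypothesis PNP : forall a o, (1 <= a)%N -> poisson_random_measure P (PN a o).
Hypothesis indep : indep_inputs P PN U0.
Variable T : R.
Hypothesis T_gt0 : 0 < T.

Lemma sigmaRM_preimage (N : rmeasure (R := R) (Omega := Omega)) A B : measurable A -> measurable B ->
  sigmaRM N ((fun w => N w A) @^-1` B).
Proof. by move=> mA mB; apply: sub_sigma_algebra; exists A, B. Qed.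

Lemma sigmaRM_setI (N : rmeasure (R := R) (Omega := Omega)) (I : Type) (s : seq I) (F : I -> set Omega) :
  (forall i, sigmaRM N (F i)) -> sigmaRM N (\big[setI/setT]_(i <- s) F i).
Proof.
rewrite /sigmaRM; set G := (X in smallest _ X) => GF.
have : (G.-sigma).-measurable (\big[setI/setT]_(i <- s) (F i : set (g_sigma_algebraType G))).
  by apply: bigsetI_measurable => i _; apply: GF.
by [].
Qed.

Let fin_slab n k K : (intensity (slab T n k K) < +oo)%E.
Proof. by rewrite intensity_slab // ltry. Qed.

Let fin_cell n k j : (intensity (cell T n k j) < +oo)%E.
Proof. by rewrite intensity_cell // ltry. Qed.

Definition simple_strips (mu : nat -> bool -> {measure set (R * R)%type -> \bar R}) N n K :=
  forall k, (k < 2 ^ n)%N ->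
  (forall a o, (1 <= a <= N)%N -> mu a o (slab T n k K) = 0%E) \/
  exists a o p, [/\ (1 <= a <= N)%N, slab T n k K p, mu a o [set p] = 1%E,
     mu a o (slab T n k K `\ p) = 0%E &
     forall a' o', (1 <= a' <= N)%N -> (a', o') <> (a, o) -> mu a' o' (slab T n k K) = 0%E].

Lemma ae_integer_boxes N : {ae P, forall w, forall a o n k K n' k' j, (1 <= a <= N)%N ->
   exists i : nat, PN a o w (slab T n k K `&` cell T n' k' j) = i%:R%:E}.
Proof.
suff H : forall a, {ae P, forall w, forall n k K n' k' j, forall (o : bool), (1 <= a <= N)%N ->
   exists i : nat, PN a o w (slab T n k K `&` cell T n' k' j) = i%:R%:E}.
  by have := ae_foralln H; apply: filterS => w Hw a o n k K n' k' j; apply: Hw.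
move=> a; apply: ae_foralln => n; apply: ae_foralln => n0; apply: ae_foralln => n1.
apply: ae_foralln => n2; apply: ae_foralln => n3; apply: ae_foralln => n4.
case: (boolP (1 <= a <= N)%N) => [/andP[a1 _]|]; last by move=> _; apply: nearW.
have mI : measurable (slab T n n0 n1 `&` cell T n2 n3 n4).
  by apply: measurableI; [apply: measurable_slab|apply: measurable_cell].
have H o : {ae P, forall w, exists i : nat,
    PN a o w (slab T n n0 n1 `&` cell T n2 n3 n4) = i%:R%:E}.
  apply: (prm_ae_nat (PNP o a1)) => //; apply: le_lt_trans (fin_slab n n0 n1).
  by apply: intensityS => //; apply: measurable_slab.
by apply: filterS2 (H true) (H false) => w H1 H2 [].
Qed.

Lemma prm_pair_indep a o a' o' (E E' : set Omega) : (1 <= a)%N -> (1 <= a')%N ->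
  (a, o) != (a', o') -> sigmaRM (PN a o) E -> sigmaRM (PN a' o') E' ->
  P (E `&` E') = (P E * P E')%E.
Proof.
move=> a1 a1' ne HE HE'.
have := indep (J := [:: inl (a, o); inl (a', o')])
  (E := fun i => if i == inl (a, o) then E else E').
rewrite !big_cons !big_nil setIT mule1 eqxx.
have /negbTE -> : inl (a', o') != inl (a, o) :> (nat * bool + nat * nat)%type.
  by apply: contra ne => /eqP[-> ->].
apply; first by rewrite /= inE andbT; apply: contra ne => /eqP[-> ->].
move=> j; rewrite !inE => /orP[/eqP ->|/eqP ->]; rewrite ?eqxx //.
by rewrite (_ : _ == _ = false) //; apply/negbTE; apply: contra ne => /eqP[-> ->].
Qed.

(** Borel-Cantelli. A strip is bad if some measure gives its slab a mass other than 0 and 1, or if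
    two measures charge it; each of these events has probability O(4^-n), and there are O(2^n) of
    them. The levels [K] are countably many, so one null set serves them all, which matters since
    [K] will depend on the path. *)
Lemma ae_simple_strips N : {ae P, forall w, forall K, exists n0, forall n, (n0 <= n)%N ->
  simple_strips (fun a o => PN a o w) N n K}.
Proof.
apply: ae_foralln => K.
pose I1 n : finType := ('I_(2 ^ n) * ('I_N * bool))%type.
pose I2 n : finType := ('I_(2 ^ n) * ('I_N * bool) * ('I_N * bool))%type.
pose M (x : 'I_N * bool) := PN x.1.+1 x.2.
pose F1 n (x : I1 n) := [set w | ~ (M x.2 w (slab T n x.1 K) = 0 \/ M x.2 w (slab T n x.1 K) = 1)%E].
pose F2 n (x : I2 n) := if x.1.2 == x.2 then set0 else
  [set w | M x.1.2 w (slab T n x.1.1 K) != 0%E] `&` [set w | M x.2 w (slab T n x.1.1 K) != 0%E].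
pose lam n := T / 2 ^+ n * K%:R.
have M_prm x : poisson_random_measure P (M x) by apply: PNP.
have meas x n k B : measurable B -> measurable [set w | B (M x w (slab T n k K))].
  by move=> mB; apply: (prm_measurable_preimage (M_prm x)) => //; apply: measurable_slab.
have m0 : measurable [set x : \bar R | x != 0%E].
  rewrite (_ : [set x | _] = ~` [set 0%E]); last by apply/seteqP; split => x /= /eqP.
  exact: measurableC.
have mF1 n x : measurable (F1 n x).
  apply: (meas _ _ _ (~` ([set 0%E] `|` [set 1%E]))).
  by apply: measurableC; apply: measurableU.
have mF2 n x : measurable (F2 n x).
  by rewrite /F2; case: ifP => // _; apply: measurableI; exact: (meas _ _ _ [set x | x != 0%E]).
have lam0 n : 0 <= lam n by rewrite mulr_ge0 // divr_ge0 // ltW.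
have iE n k : fine (intensity (slab T n k K)) = lam n by rewrite intensity_slab.
have PF1 n x : (P (F1 n x) <= (lam n ^+ 2)%:E)%E.
  rewrite -(iE n x.1); apply: (prm_multiple_le (M_prm x.2)) => //.
  exact: measurable_slab.
have PF2 n x : (P (F2 n x) <= (lam n ^+ 2)%:E)%E.
  rewrite /F2; case: eqP => [_|/eqP ne]; first by rewrite measure0 lee_fin sqr_ge0.
  have ne' : (x.1.2.1.+1, x.1.2.2) != (x.2.1.+1, x.2.2).
    apply: contra ne; rewrite -pair_eqE /= => /andP[/eqP[e1] /eqP e2].
    by rewrite -pair_eqE /= e2 eqxx andbT; apply/eqP/val_inj.
  have S y := @sigmaRM_preimage (M y) _ _ (@measurable_slab _ T n x.1.1 K) m0.
  rewrite (prm_pair_indep _ _ ne' (S x.1.2) (S x.2)) //.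
  have H y : (P [set w | M y w (slab T n x.1.1 K) != 0%E] <= (lam n)%:E)%E.
    rewrite -(iE n x.1.1); apply: (prm_neq0_le (M_prm y)) => //.
    exact: measurable_slab.
  rewrite expr2 EFinM; apply: lee_pmul; [exact: measure_ge0|exact: measure_ge0|exact: H|exact: H].
pose bad n := [set w | exists x, F1 n x w] `|` [set w | exists x, F2 n x w].
have mbad n : measurable (bad n).
  by apply: measurableU; [case: (finite_Boole (mF1 n) (PF1 n))|case: (finite_Boole (mF2 n) (PF2 n))].
(* The 2N measures and the pairs of them, in 2^n strips; the final factor 2 brings the bound to the
   form [C / 2^(n+1)] of the geometric series used below. *)
pose C := (2 * N%:R + 4 * N%:R ^+ 2) * (T * K%:R) ^+ 2 * 2.
have C0 : 0 <= C.
  rewrite /C mulr_ge0 // mulr_ge0 ?sqr_ge0 // addr_ge0 // mulr_ge0 // sqr_ge0 //.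
have Pbad n : (P (bad n) <= (C / (2 ^ n.+1)%:R)%:E)%E.
  apply: le_trans (measureU2 _ _ _) _ => /=.
  - by case: (finite_Boole (mF1 n) (PF1 n)).
  - by case: (finite_Boole (mF2 n) (PF2 n)).
  have [_ h1] := finite_Boole (mF1 n) (PF1 n).
  have [_ h2] := finite_Boole (mF2 n) (PF2 n).
  apply: le_trans (leeD h1 h2) _; rewrite -EFinD lee_fin le_eqVlt; apply/orP; left; apply/eqP.
  rewrite !card_prod !card_ord card_bool !natrM !natrX (exprS 2) /C /lam.
  by field; rewrite gt_eqF // two_gt0.
have BC : P (lim_sup_set bad) = 0%E.
  apply: lim_sup_set_cvg0 => //; apply: le_lt_trans (ltry C).
  apply: le_trans (epsilon_trick0 xpredT C0); apply: (@lee_nneseries _ _ _ xpredT 0) => [n _ _|n _].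
    exact: measure_ge0.
  exact: Pbad.
have nlim : {ae P, forall w, ~ lim_sup_set bad w}.
  exists (lim_sup_set bad); split; [|exact: BC|].
    by apply: bigcap_measurable => // n _; apply: bigcup_measurable.
  by move=> w /= /contrapT.
apply: filterS2 nlim (ae_integer_boxes N) => w Hlim Hint_.
have [n0 Hn0] : exists n0, forall n, (n0 <= n)%N -> ~ bad n w.
  apply: contrapT => /forallNP H; apply: Hlim => n _.
  have := H n => /existsNP[n' /not_implyP[nn' /contrapT bw]].
  by exists n'.
exists n0 => n n0n; have {Hn0 n0n}nb := Hn0 n n0n.
move=> k kn; pose ko := Ordinal kn.
have H1 x : (M x w (slab T n k K) = 0 \/ M x w (slab T n k K) = 1)%E.
  by apply: contrapT => H; apply: nb; left; exists (ko, x).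
have H2 x y : x != y -> M x w (slab T n k K) != 0%E -> M y w (slab T n k K) = 0%E.
  move=> xy x0; apply: contrapT => /eqP y0; apply: nb; right; exists (ko, x, y).
  by rewrite /F2 /= (negbTE xy).
have ordE a : (1 <= a <= N)%N -> exists a' : 'I_N, a = a'.+1.
  by case: a => [//|a] /= aN; exists (Ordinal aN).
case: (pselect (exists x, M x w (slab T n k K) != 0%E)) => [[x x0]|H]; last first.
  left=> a o /ordE[a' ->]; apply/eqP; apply: contrapT => /negP nz; apply: H.
  by exists (a', o).
right; have x1 : M x w (slab T n k K) = 1%E by case: (H1 x) x0 => // ->; rewrite eqxx.
have [|p [Sp p1 p0]] := unit_mass_atom T_gt0 x1.
  by move=> n' k' j'; apply: Hint_; rewrite /= ltn_ord.
exists x.1.+1, x.2, p; split => //; first by rewrite /= ltn_ord.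
move=> a' o' /ordE[b ->] ne; apply: (H2 x (b, o')) => //.
by apply: contra_notN ne => /eqP ->.
Qed.

(** The integrals run over closed intervals starting at 0, so atoms at time 0 have to be excluded
    for the paths to start at their initial values. *)
Lemma ae_zero_time N : {ae P, forall w, forall K : nat, forall a o, (1 <= a <= N)%N ->
  PN a o w ([set` `[(0 : R), 0]] `*` [set` `[(0 : R), K%:R[]) = 0%E}.
Proof.
suff H : forall K a, {ae P, forall w, forall o : bool, (1 <= a <= N)%N ->
  PN a o w ([set` `[(0 : R), 0]] `*` [set` `[(0 : R), K%:R[]) = 0%E}.
  apply: ae_foralln => K; have := ae_foralln (H K).
  by apply: filterS => w Hw a o; apply: Hw.
move=> K a; case: (boolP (1 <= a <= N)%N) => [/andP[a1 _]|]; last by move=> _; apply: nearW.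
set A := _ `*` _; have mA : measurable A by apply: measurable_box.
have iA : intensity A = 0%E.
  rewrite /A intensity_box.
  - by rewrite lebesgue_measure_itv /= ltxx mul0e.
  - by move=> x /=; rewrite in_itv /= => /andP[].
  - by move=> x /=; rewrite in_itv /= => /andP[].
have H o : {ae P, forall w, PN a o w A = 0%E}.
  have fA : (intensity A < +oo)%E by rewrite iA ltry.
  have m0 : measurable [set w | PN a o w A != 0%E].
    apply: (prm_measurable_preimage (PNP o a1) mA fA (B := [set x | x != 0%E])).
    rewrite (_ : [set x | _] = ~` [set 0%E]); last by apply/seteqP; split => x /= /eqP.
    exact: measurableC.
  exists [set w | PN a o w A != 0%E]; split => //.
    by rewrite (prm_neq0 (PNP o a1) mA fA) iA /= oppr0 expR0 subrr.
  by move=> w /= /eqP.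
by apply: filterS2 (H true) (H false) => w H1 H2 [].
Qed.

End Driving.

Lemma integral_finite_valued (d : measure_display) (Omega : measurableType d) (R : realType)
    (P : probability Omega R) (V : finType) (X : Omega -> V) (F : V -> R) :
  (forall v, measurable [set w | X w = v]) -> (forall v, 0 <= F v) ->
  (\int[P]_w (F (X w))%:E)%E = (\sum_v F v * fine (P [set w | X w = v]))%:E.
Proof.
move=> mX F0.
have fP v : P [set w | X w = v] \is a fin_num.
  by rewrite ge0_fin_numE ?measure_ge0 // (le_lt_trans (probability_le1 P (mX v))) ?ltry.
transitivity (\int[P]_w \sum_v ((F v)%:E * (\1_[set w | X w = v] w)%:E))%E.
  apply: eq_integral => w _; rewrite (bigD1 (X w)) //= indicE mem_set // mule1.
  rewrite big1 ?adde0 // => v vX; rewrite indicE memNset ?mule0 //= => Xv.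
  by move: vX; rewrite -Xv eqxx.
rewrite ge0_integral_sum //; last 2 first.
- move=> v; apply: measurable_funeM; apply/measurable_EFinP.
  exact: measurable_indic.
- by move=> v w _; rewrite mule_ge0 // lee_fin.
rewrite -sumEFin; apply: eq_bigr => v _.
rewrite ge0_integralZl //; last 2 first.
- by apply/measurable_EFinP; apply: measurable_indic.
- by rewrite lee_fin.
by rewrite integral_indic // setIT EFinM fineK.
Qed.

(** * Law of the discretized inputs *)

Section ConfigurationLaw.
Context {R : realType} {d : measure_display} {Omega : measurableType d}.
Variables (P : probability Omega R) (PN : nat -> bool -> rmeasure (R := R) (Omega := Omega)).
Variables (U0 : nat -> nat -> Omega -> R).
Hypothesis PNP : forall a o, (1 <= a)%N -> poisson_random_measure P (PN a o).
Hypothesis indep : indep_inputs P PN U0.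
Hypothesis mU0 : forall N a, (2 <= N)%N -> (1 <= a <= N)%N -> measurable_fun setT (U0 N a).
Hypothesis idU0 : forall N a N' a', (2 <= N)%N -> (1 <= a <= N)%N ->
         (2 <= N')%N -> (1 <= a' <= N')%N ->
         forall B : set R, measurable B ->
           P (U0 N a @^-1` B) = P (U0 N' a' @^-1` B).
Variables (T L : R) (N n J q : nat).
Hypothesis T_gt0 : 0 < T.
Hypothesis N2 : (2 <= N)%N.

Let Idx : finType := ('I_N * option (bool * 'I_(2 ^ n) * 'I_J))%type.
Let V : finType := 'I_q.+2.

(* Coordinate [(a, None)] encodes the initial value of the actor [a.+1], and
   [(a, Some (o, k, j))] whether N^{a+1,o} charges the [(k, j)]-th cell. *)
Definition occ_code (x : \bar R) : V := if x == 0%E then ord0 else inord 1.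
(** [inord] sends the integers out of range to 0, which keeps the code total; with [q = init_size]
    no [x] with [|x| <= L] is concerned. *)
Definition init_code (x : R) : V := inord (Num.truncn ((x + L) * 2 ^+ n)).

Definition conf_at (i : Idx) (w : Omega) : V :=
  match i.2 with
  | Some (o, k, j) => occ_code (PN i.1.+1 o w (cell T n k j))
  | None => init_code (U0 N i.1.+1 w)
  end.

Definition conf (w : Omega) : {ffun Idx -> V} := [ffun i => conf_at i w].

Definition cell_rate : R := 1 - expR (- (T / 2 ^+ n / 2 ^+ n)).

(** Initial values being identically distributed, the first actor stands for all. The weight does
    not depend on the actor, which is what exchangeability requires. *)
Definition coord_law (x : option (bool * 'I_(2 ^ n) * 'I_J)) (v : V) : R :=
  if x is Some _ then if v == ord0 then 1 - cell_rate else if v == inord 1 then cell_rate else 0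
  else fine (P [set w | init_code (U0 N 1 w) = v]).

Let inord1 : (inord 1 : V) != ord0.
Proof. by apply/eqP => /(congr1 val); rewrite /= inordK. Qed.

Lemma cell_rate_bounds : 0 <= cell_rate <= 1.
Proof.
apply/andP; split; last by rewrite /cell_rate gerBl expR_ge0.
by rewrite subr_ge0 -expR0 ler_expR oppr_le0 !divr_ge0 // ltW // ?two_gt0.
Qed.

Lemma coord_law_ge0 x v : 0 <= coord_law x v.
Proof.
have /andP[r0 r1] := cell_rate_bounds.
rewrite /coord_law; case: x => [_|]; last by rewrite fine_ge0 ?measure_ge0.
by case: ifP => _; rewrite ?subr_ge0 //; case: ifP.
Qed.

Lemma coord_law_rate x : \sum_(v | v != ord0) coord_law (Some x) v = cell_rate.
Proof.
rewrite (bigD1 (inord 1)) //= (negbTE inord1) eqxx big1 ?addr0 // => v /andP[v0 v1].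
by rewrite (negbTE v0) (negbTE v1).
Qed.

Let measurable_init_code v : measurable [set x : R | init_code x = v].
Proof.
pose S i := [set x : R | (Num.truncn ((x + L) * 2 ^+ n) <= i)%N].
have mS i : measurable (S i).
  rewrite (_ : S i = [set` `]-oo, i.+1%:R / 2 ^+ n - L[]); first exact: measurable_itv.
  apply/seteqP; split => x; rewrite /S /= truncn_le_nat in_itv /= ltrBrDr;
    by rewrite ltr_pdivlMr ?two_gt0.
rewrite (_ : [set x | _] = \bigcup_(i in [set i | inord i = v])
   (S i `\` (if i is i'.+1 then S i' else set0))); last first.
  apply/seteqP; split => x /=.
    move=> xv; exists (Num.truncn ((x + L) * 2 ^+ n)) => //; split; first by rewrite /S /=.
    by case E: (Num.truncn ((x + L) * 2 ^+ n)) => [|k] //; rewrite /S /= E ltnn.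
  move=> [i iv [Si nSi]]; rewrite /init_code -iv; congr inord.
  apply/eqP; rewrite eqn_leq Si /=; case: i nSi {iv Si} => // i.
  by rewrite /S /= => /negP; rewrite -ltnNge.
apply: bigcup_measurable => i _; apply: measurableD => //.
by case: i.
Qed.

Let measurable_init v (a : 'I_N) : measurable [set w | init_code (U0 N a.+1 w) = v].
Proof.
have aN : (1 <= a.+1 <= N)%N by rewrite /= ltn_ord.
by have := mU0 N2 aN measurableT (measurable_init_code v); rewrite setTI.
Qed.

Let mB v : measurable [set x : \bar R | occ_code x = v].
Proof.
rewrite /occ_code; case: (eqVneq v ord0) => [->|v0].
  rewrite (_ : [set x | _] = [set 0%E]) //; apply/seteqP; split => x /=.
    by case: eqP => // _ /eqP; rewrite (negbTE inord1).
  by move=> ->; rewrite eqxx.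
case: (eqVneq v (inord 1)) => [->|v1].
  rewrite (_ : [set x | _] = ~` [set 0%E]); first exact: measurableC.
  apply/seteqP; split => x /=; case: eqP => // _.
  by move=> /eqP; rewrite eq_sym (negbTE inord1).
rewrite (_ : [set x | _] = set0) //; apply/seteqP; split => x //=.
by case: eqP => _ /esym/eqP; rewrite ?(negbTE v0) ?(negbTE v1).
Qed.

Let fin_cell k j : (intensity (cell T n k j) < +oo)%E.
Proof. by rewrite intensity_cell // ltry. Qed.

Lemma measurable_conf_at i v : measurable [set w | conf_at i w = v].
Proof.
case: i => a [[[s k] j]|]; last exact: measurable_init.
by apply: (prm_measurable_preimage (PNP s (ltn0Sn a)) (@measurable_cell _ T n k j) (fin_cell k j) (mB v)).
Qed.

Lemma conf_at_law i v : P [set w | conf_at i w = v] = (coord_law i.2 v)%:E.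
Proof.
case: i => a [[[s k] j]|] /=; last first.
  rewrite /conf_at /= fineK; last first.
    have m := @measurable_init v (Ordinal (ltnW N2)).
    by rewrite ge0_fin_numE ?measure_ge0 // (le_lt_trans (probability_le1 P m)) ?ltry.
  apply: (idU0 (a := a.+1) (a' := 1) N2 _ N2 _ (measurable_init_code v)) => /=.
    by rewrite ltn_ord.
  exact: ltnW.
have PRM := PNP s (ltn0Sn a); have mC := @measurable_cell _ T n k j.
have H0 := prm_eq0 PRM mC (fin_cell k j); have H1 := prm_neq0 PRM mC (fin_cell k j).
rewrite intensity_cell //= in H0 H1; rewrite /conf_at /occ_code /=.
case: eqP => [->|/eqP v0].
  rewrite (_ : [set w | _] = [set w | PN a.+1 s w (cell T n k j) = 0%E]).
    by rewrite H0 /cell_rate opprB addrC subrK.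
  apply/seteqP; split => w /=; last by move=> ->; rewrite eqxx.
  by case: eqP => // _ /eqP; rewrite (negbTE inord1).
case: eqP => [->|/eqP v1].
  rewrite (_ : [set w | _] = [set w | PN a.+1 s w (cell T n k j) != 0%E]) //.
  apply/seteqP; split => w /=; case: eqP => //= _.
  by move=> /eqP; rewrite eq_sym (negbTE inord1).
rewrite (_ : [set w | _] = set0) ?measure0 //; apply/seteqP; split => w //=.
by case: eqP => _ /esym/eqP; rewrite ?(negbTE v0) ?(negbTE v1).
Qed.

Lemma coord_law_sum1 x : \sum_v coord_law x v = 1.
Proof.
case: x => [x|].
  by rewrite (bigD1 ord0) //= (coord_law_rate x) /= subrK.
apply: EFin_inj.
have m v : measurable [set w | init_code (U0 N 1 w) = v] := @measurable_init v (Ordinal (ltnW N2)).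
have := integral_finite_valued P (F := fun=> 1) m (fun _ => ler01).
have -> : (\int[P]_(w in setT) 1%:E = 1)%E.
  by rewrite integral_cst // mul1e; apply: probability_setT.
move=> ->; congr EFin.
by apply: eq_bigr => v _; rewrite mul1r.
Qed.

Let big_setI_in (I : eqType) (X : Type) (s : seq I) (F : I -> set X) (w : X) :
  (\big[setI/setT]_(i <- s) F i) w <-> (forall i, i \in s -> F i w).
Proof.
elim: s => [|i s IH]; first by rewrite big_nil; split.
rewrite big_cons; split=> [[Fi /IH H] j|H].
  by rewrite inE => /orP[/eqP ->|/H].
split; first by apply: H; rewrite mem_head.
by apply/IH => j js; apply: H; rewrite inE js orbT.
Qed.

Let cells : finType := ('I_(2 ^ n) * 'I_J)%type.

Let conf_cells (c : {ffun Idx -> V}) (a : 'I_N) (s : bool) : set Omega :=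
  \big[setI/setT]_(x <- enum cells) [set w | conf_at (a, Some (s, x.1, x.2)) w = c (a, Some (s, x.1, x.2))].

Let conf_cells_law c a s : P (conf_cells c a s) =
  (\prod_(x : cells) coord_law (Some (s, x.1, x.2)) (c (a, Some (s, x.1, x.2))))%:E.
Proof.
have [_ [_ PRM]] := PNP s (ltn0Sn a).
pose x_ (i : 'I_#|cells|) : cells := enum_val i.
have H1 i : measurable (cell T n (x_ i).1 (x_ i).2) /\ (intensity (cell T n (x_ i).1 (x_ i).2) < +oo)%E.
  by split; [apply: measurable_cell|apply: fin_cell].
have H2 i j : i != j -> cell T n (x_ i).1 (x_ i).2 `&` cell T n (x_ j).1 (x_ j).2 = set0.
  move=> ij; apply/seteqP; split => // y [[h1 h2] [h3 h4]].
  have e1 := strip_uniq T_gt0 h1 h3; have e2 := level_uniq h2 h4.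
  move: ij => /negP[]; apply/eqP/enum_val_inj.
  by rewrite [enum_val i]surjective_pairing [enum_val j]surjective_pairing;
     congr (_, _); apply: val_inj.
pose E (i : 'I_#|cells|) := [set w | conf_at (a, Some (s, (x_ i).1, (x_ i).2)) w
   = c (a, Some (s, (x_ i).1, (x_ i).2))].
have H3 := PRM _ _ H1 H2 (index_enum _) E (index_enum_uniq _).
have -> : conf_cells c a s = \big[setI/setT]_(i <- index_enum 'I_#|cells|) E i.
  apply/seteqP; split => w /big_setI_in H; apply/big_setI_in => i _.
    by apply: H; rewrite mem_enum.
  have := H (enum_rank i) (mem_index_enum _).
  by rewrite /E /= /x_ enum_rankK.
rewrite H3; last first.
  move=> j _; split => //; exists [set x | occ_code x = c (a, Some (s, (x_ j).1, (x_ j).2))] => //.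
  exact: mB.
rewrite [in RHS](reindex x_) /=; last exact: onW_bij (enum_val_bij _).
by rewrite -prodEFin; apply: eq_bigr => i _; rewrite conf_at_law.
Qed.

Lemma measurable_conf (c : {ffun Idx -> V}) : measurable [set w | conf w = c].
Proof.
rewrite (_ : [set w | conf w = c] = \big[setI/setT]_(i <- enum Idx) [set w | conf_at i w = c i]).
  by apply: bigsetI_measurable => i _; apply: measurable_conf_at.
apply/seteqP; split => w.
  by move=> /= <-; apply/big_setI_in => i _; rewrite /= ffunE.
by move=> /big_setI_in H; apply/ffunP => i; rewrite ffunE; apply: H; rewrite mem_enum.
Qed.

Let conf_cells_sigma (c : {ffun Idx -> V}) (a : 'I_N) s : sigmaRM (PN a.+1 s) (conf_cells c a s).
Proof.
apply: sigmaRM_setI => x; apply: (@sigmaRM_preimage _ _ _ (PN a.+1 s) _ [set y | occ_code y = c (a, Some (s, x.1, x.2))]).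
  exact: measurable_cell.
exact: mB.
Qed.

Let signed : finType := ('I_N * bool)%type.
Let index := ((nat * bool) + (nat * nat))%type.

(** Independence in two stages: between the measures and the initial values by [indep], then between
    the disjoint cells of one measure by complete randomness, as in [conf_cells_law]. *)
Lemma conf_law (c : {ffun Idx -> V}) : P [set w | conf w = c] = (prod_wt (fun i => coord_law i.2) c)%:E.
Proof.
pose J1 : seq index := [seq inl (x.1.+1, x.2) | x : signed <- enum signed].
pose J2 : seq index := [seq inr (N, a.+1) | a : 'I_N <- enum 'I_N].
(* Actors are numbered from 1 and ordinals from 0, whence [a.-1]; past the last actor the full event
   is a default. *)
pose E (i : index) : set Omega := match i with
  | inl (a, s) => if insub a.-1 is Some a' then conf_cells c a' s else setT
  | inr (_, a) => if insub a.-1 is Some a' then [set w | conf_at (a', None) w = c (a', None)] else setT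
  end.
have E1 (a : 'I_N) s : E (inl (a.+1, s)) = conf_cells c a s by rewrite /E /= valK.
have E2 (a : 'I_N) : E (inr (N, a.+1)) = [set w | conf_at (a, None) w = c (a, None)].
  by rewrite /E /= valK.
have J12 : uniq (J1 ++ J2).
  rewrite cat_uniq; apply/and3P; split.
  - rewrite map_inj_uniq ?enum_uniq // => -[a s] [a' s'] [/val_inj -> ->] //.
  - by apply/hasPn => _ /mapP[a _ ->]; apply/negP => /mapP[].
  - by rewrite map_inj_uniq ?enum_uniq // => a a' [/val_inj].
have HJ : forall j : index, j \in J1 ++ J2 ->
    (match j with inl (a, _) => (1 <= a)%N | inr (N, a) => (2 <= N)%N /\ (1 <= a <= N)%N end : Prop) /\
    (match j with inl (a, o) => sigmaRM (PN a o) | inr (N, a) => sigmaRV (U0 N a) end) (E j).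
  move=> j; rewrite mem_cat => /orP[] /mapP.
    move=> [[a s] _ ->]; split => //; rewrite E1; exact: conf_cells_sigma.
  move=> [a _ ->]; split; first by rewrite /= ltn_ord.
  rewrite E2; exists [set x | init_code x = c (a, None)] => //.
  exact: measurable_init_code.
have PE := indep J12 HJ.
have -> : [set w | conf w = c] = \big[setI/setT]_(j <- J1 ++ J2) E j.
  apply/seteqP; split => w.
    move=> /= Hw; apply/big_setI_in => j; rewrite mem_cat => /orP[] /mapP.
      by move=> [[a s] _ ->]; rewrite E1; apply/big_setI_in => x _; rewrite /= -Hw ffunE.
    by move=> [a _ ->]; rewrite E2 /= -Hw ffunE.
  move=> /big_setI_in H; apply/ffunP => -[a [[[s k] j]|]]; rewrite ffunE.
    have := H (inl (a.+1, s)); rewrite E1 mem_cat.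
    have -> : (inl (a.+1, s) : index) \in J1.
      by apply/mapP; exists (a, s); rewrite // mem_enum.
    by move=> /(_ isT)/big_setI_in/(_ (k, j)); apply; rewrite mem_enum.
  have := H (inr (N, a.+1)); rewrite E2 mem_cat.
  have -> : (inr (N, a.+1) : index) \in J2 by apply/mapP; exists a; rewrite // mem_enum.
  by rewrite orbT => /(_ isT).
have cat : (\prod_(j <- J1 ++ J2) P (E j) = (\prod_(x <- enum signed) P (E (inl (x.1.+1, x.2))))
    * (\prod_(a <- enum 'I_N) P (E (inr (N, a.+1)))))%E.
  by rewrite big_cat /J1 /J2 !big_map.
rewrite PE cat.
have -> : (\prod_(x <- enum signed) P (E (inl (x.1.+1, x.2))))%E =
  (\prod_(x : signed) \prod_(y : cells) coord_law (Some (x.2, y.1, y.2)) (c (x.1, Some (x.2, y.1, y.2))))%:E.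
  rewrite -prodEFin big_enum; apply: eq_bigr => x _.
  by rewrite E1 conf_cells_law.
have -> : (\prod_(a <- enum 'I_N) P (E (inr (N, a.+1))))%E =
  (\prod_(a : 'I_N) coord_law None (c (a, None)))%:E.
  rewrite -prodEFin big_enum; apply: eq_bigr => a _.
  by rewrite E2 conf_at_law.
rewrite -EFinM; congr EFin; rewrite /prod_wt.
have -> : \prod_(i : Idx) coord_law i.2 (c i) = \prod_a \prod_y coord_law y (c (a, y)).
  by rewrite pair_bigA; apply: eq_bigr => -[a y] _.
rewrite -(pair_bigA _ (fun a s => \prod_(y : cells) coord_law (Some (s, y.1, y.2)) (c (a, Some (s, y.1, y.2))))) /=.
rewrite -big_split /=; apply: eq_bigr => a _.
rewrite [RHS](bigD1 None) //= mulrC; congr (_ * _).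
rewrite [RHS](reindex_omap Some id); last by case.
rewrite [RHS](eq_bigl xpredT) => [|x]; last by rewrite /= eqxx.
transitivity (\prod_s \prod_k \prod_j coord_law (Some ((s, k), j)) (c (a, Some ((s, k), j)))).
  by apply: eq_bigr => s _; rewrite pair_bigA.
by rewrite pair_bigA pair_bigA; apply: eq_bigr => -[[s k] j] _.
Qed.

(** The transfer from [Omega] to the finite product space. *)
Lemma integral_conf (F : {ffun Idx -> V} -> R) : (forall c, 0 <= F c) ->
  (\int[P]_w (F (conf w))%:E)%E = (Ex (fun i => coord_law i.2) F)%:E.
Proof.
move=> F0; rewrite (integral_finite_valued P measurable_conf F0); congr EFin.
by apply: eq_bigr => c _; rewrite conf_law mulrC.
Qed.

End ConfigurationLaw.

(** * Paths and schemes *)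

Section Cadlag.
Context {R : realType}.
Implicit Types (f : R -> R) (s t T B : R).

Lemma leftlim_cvg f s : cadlag f -> 0 < s -> f x @[x --> at_left s] --> leftlim f s.
Proof. by move=> [_ fl] s0; rewrite /leftlim s0; apply: fl. Qed.

(** One-sided limits bound the path near every time, and compactness of the interval makes the bound
    uniform. *)
Lemma cadlag_bounded f T : cadlag f -> exists B, forall t, 0 <= t <= T -> `|f t| <= B.
Proof.
move=> [fr fl].
have K := @segment_compact R 0 T; rewrite compact_near_coveringP in K.
(* [cadlag] is silent about negative times, so neighbourhoods of 0 are only inspected on the
   right. *)
pose Q (B x : R) := 0 <= x -> `|f x| <= B.
have [|B0 [_ HB]] := K R (pinfty_nbhs R) Q _; last first.
  exists (B0 + 1) => t /andP[t0 tT]; apply: (HB (B0 + 1)) => //=; first by rewrite ltrDl.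
  by rewrite in_itv /= t0.
move=> x; rewrite /= in_itv /= => /andP[x0 _].
have [Br Hr] : exists B, \forall y \near at_right x, `|f y| <= B.
  exists (`|f x| + 1); have := fr x x0 => /cvgrPdist_lt/(_ 1 ltr01).
  apply: filterS => y H; have := ler_normD (f y - f x) (f x).
  by rewrite subrK distrC; move: H; lra.
have [Bl Hl] : exists B, \forall y \near at_left x, 0 <= y -> `|f y| <= B.
  move: x0; rewrite le_eqVlt => /orP[/eqP <-|x0].
    exists 0; near=> y => y0; exfalso.
    have : y < 0 by near: y; exact: nbhs_left_lt.
    by rewrite ltNge y0.
  have /cvg_ex[l fxl] := fl x x0.
  exists (`|l| + 1); have := fxl => /cvgrPdist_lt/(_ 1 ltr01).
  apply: filterS => y H _; have := ler_normD (f y - l) l.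
  by rewrite subrK distrC; move: H; lra.
pose B := Num.max `|f x| (Num.max Br Bl).
have HB : \forall y \near x, 0 <= y -> `|f y| <= B.
  move: Hr Hl; rewrite !near_withinE => Hr Hl.
  near=> y => y0; have [yx|xy|->] := ltgtP y x.
  - rewrite /B !le_max; apply/orP; right; apply/orP; right; move: yx y0.
    by near: y.
  - rewrite /B !le_max; apply/orP; right; apply/orP; left; move: xy.
    by near: y.
  - by rewrite /B le_max lexx.
exists ([set y | 0 <= y -> `|f y| <= B], [set b | B < b]) => /=.
  by split => //; exists B; split => //; rewrite num_real.
by move=> [y b] [/= Hy Bb] y0; apply: le_trans (Hy y0) (ltW Bb).
Unshelve. all: by end_near. Qed.

Lemma leftlim_le f s a B c : cadlag f -> 0 <= a -> a < s ->
  (forall t, a <= t < s -> `|f t - c| <= B) -> `|leftlim f s - c| <= B.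
Proof.
move=> cf a0 as_ H.
have s0 := le_lt_trans a0 as_.
have := leftlim_cvg cf s0 => fl.
have fl' : `|f x - c| @[x --> at_left s] --> `|leftlim f s - c|.
  by apply: cvg_norm; apply: cvgB fl _; apply: cvg_cst.
rewrite -(cvg_lim (@Rhausdorff R) fl'); apply: limr_le.
  by apply/cvg_ex; exists `|leftlim f s - c|.
near=> x; apply: H; apply/andP; split.
  by apply: ltW; near: x; apply: nbhs_left_gt.
by near: x; apply: nbhs_left_lt.
Unshelve. all: by end_near. Qed.

Lemma leftlim_const f s a c : cadlag f -> 0 <= a -> a < s ->
  (forall t, a <= t < s -> f t = c) -> leftlim f s = c.
Proof.
move=> cf a0 as_ H; apply/eqP; rewrite -subr_eq0 -normr_le0.
apply: (leftlim_le cf a0 as_) => t /H ->.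
by rewrite subrr normr0.
Qed.

Lemma leftlim_bounded f s T B : cadlag f -> 0 <= s <= T ->
  (forall t, 0 <= t <= T -> `|f t| <= B) -> `|leftlim f s| <= B.
Proof.
move=> cf /andP[s0 sT] H; move: (s0); rewrite le_eqVlt => /orP[/eqP s00|s0'].
  by rewrite /leftlim -s00 ltxx; apply: H; rewrite lexx s00.
rewrite -[leftlim f s]subr0; apply: (leftlim_le cf (lexx 0) s0') => t /andP[t0 ts].
by rewrite subr0 H // t0 (le_trans (ltW ts)).
Qed.

End Cadlag.

(** * Increments of the integrals over a strip *)

Section PathIntegral.
Context {R : realType}.
Variable mu : {measure set (R * R)%type -> \bar R}.
Implicit Types (g : R * R -> R) (s t : R) (p : R * R).

Definition rows s t : set (R * R)%type := [set` `]s, t]] `*` [set` `[(0 : R), +oo[].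

Lemma measurable_dom2 t : measurable (dom2 t).
Proof.
rewrite (_ : dom2 t = [set` `[(0 : R), t]] `*` [set` `[(0 : R), +oo[]); first exact: measurable_box.
by apply/seteqP; split => -[x y] /=; rewrite !in_itv /= andbT.
Qed.

Lemma dom2_split s t : 0 <= s <= t -> dom2 t = dom2 s `|` rows s t.
Proof.
move=> /andP[s0 st]; apply/seteqP; split => -[x y] /=; rewrite ?in_itv /= ?andbT.
  move=> [/andP[x0 xt] y0]; case: (leP x s) => xs.
    by left; split => //=; rewrite x0.
  by right; split => /=; rewrite in_itv /= ?xs ?xt ?andbT.
move=> [[/andP[/= x0 xs] y0]|[]]; first by split => //=; rewrite x0 (le_trans xs).
rewrite /= !in_itv /= andbT => /andP[sx xt] y0; split => //.
by rewrite xt andbT (le_trans s0 (ltW sx)).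
Qed.

Lemma measurable_point p : measurable [set p].
Proof.
rewrite (_ : [set p] = [set` `[p.1, p.1]] `*` [set` `[p.2, p.2]]); first exact: measurable_box.
case: p => a b; apply/seteqP; split => -[x y] /=; rewrite !in_itv /=.
  by move=> [-> ->]; rewrite !lexx.
by rewrite -!eq_le => -[/eqP -> /eqP ->].
Qed.

Lemma integral_atom (D Z : set (R * R)%type) g p :
  measurable D -> measurable Z -> measurable_fun D (fun x => (g x)%:E) ->
  D p -> mu [set p] = 1%E -> mu Z = 0%E ->
  (forall x, D x -> x <> p -> g x <> 0 -> Z x) ->
  (\int[mu]_(x in D) (g x)%:E)%E = (g p)%:E.
Proof.
move=> mD mZ mg Dp mp Z0 H.
have mp' : measurable [set p] by apply: measurable_point.
have DE : D = [set p] `|` (D `\ p) by rewrite setDUK // => x ->.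
have mDp : measurable (D `\ p) by apply: measurableD.
rewrite DE integral_setU //; last 2 first.
- by rewrite -DE.
- by apply/disj_setPS => x [/= ->] [].
have -> : (\int[mu]_(x in D `\ p) (g x)%:E = 0)%E.
  rewrite (@ae_eq_integral _ _ _ mu (D `\ p) (cst 0%E)) ?integral0 //.
    by apply: measurable_funS mg => // x [].
  exists Z; split => // x /= /not_implyP[[Dx xp] gx]; apply: (H x Dx xp) => g0.
  by apply: gx; rewrite g0.
rewrite adde0 (eq_integral (cst (g p)%:E)); last by move=> x /set_mem ->.
by rewrite integral_cst // mp mule1.
Qed.

Lemma integral_off_null (D Z : set (R * R)%type) g :
  measurable D -> measurable Z -> measurable_fun D (fun x => (g x)%:E) ->
  mu Z = 0%E -> (forall x, D x -> g x <> 0 -> Z x) ->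
  (\int[mu]_(x in D) (g x)%:E)%E = 0%E.
Proof.
move=> mD mZ mg Z0 H; rewrite (@ae_eq_integral _ _ _ mu D (cst 0%E)) ?integral0 //.
exists Z; split => // x /= /not_implyP[Dx gx]; apply: (H x Dx) => g0.
by apply: gx; rewrite g0.
Qed.

Lemma measurable_rows s t : measurable (rows s t).
Proof. exact: measurable_box. Qed.

Lemma pint_incr s t g : 0 <= s <= t -> pintegrable mu t g ->
  pint mu t g - pint mu s g = fine (\int[mu]_(x in rows s t) (g x)%:E)%E.
Proof.
move=> st ig; rewrite /pint.
have ms := measurable_dom2 s; have mt := measurable_dom2 t; have mr := measurable_rows s t.
have sub1 : dom2 s `<=` dom2 t by rewrite (dom2_split st); apply: subsetUl.
have sub2 : rows s t `<=` dom2 t by rewrite (dom2_split st); apply: subsetUr.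
have i1 := integrableS mt ms sub1 ig; have i2 := integrableS mt mr sub2 ig.
have mg := measurable_int mu ig.
have -> : (\int[mu]_(x in dom2 t) (g x)%:E =
   \int[mu]_(x in dom2 s) (g x)%:E + \int[mu]_(x in rows s t) (g x)%:E)%E.
  rewrite (dom2_split st) integral_setU //; first by rewrite -dom2_split.
  apply/disj_setPS => -[x y] [[/= /andP[_ xs] _] [/= + _]].
  by rewrite in_itv /= => /andP[sx _]; move: (lt_le_trans sx xs); rewrite ltxx.
by rewrite fineD ?integrable_fin_num // [X in X - _]addrC addrK.
Qed.

Lemma pint_incr0 s t g (K : R) : 0 <= s <= t -> pintegrable mu t g ->
  (forall x, rows s t x -> K <= x.2 -> g x = 0) ->
  mu ([set` `]s, t]] `*` [set` `[(0 : R), K[]) = 0%E -> pint mu t g = pint mu s g.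
Proof.
move=> st ig gK m0; apply/eqP; rewrite -subr_eq0 pint_incr //.
rewrite (@integral_off_null (rows s t) ([set` `]s, t]] `*` [set` `[(0 : R), K[])) ?fine0 //.
- exact: measurable_rows.
- exact: measurable_box.
- apply: measurable_funS (measurable_int mu ig); first exact: measurable_dom2.
  by rewrite (dom2_split st); apply: subsetUr.
move=> [x y] [/= xs]; rewrite in_itv /= andbT => y0 gx; split => //=.
rewrite in_itv /= y0 ltNge; apply/negP => Ky; apply: gx; apply: gK => //.
by split => //=; rewrite in_itv /= andbT.
Qed.

Lemma pint_incr_atom s t g (K : R) p : 0 <= s <= t -> pintegrable mu t g ->
  (forall x, rows s t x -> K <= x.2 -> g x = 0) ->
  rows s t p -> mu [set p] = 1%E ->
  mu (([set` `]s, t]] `*` [set` `[(0 : R), K[]) `\ p) = 0%E ->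
  pint mu t g = pint mu s g + g p.
Proof.
move=> st ig gK rp mp m0; apply/eqP; rewrite addrC -subr_eq pint_incr //.
rewrite (@integral_atom (rows s t) (([set` `]s, t]] `*` [set` `[(0 : R), K[]) `\ p) g p) //.
- exact: measurable_rows.
- by apply: measurableD; [exact: measurable_box|exact: measurable_point].
- apply: measurable_funS (measurable_int mu ig); first exact: measurable_dom2.
  by rewrite (dom2_split st); apply: subsetUr.
move=> [x y] [/= xs]; rewrite in_itv /= andbT => y0 xp gx; split => //.
split => //=; rewrite in_itv /= y0 ltNge; apply/negP => Ky; apply: gx; apply: gK => //.
by split => //=; rewrite in_itv /= andbT.
Qed.

Lemma pint0 g (K : R) : pintegrable mu 0 g ->
  (forall x, dom2 0 x -> K <= x.2 -> g x = 0) ->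
  mu ([set` `[(0 : R), 0]] `*` [set` `[(0 : R), K[]) = 0%E -> pint mu 0 g = 0.
Proof.
move=> ig gK m0; rewrite /pint.
rewrite (@integral_off_null (dom2 0) ([set` `[(0 : R), 0]] `*` [set` `[(0 : R), K[])) ?fine0 //.
- exact: measurable_dom2.
- exact: measurable_box.
- exact: measurable_int ig.
move=> [x y] /= [x0 y0] gx; split => /=; first by rewrite in_itv.
rewrite in_itv /= y0 ltNge; apply/negP => Ky; apply: gx; exact: gK.
Qed.

End PathIntegral.

Section StripIncrements.
Context {R : realType}.
Variables (T : R) (n k K : nat).
Hypothesis T_gt0 : 0 < T.
Variable nu : {measure set (R * R)%type -> \bar R}.
Implicit Types (g : R * R -> R) (s t : R).

(** Truncates the unbounded axis of levels: along a bounded path the rates stay below some integer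
    [K], so atoms at level [K] or higher are never accepted and slabs of height [K] tell
    everything. *)
Definition supported_below g := forall x, 0 <= x.1 <= T -> K%:R <= x.2 -> g x = 0.

Hypothesis kn : (k < 2 ^ n)%N.

Let sub s t : grid T n k <= s -> t <= grid T n k.+1 ->
  [set` `]s, t]] `*` [set` `[(0 : R), K%:R[] `<=` slab T n k K.
Proof.
move=> ks tk -[x y] [/=]; rewrite !in_itv /= => /andP[sx xt] hy; split => //=.
by rewrite in_itv /= (le_lt_trans ks sx) (le_trans xt tk).
Qed.

Lemma grid_leT j : (j <= 2 ^ n)%N -> grid T n j <= T.
Proof. by move=> jn; rewrite -[leRHS](gridT T n); apply: grid_le. Qed.

Let rowsT g s t : supported_below g -> grid T n k <= s -> s <= t -> t <= grid T n k.+1 ->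
  forall x, rows s t x -> K%:R <= x.2 -> g x = 0.
Proof.
move=> gK ks st tk -[x y] [/=]; rewrite in_itv /= => /andP[sx xt] _ Ky.
apply: gK => //=; rewrite (le_trans xt (le_trans tk (grid_leT kn))) andbT.
by apply: ltW; apply: le_lt_trans sx; apply: le_trans ks; apply: grid_ge0.
Qed.

Let s_ge0 s : grid T n k <= s -> 0 <= s.
Proof. by apply: le_trans; apply: grid_ge0. Qed.

Let mbox s t : measurable ([set` `]s, t]] `*` [set` `[(0 : R), K%:R[]).
Proof. exact: measurable_box. Qed.

Lemma pint_strip_empty g s t : supported_below g ->
  grid T n k <= s -> s <= t -> t <= grid T n k.+1 -> pintegrable nu t g ->
  nu (slab T n k K) = 0%E -> pint nu t g = pint nu s g.
Proof.
move=> gK ks st tk ig n0; apply: (@pint_incr0 _ _ s t g K%:R) => //.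
- by rewrite (s_ge0 ks).
- exact: rowsT gK ks st tk.
- exact: subset_measure0 (mbox _ _) (@measurable_slab _ _ _ _ _) (sub ks tk) n0.
Qed.

Lemma pint_strip_atom g s t p : supported_below g ->
  grid T n k <= s -> s <= t -> t <= grid T n k.+1 -> pintegrable nu t g ->
  slab T n k K p -> nu [set p] = 1%E -> nu (slab T n k K `\ p) = 0%E ->
  pint nu t g = pint nu s g + (if s < p.1 <= t then g p else 0).
Proof.
move=> gK ks st tk ig Sp p1 p0.
have mSp : measurable (slab T n k K `\ p).
  by apply: measurableD; [exact: measurable_slab|exact: measurable_point].
have st0 : 0 <= s <= t by rewrite (s_ge0 ks).
case: ifP => [/andP[sp pt]|spt].
  apply: (@pint_incr_atom _ _ s t g K%:R) => //.
  - exact: rowsT gK ks st tk.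
  - case: Sp => _ /=; rewrite in_itv /= => /andP[y0 _].
    by split; rewrite /= in_itv /= ?sp ?pt ?y0.
  - apply: subset_measure0 mSp _ p0.
      by apply: measurableD; [exact: mbox|exact: measurable_point].
    by apply: setSD; apply: sub.
rewrite addr0; apply: (@pint_incr0 _ _ s t g K%:R) => //.
  exact: rowsT gK ks st tk.
apply: subset_measure0 (mbox _ _) mSp _ p0 => x Hx; split; first exact: sub ks tk _ Hx.
move=> /= xp; move: Hx; rewrite xp => -[/=]; rewrite in_itv /= => Hp _.
by move: spt; rewrite Hp.
Qed.

End StripIncrements.

Section Atoms.
Context {R : realType}.
Variables (T : R) (mu : nat -> bool -> {measure set (R * R)%type -> \bar R}) (N K : nat).
Hypothesis T_gt0 : 0 < T.

Definition atom b o (p : R * R) :=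
  [/\ (1 <= b <= N)%N, 0 < p.1 <= T, 0 <= p.2 < K%:R & mu b o [set p] != 0%E].

Lemma grid_locate n (t : R) : 0 < t <= T -> exists2 k, (k < 2 ^ n)%N & t \in strip T n k.
Proof.
move=> /andP[t0 tT]; have [k [/= tk _]] := @cell_cover _ T T_gt0 n (t, 0) t0 (lexx 0).
exists k => //; rewrite ltnNge; apply/negP => nk.
move: tk; rewrite in_itv /= => /andP[kt _].
have := grid_le T_gt0 n nk; rewrite gridT => /le_lt_trans /(_ kt).
by rewrite ltNge tT.
Qed.

Lemma slab_atom n k b o p : (k < 2 ^ n)%N -> (1 <= b <= N)%N -> slab T n k K p ->
  mu b o [set p] = 1%E -> atom b o p.
Proof.
move=> kn bN [/=]; rewrite !in_itv /= => /andP[kp pk] hy p1; split => //.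
  rewrite (le_lt_trans _ kp) ?grid_ge0 //= (le_trans pk) //.
  by rewrite -[leRHS](gridT T n); apply: grid_le.
by rewrite p1 eqe oner_eq0.
Qed.

(* There are finitely many atoms, so a strict inequality on each of them is
   uniform. *)
Lemma atom_gap (F : nat -> bool -> R * R -> R) n0 : simple_strips T mu N n0 K ->
  exists2 gam : R, 0 < gam & forall b o p, atom b o p ->
    F b o p < p.2 -> F b o p + gam <= p.2.
Proof.
move=> iso.
have loc k : (k < 2 ^ n0)%N -> exists2 gam : R, 0 < gam & forall b o p, atom b o p ->
    p.1 \in strip T n0 k -> F b o p < p.2 -> F b o p + gam <= p.2.
  move=> kn; case: (iso k kn) => [H|[b [sg [p [bN Sp p1 p0 other]]]]].
    exists 1 => // b o p [bN _ hy nz] hs _; exfalso; move/eqP: nz; apply.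
    apply: subset_measure0 (measurable_point p) (@measurable_slab _ _ _ _ _) _ (H b o bN).
    by move=> _ -> /=; split => //=; rewrite in_itv.
  exists (if F b sg p < p.2 then p.2 - F b sg p else 1); first by case: ifP => // H; rewrite subr_gt0.
  move=> b' o' p' [bN' _ hy nz] hs lt.
  have Sp' : slab T n0 k K p' by split => //=; rewrite in_itv.
  have [bo|bo] := pselect ((b', o') = (b, sg)); last first.
    exfalso; move/eqP: nz; apply.
    apply: subset_measure0 (measurable_point p') (@measurable_slab _ _ _ _ _) _ (other b' o' bN' bo).
    by move=> _ ->.
  case: bo => ? ?; subst b' o'; have [pp|pp] := pselect (p' = p).
    by rewrite pp in lt *; rewrite lt addrC subrK.
  exfalso; move/eqP: nz; apply.
  apply: subset_measure0 (measurable_point p') _ _ p0.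
    by apply: measurableD; [exact: measurable_slab|exact: measurable_point].
  by move=> _ ->.
have [gam g0 Hg] : exists2 gam : R, 0 < gam & forall k, (k < 2 ^ n0)%N -> forall b o p, atom b o p ->
    p.1 \in strip T n0 k -> F b o p < p.2 -> F b o p + gam <= p.2.
  have : (2 ^ n0 <= 2 ^ n0)%N by [].
  elim: {1 3}(2 ^ n0)%N => [|m IH] mn; first by exists 1.
  have [g1 g10 H1] := IH (ltnW mn); have [g2 g20 H2] := loc m mn.
  exists (Num.min g1 g2); first by rewrite lt_min g10.
  move=> k; rewrite ltnS leq_eqVlt => /orP[/eqP ->|km] b o p ap hs lt.
    by apply: le_trans (H2 b o p ap hs lt); rewrite lerD2l ge_min lexx orbT.
  by apply: le_trans (H1 k km b o p ap hs lt); rewrite lerD2l ge_min lexx.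
exists gam => // b o p ap lt.
have [k kn hs] : exists2 k, (k < 2 ^ n0)%N & p.1 \in strip T n0 k.
  by apply: grid_locate; case: ap.
exact: Hg kn _ _ _ ap hs lt.
Qed.

End Atoms.

(** * Clipped rates and the acceptance of atoms *)

Section Threshold.
Context {R : realType}.
Variable phi : R -> R.

(** Composed with [clip], a locally Lipschitz rate becomes globally Lipschitz and bounded, without
    changing on the interval of radius [K]. *)
Definition clip (K x : R) : R := Num.max (- K) (Num.min K x).

(* The margin [1/(n+1)] eventually dominates the Lipschitz constant of the
   clipped rate times the error O(2^-n) of the scheme, so that every atom
   accepted by the path is accepted by the scheme. *)
Definition thr (K : R) (n : nat) (x : R) : nat :=
  (Num.truncn (2 ^+ n * (phi (clip K x) + n.+1%:R^-1))).+1.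

Lemma clip_id K x : `|x| <= K -> clip K x = x.
Proof.
rewrite ler_norml => /andP[h1 h2]; rewrite /clip.
by rewrite (min_idPr h2); apply/max_idPr.
Qed.

Lemma clip_norm K x : 0 <= K -> `|clip K x| <= K.
Proof.
move=> K0; rewrite ler_norml /clip le_max lexx /= ge_max ge_min lexx /=.
by rewrite andbT; lra.
Qed.

Lemma clip_lip K x y : `|clip K x - clip K y| <= `|x - y|.
Proof.
rewrite /clip !minEle !maxEle.
do 4! case: ifP => /idP; try move/negP; rewrite -?ltNge;
  move=> *; rewrite ler_norml; apply/andP; split;
  have := ler_norm (x - y); have := ler_norm (y - x); rewrite distrC; lra.
Qed.

(** The path decides at [x] with the exact rate, the scheme at [y] with whole cells. The first
    smallness condition lets the margin of [thr] cover the error, so accepted atoms stay accepted;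
    by the second, the gap [gam] above the rate exceeds the error, the margin and the height of a
    cell together, so rejected atoms stay rejected. *)
Lemma thr_decision K n (lip x y z eta gam : R) :
  (forall x, 0 <= phi x) ->
  (forall x y, `|phi (clip K x) - phi (clip K y)| <= lip * `|x - y|) ->
  0 <= lip -> `|x| <= K -> 0 <= z -> `|x - y| <= eta ->
  lip * eta <= n.+1%:R^-1 -> lip * eta + n.+1%:R^-1 + (2 ^+ n)^-1 < gam ->
  (phi x < z -> phi x + gam <= z) ->
  (Num.truncn (z * 2 ^+ n) < thr K n y)%N = (z <= phi x).
Proof.
move=> phi0 Hlip lip0 xK z0 xy le1 lt1 gap.
have t0 := @two_gt0 R n.
have xyl : `|phi x - phi (clip K y)| <= lip * eta.
  rewrite -{1}(clip_id xK); apply: le_trans (Hlip _ _) _; exact: ler_wpM2l.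
have r0 : 0 <= phi (clip K y) + n.+1%:R^-1 by rewrite addr_ge0 // invr_ge0.
move: xyl; rewrite ler_norml => /andP[h1 h2].
rewrite /thr ltnS; case: (lerP z (phi x)) => zx.
  apply: le_truncn; rewrite mulrC ler_pM2l //.
  move: zx h2 le1; set j := n.+1%:R^-1; lra.
have := gap zx => gz; apply/negbTE; rewrite -ltnNge.
have h3 : 2 ^+ n * (phi (clip K y) + n.+1%:R^-1) + 1 <= z * 2 ^+ n.
  rewrite [X in _ + X](_ : 1 = 2 ^+ n * (2 ^+ n)^-1); last by rewrite mulfV // gt_eqF.
  rewrite -mulrDr [leRHS]mulrC ler_pM2l //.
  move: gz lt1 h1; set i := (2 ^+ n)^-1; set j := n.+1%:R^-1; lra.
have h4 := truncn_itv (mulr_ge0 (ltW t0) r0).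
have h5 : 0 <= z * 2 ^+ n by rewrite mulr_ge0 // ltW.
rewrite truncn_gt_nat; apply: le_trans h3.
by rewrite -natr1 lerD2r; case/andP: h4.
Qed.

End Threshold.

Section JumpSupport.
Context {R : realType}.
Variables (T : R) (phi : R -> R) (K : nat) (u : R -> R) (B : R).
Hypothesis cu : cadlag u.
Hypothesis uB : forall t, 0 <= t <= T -> `|u t| <= B.
Hypothesis phiK : forall x, `|x| <= B -> phi x < K%:R.

Let above s (x : R * R) : 0 <= x.1 <= T -> K%:R <= x.2 ->
  (x.2 <= phi (sgnO s * leftlim u x.1)) = false.
Proof.
move=> xT Kx; apply/negbTE; rewrite -ltNge; apply: lt_le_trans Kx; apply: phiK.
by rewrite normr_sgnOM; apply: (leftlim_bounded cu xT uB).
Qed.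

Lemma own_jump_supported s : supported_below T K (own_jump phi s u).
Proof. by move=> x xT Kx; rewrite /own_jump above // mulr0. Qed.

Lemma spike_supported s : supported_below T K (spike phi s u).
Proof. by move=> x xT Kx; rewrite /spike above. Qed.

End JumpSupport.

(** * The actor system inside a strip *)

Section ActorPath.
Context {R : realType}.
Variables (T h : R) (phi : R -> R) (mu : nat -> bool -> {measure set (R * R)%type -> \bar R}) (N K : nat).
Variables (x0 : nat -> R) (u : nat -> R -> R) (B : R).
Hypothesis T_gt0 : 0 < T.
Hypothesis cu : forall a, (1 <= a <= N)%N -> cadlag (u a).
Hypothesis iown : forall a s t, (1 <= a <= N)%N -> 0 <= t -> pintegrable (mu a s) t (own_jump phi s (u a)).
Hypothesis ispike : forall a s t, (1 <= a <= N)%N -> 0 <= t -> pintegrable (mu a s) t (spike phi s (u a)).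
Hypothesis uE : forall a t, (1 <= a <= N)%N -> 0 <= t ->
  u a t = x0 a - \sum_(s : bool) pint (mu a s) t (own_jump phi s (u a))
    + h / N%:R * \sum_(s : bool) \sum_(1 <= b < N.+1 | b != a)
        sgnO s * pint (mu b s) t (spike phi s (u b)).
Hypothesis uB : forall a t, (1 <= a <= N)%N -> 0 <= t <= T -> `|u a t| <= B.
Hypothesis phiK : forall x, `|x| <= B -> phi x < K%:R.
Hypothesis mu0 : forall a s, (1 <= a <= N)%N ->
  mu a s ([set` `[(0 : R), 0]] `*` [set` `[(0 : R), K%:R[]) = 0%E.

Let own_sup a s : (1 <= a <= N)%N -> supported_below T K (own_jump phi s (u a)).
Proof. by move=> aN; exact: (own_jump_supported (cu aN) (fun t => @uB a t aN) phiK). Qed.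

Let spike_sup a s : (1 <= a <= N)%N -> supported_below T K (spike phi s (u a)).
Proof. by move=> aN; exact: (spike_supported (cu aN) (fun t => @uB a t aN) phiK). Qed.

Lemma actor_init a : (1 <= a <= N)%N -> u a 0 = x0 a.
Proof.
have z g b s : (1 <= b <= N)%N -> supported_below T K g -> pintegrable (mu b s) 0 g ->
    pint (mu b s) 0 g = 0.
  move=> bN gK ig; apply: (@pint0 _ _ g K%:R) => // [x [/andP[x0' xT] _] Kx|]; last exact: mu0.
  by apply: gK => //; rewrite x0' (le_trans xT) // ltW.
move=> aN; rewrite uE // big1 ?subr0; last first.
  by move=> s _; rewrite (z _ a s) //; [exact: own_sup|exact: iown].
rewrite big1 ?mulr0 ?addr0 // => s _; rewrite big_nat_cond big1 // => b /andP[bN _].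
by rewrite (z _ b s) ?mulr0 //; [exact: spike_sup|exact: ispike].
Qed.

Let u_diff a s t (dO : bool -> R) (dS : bool -> nat -> R) : (1 <= a <= N)%N -> 0 <= s -> 0 <= t ->
  (forall sg, pint (mu a sg) t (own_jump phi sg (u a)) =
     pint (mu a sg) s (own_jump phi sg (u a)) + dO sg) ->
  (forall sg b, (1 <= b <= N)%N -> pint (mu b sg) t (spike phi sg (u b)) =
     pint (mu b sg) s (spike phi sg (u b)) + dS sg b) ->
  u a t = u a s - \sum_(sg : bool) dO sg + h / N%:R * \sum_(sg : bool) \sum_(1 <= b < N.+1 | b != a) sgnO sg * dS sg b.
Proof.
move=> aN s0 t0 HO HS; rewrite (uE aN t0) (uE aN s0).
have -> : \sum_(sg : bool) \sum_(1 <= b < N.+1 | b != a) sgnO sg * pint (mu b sg) t (spike phi sg (u b)) =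
   \sum_(sg : bool) \sum_(1 <= b < N.+1 | b != a) sgnO sg * pint (mu b sg) s (spike phi sg (u b)) +
   \sum_(sg : bool) \sum_(1 <= b < N.+1 | b != a) sgnO sg * dS sg b.
  rewrite -big_split; apply: eq_bigr => sg _ /=; rewrite -big_split /=.
  rewrite big_nat_cond [RHS]big_nat_cond; apply: eq_bigr => b /andP[bN _].
  by rewrite HS // mulrDr.
under eq_bigr do rewrite HO.
rewrite big_split /=; ring.
Qed.

Section Strip.
Variables (n k : nat).
Hypothesis kn : (k < 2 ^ n)%N.
Let g := grid T n.

Let g0 : 0 <= g k. Proof. exact: grid_ge0. Qed.

Lemma actor_strip_empty a t :
  (forall a s, (1 <= a <= N)%N -> mu a s (slab T n k K) = 0%E) ->
  (1 <= a <= N)%N -> g k <= t <= g k.+1 -> u a t = u a (g k).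
Proof.
move=> H aN /andP[kt tk]; have t0 := le_trans g0 kt.
rewrite (@u_diff a (g k) t (fun=> 0) (fun _ _ => 0)) //; last 2 first.
- move=> sg; rewrite addr0.
  by apply: (pint_strip_empty T_gt0 kn (@own_sup a sg aN)) => //; [exact: iown|exact: H].
- move=> sg b bN; rewrite addr0.
  by apply: (pint_strip_empty T_gt0 kn (@spike_sup b sg bN)) => //; [exact: ispike|exact: H].
rewrite !big1 ?subr0 ?mulr0 ?addr0 // => sg _; rewrite big1 // => b _; exact: mulr0.
Qed.

Variables (b0 : nat) (s0 : bool) (p : R * R).
Hypothesis b0N : (1 <= b0 <= N)%N.
Hypothesis Sp : slab T n k K p.
Hypothesis p1 : mu b0 s0 [set p] = 1%E.
Hypothesis p0 : mu b0 s0 (slab T n k K `\ p) = 0%E.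
Hypothesis other : forall a' s', (1 <= a' <= N)%N -> (a', s') <> (b0, s0) -> mu a' s' (slab T n k K) = 0%E.

Let kp : g k < p.1 <= g k.+1.
Proof. by case: Sp => /=; rewrite in_itv. Qed.

Let pint_cross b s t f : (1 <= b <= N)%N -> supported_below T K f ->
  pintegrable (mu b s) t f -> g k <= t <= g k.+1 ->
  pint (mu b s) t f = pint (mu b s) (g k) f +
    (if ((b, s) == (b0, s0)) && (p.1 <= t) then f p else 0).
Proof.
move=> bN fK itf /andP[kt tk]; case: eqP => [bs|bs] /=; last first.
  by rewrite addr0; apply: (pint_strip_empty T_gt0 kn fK) => //; exact: other.
case: bs itf => -> -> itf.
rewrite (pint_strip_atom T_gt0 kn fK (lexx _) kt tk itf Sp p1 p0).
by case/andP: kp => -> _.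
Qed.

Let single_sum a (v : R) (c : bool) : (1 <= a <= N)%N ->
  \sum_(sg : bool) \sum_(1 <= b < N.+1 | b != a)
     sgnO sg * (if ((b, sg) == (b0, s0)) && c then v else 0) =
  (if (b0 != a) && c then sgnO s0 * v else 0).
Proof.
move=> aN; case: c; last first.
  rewrite andbF big1 // => sg _; rewrite big1 // => b _; by rewrite andbF mulr0.
rewrite andbT (bigD1 s0) //= [X in _ + X]big1 ?addr0; last first.
  move=> sg ne; rewrite big1 // => b _; rewrite andbT ?xpair_eqE /= (negbTE ne) andbF mulr0 //.
have b0i : b0 \in index_iota 1 N.+1 by rewrite mem_index_iota.
rewrite -big_filter; case: ifP => ba.
  rewrite (bigD1_seq b0) /= ?filter_uniq ?iota_uniq ?mem_filter ?ba //.
  rewrite ?xpair_eqE ?eqxx /= big1 ?addr0 // => b bb.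
  by rewrite ?xpair_eqE /= (negbTE bb) mulr0.
rewrite big_filter big1 // => b ba'; rewrite andbT ?xpair_eqE /=.
case: eqP => [bb|]; rewrite /= ?mulr0 //.
by move: ba'; rewrite bb ba.
Qed.

Lemma actor_strip_before a t : (1 <= a <= N)%N -> g k <= t < p.1 -> u a t = u a (g k).
Proof.
move=> aN /andP[kt tp]; have t0 := le_trans g0 kt.
have tk : g k <= t <= g k.+1.
  by rewrite kt (le_trans (ltW tp)) //; case/andP: kp.
have ptF : (p.1 <= t) = false by rewrite leNgt tp.
rewrite (@u_diff a (g k) t (fun=> 0) (fun _ _ => 0)) //; last 2 first.
- by move=> sg; rewrite (pint_cross aN (@own_sup a sg aN) (iown sg aN t0) tk) ptF andbF.
- by move=> sg b bN; rewrite (pint_cross bN (@spike_sup b sg bN) (ispike sg bN t0) tk) ptF andbF.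
rewrite !big1 ?subr0 ?mulr0 ?addr0 // => sg _; rewrite big1 // => b _; exact: mulr0.
Qed.

(** The actor system has no drift between atoms, so the value just before the atom of a strip is the
    one at its start. *)
Lemma actor_leftlim a : (1 <= a <= N)%N -> leftlim (u a) p.1 = u a (g k).
Proof.
move=> aN; case/andP: kp => kp' _.
by apply: (leftlim_const (cu aN) g0 kp') => t; apply: actor_strip_before.
Qed.

Lemma actor_strip_atom a : (1 <= a <= N)%N ->
  u a (g k.+1) = if p.2 <= phi (sgnO s0 * u b0 (g k)) then
     (if b0 == a then 0 else u a (g k) + h / N%:R * sgnO s0) else u a (g k).
Proof.
move=> aN; have t0 : 0 <= g k.+1 by apply: grid_ge0.
have tk : g k <= g k.+1 <= g k.+1 by rewrite lexx (ltW (grid_lt _ _ _)).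
have pt : p.1 <= g k.+1 by case/andP: kp.
have H := @u_diff a (g k) (g k.+1)
   (fun sg => if ((a, sg) == (b0, s0)) && (p.1 <= g k.+1) then own_jump phi s0 (u b0) p else 0)
   (fun sg b => if ((b, sg) == (b0, s0)) && (p.1 <= g k.+1) then spike phi s0 (u b0) p else 0) aN g0 t0.
rewrite H; first last.
- move=> sg b bN; rewrite (pint_cross bN (@spike_sup b sg bN) (ispike sg bN t0) tk).
  by case: eqP => [[-> ->]|].
- move=> sg; rewrite (pint_cross aN (@own_sup a sg aN) (iown sg aN t0) tk).
  by case: eqP => [[-> ->]|].
rewrite (single_sum _ _ aN) pt andbT.
have -> : \sum_(sg : bool) (if ((a, sg) == (b0, s0)) && true then own_jump phi s0 (u b0) p else 0) =
    if b0 == a then own_jump phi s0 (u b0) p else 0.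
  rewrite (bigD1 s0) //= big1 ?addr0; last first.
    by move=> sg ne; rewrite andbT ?xpair_eqE /= (negbTE ne) andbF.
  by rewrite andbT ?xpair_eqE /= eqxx andbT eq_sym.
rewrite /own_jump /spike actor_leftlim //.
case: eqP => [<-|_]; case: ifP => _; rewrite /= ?mulr1 ?mulr0 ?subr0 ?addr0 ?subrr //.
Qed.

End Strip.
End ActorPath.

Lemma sqr_le_pow2 n : (n.+1 ^ 2 <= 4 * 2 ^ n)%N.
Proof.
elim: n => // n IH; case: n IH => // -[|n] IH //.
rewrite (expnS 2 n.+2); move: IH; rewrite !expnS !expn0; lia.
Qed.

(** Provides the two smallness conditions of [thr_decision]. The margin [1/(n+1)] tends to zero so
    slowly that [2^-n] is at most four times its square. *)
Lemma eventually_small (R : realType) (lip C gam : R) : 0 <= lip -> 0 <= C -> 0 < gam ->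
  exists n1, forall n, (n1 <= n)%N ->
    lip * (C / 2 ^+ n) <= n.+1%:R^-1 /\ lip * (C / 2 ^+ n) + n.+1%:R^-1 + (2 ^+ n)^-1 < gam.
Proof.
move=> lip0 C0 gam0.
(* With [i = 1/(n+1)], the first summand gives [lip * C / 2^n <= i]; the three terms of the second
   condition are then at most [i], [i] and [4i], whence the 6. *)
exists (Num.truncn (4 * (lip * C) + 6 / gam)).+1 => n nn.
have t0 := @two_gt0 R n.
have s0 : 0 < n.+1%:R :> R by rewrite ltr0n.
have lC0 : 0 <= lip * C by rewrite mulr_ge0.
have g0 : 0 <= 6 / gam by rewrite divr_ge0 // ltW.
have big : 4 * (lip * C) + 6 / gam < n.+1%:R.
  apply: lt_le_trans (truncnS_gt _) _; rewrite ler_nat ltnS; exact: ltnW.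
set i := n.+1%:R^-1.
have i0 : 0 < i by rewrite invr_gt0.
have iS : n.+1%:R * i = 1 by rewrite mulfV // gt_eqF.
have i1 : i <= 1 by rewrite invf_le1 // ler1n.
have half : (2 ^+ n)^-1 <= 4 * i * i :> R.
  have q0 : 0 <= (2 ^+ n)^-1 * (i * i) by rewrite !mulr_ge0 ?invr_ge0 // ltW.
  have H : n.+1%:R * n.+1%:R <= 4 * 2 ^+ n :> R.
    by have := sqr_le_pow2 n; rewrite -(ler_nat R) natrM !natrX expr2.
  have := ler_wpM2r q0 H.
  have -> : n.+1%:R * n.+1%:R * ((2 ^+ n)^-1 * (i * i)) = (2 ^+ n)^-1.
    by rewrite mulrCA mulrACA iS !mulr1.
  have -> // : 4 * 2 ^+ n * ((2 ^+ n)^-1 * (i * i)) = 4 * i * i.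
  transitivity (4 * (2 ^+ n * (2 ^+ n)^-1) * (i * i)); first by rewrite !mulrA.
  by rewrite mulfV ?gt_eqF // mulr1 mulrA.
have H1 : lip * (C / 2 ^+ n) <= i.
  rewrite mulrA; apply: le_trans (ler_wpM2l lC0 half) _.
  have -> : lip * C * (4 * i * i) = (4 * (lip * C) * i) * i by ring.
  rewrite ler_piMl ?(ltW i0) //.
  have : 4 * (lip * C) * i <= n.+1%:R * i by rewrite ler_wpM2r ?(ltW i0) //; lra.
  by rewrite iS.
split => //.
have H2 : (2 ^+ n)^-1 <= 4 * i.
  by apply: le_trans half _; rewrite ler_piMr // mulr_ge0 // ltW.
have : 6 * i < gam.
  have : 6 / gam < n.+1%:R by lra.
  rewrite ltr_pdivrMr // => H; rewrite -(ltr_pM2l s0) mulrCA iS mulr1; lra.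
move: H1 H2; set a := lip * _; set b := (2 ^+ n)^-1; lra.
Qed.

Section StripSpikes.
Context {R : realType}.
Variables (T : R) (n k K : nat) (nu : {measure set (R * R)%type -> \bar R}).
Hypothesis T_gt0 : 0 < T.

Lemma cell_slab j : (j < K * 2 ^ n)%N -> cell T n k j `<=` slab T n k K.
Proof.
move=> jK -[x y] [/= hx]; rewrite !in_itv /= => /andP[hy1 hy2]; split => //=.
rewrite in_itv /=; apply/andP; split; first by apply: le_trans hy1; rewrite divr_ge0.
apply: lt_le_trans hy2 _; rewrite ler_pdivrMr ?two_gt0 // -natrX -natrM ler_nat //.
Qed.

Lemma has_cell_empty m : (m <= K * 2 ^ n)%N -> nu (slab T n k K) = 0%E ->
  has (fun j => nu (cell T n k j) != 0%E) (iota 0 m) = false.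
Proof.
move=> mK n0; apply/hasPn => j; rewrite mem_iota add0n /= => jm; rewrite negbK; apply/eqP.
apply: subset_measure0 (@measurable_cell _ _ _ _ _) (@measurable_slab _ _ _ _ _) _ n0.
by apply: cell_slab; apply: leq_trans jm mK.
Qed.

(** With a single atom in the strip, the charged cell is the one that contains it; reading the cells
    below [m] compares the level of the atom with [m]. *)
Lemma has_cell_atom m p : (m <= K * 2 ^ n)%N -> slab T n k K p ->
  nu [set p] = 1%E -> nu (slab T n k K `\ p) = 0%E ->
  has (fun j => nu (cell T n k j) != 0%E) (iota 0 m) = (Num.truncn (p.2 * 2 ^+ n) < m)%N.
Proof.
move=> mK Sp p1 p0.
have y0 : 0 <= p.2 * 2 ^+ n.
  by case: Sp => _ /=; rewrite in_itv /= => /andP[? _]; rewrite mulr_ge0 // ltW ?two_gt0.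
have pj j : cell T n k j p <-> j = Num.truncn (p.2 * 2 ^+ n).
  have itv : p.2 \in level n (Num.truncn (p.2 * 2 ^+ n)).
    rewrite in_itv /= ler_pdivrMr ?two_gt0 // ltr_pdivlMr ?two_gt0 //.
    exact: truncn_itv.
  split=> [[_ h2]|->]; first exact: level_uniq h2 itv.
  by split => //; case: Sp.
apply/hasP/idP => [[j]|pm].
  rewrite mem_iota add0n /= => jm nz.
  have [/pj <- //|np] := pselect (cell T n k j p).
  exfalso; move/eqP: nz; apply.
  apply: subset_measure0 (@measurable_cell _ _ _ _ _) _ _ p0.
    by apply: measurableD; [exact: measurable_slab|exact: measurable_point].
  move=> x cx; split; first by apply: cell_slab cx; apply: leq_trans jm mK.
  by move=> /= xp; apply: np; rewrite -xp.
exists (Num.truncn (p.2 * 2 ^+ n)); first by rewrite mem_iota add0n.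
apply/eqP => c0; have : nu [set p] = 0%E.
  apply: subset_measure0 (measurable_point p) (@measurable_cell _ _ _ _ _) _ c0.
  by move=> _ ->; apply/pj.
by rewrite p1 => /eqP; rewrite eqe oner_eq0.
Qed.

End StripSpikes.

Lemma thr_le (R : realType) (phi : R -> R) (kap : R) (K n : nat) x : (forall x, 0 <= phi x) ->
  (forall x, phi (clip kap x) + 2 <= K%:R) -> (thr phi kap n x <= K * 2 ^ n)%N.
Proof.
move=> phi0 HK; rewrite /thr -(ler_nat R) natrM natrX -natr1.
have t0 := @two_gt0 R n.
have t1 : 1 <= 2 ^+ n :> R by rewrite exprn_ege1 // ler1n.
have i1 : n.+1%:R^-1 <= 1 :> R by rewrite invf_le1 ?ltr0n // ler1n.
have i0 : 0 <= n.+1%:R^-1 :> R by rewrite invr_ge0.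
set r := phi _ + _; have r0 : 0 <= r by rewrite addr_ge0.
have /andP[+ _] := truncn_itv (mulr_ge0 (ltW t0) r0).
set c := Num.truncn _ => cr.
have : 2 ^+ n * r + 2 ^+ n <= 2 ^+ n * K%:R.
  rewrite -[X in _ + X]mulr1 -mulrDr ler_pM2l //; have := HK x; rewrite /r.
  move: i1; set j := n.+1%:R^-1; lra.
rewrite [K%:R * _]mulrC; move: cr t1; set q := 2 ^+ n * r; lra.
Qed.

Lemma shrink_bound (R : realType) (n : nat) (C : R) : 0 <= C -> 0 <= C / 2 ^+ n.
Proof. by move=> C0; rewrite divr_ge0 // ltW // two_gt0. Qed.

Section ActorPathScheme.
Context {R : realType}.
Variables (T h : R) (phi : R -> R) (mu : nat -> bool -> {measure set (R * R)%type -> \bar R}) (N K : nat).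
Variables (x0 : nat -> R) (u : nat -> R -> R) (B : R).
Hypothesis T_gt0 : 0 < T.
Hypothesis cu : forall a, (1 <= a <= N)%N -> cadlag (u a).
Hypothesis iown : forall a s t, (1 <= a <= N)%N -> 0 <= t -> pintegrable (mu a s) t (own_jump phi s (u a)).
Hypothesis ispike : forall a s t, (1 <= a <= N)%N -> 0 <= t -> pintegrable (mu a s) t (spike phi s (u a)).
Hypothesis uE : forall a t, (1 <= a <= N)%N -> 0 <= t ->
  u a t = x0 a - \sum_(s : bool) pint (mu a s) t (own_jump phi s (u a))
    + h / N%:R * \sum_(s : bool) \sum_(1 <= b < N.+1 | b != a)
        sgnO s * pint (mu b s) t (spike phi s (u b)).
Hypothesis uB : forall a t, (1 <= a <= N)%N -> 0 <= t <= T -> `|u a t| <= B.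
Hypothesis mu0 : forall a s, (1 <= a <= N)%N ->
  mu a s ([set` `[(0 : R), 0]] `*` [set` `[(0 : R), K%:R[]) = 0%E.
Hypothesis simple : exists n0, forall n, (n0 <= n)%N -> simple_strips T mu N n K.

Variables (kap lip : R).
Hypothesis phi_ge0 : forall x, 0 <= phi x.
Hypothesis lip_ge0 : 0 <= lip.
Hypothesis phi_lip : forall x y, `|phi (clip kap x) - phi (clip kap y)| <= lip * `|x - y|.
Hypothesis Bkap : B <= kap.
Hypothesis phi_K : forall x, phi (clip kap x) + 2 <= K%:R.

Let phiK x : `|x| <= B -> phi x < K%:R.
Proof.
move=> xB; have := phi_K x; rewrite clip_id; last exact: le_trans xB Bkap.
lra.
Qed.

Definition path_occ n (a : 'I_N) s k j := mu a.+1 s (cell T n k j) != 0%E.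

(** Errors do not accumulate. Path and scheme take the same decision in every strip, by
    [thr_decision]; then they either receive the same jump, which keeps the difference, or are both
    reset to 0, which cancels it. What remains is at most the rounding of the initial values. *)
Lemma actor_path_scheme (x0n : nat -> 'I_N -> R) :
  (forall n a, `|x0n n a - x0 a.+1| <= 1 / 2 ^+ n) ->
  exists n1, forall n, (n1 <= n)%N -> forall k a, (k <= 2 ^ n)%N ->
    `|actor_scheme (thr phi kap n) h (x0n n) (path_occ n) k a - u a.+1 (grid T n k)| <= 1 / 2 ^+ n.
Proof.
move=> x0P; have [n0 iso] := simple.
have [gam gam0 gap] := atom_gap T_gt0 (fun b s p => phi (sgnO s * leftlim (u b) p.1)) (iso n0 (leqnn _)).
have [n1 Hn1] := eventually_small lip_ge0 ler01 gam0.
exists (maxn n0 n1) => n; rewrite geq_max => /andP[n0n n1n].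
have [e1 e2] := Hn1 n n1n.
have aN (a : 'I_N) : (1 <= a.+1 <= N)%N by rewrite /= ltn_ord.
have iota_le y : (thr phi kap n y <= K * 2 ^ n)%N by apply: thr_le.
elim=> [|k IH] a kn /=; first by rewrite grid0 (actor_init T_gt0 cu iown ispike uE uB phiK mu0).
have {}IH b := IH b (ltnW kn).
set y := actor_scheme (thr phi kap n) h (x0n n) (path_occ n) k in IH *.
case: (iso n n0n k kn) => [H|[b0 [s0 [p [b0N Sp p1 p0 other]]]]].
  have noS b s : spikes (thr phi kap n) (y b) (fun s => path_occ n b s k) s = false.
    by apply: (has_cell_empty (K := K)) => //; apply: H.
  have -> : u a.+1 (grid T n k.+1) = u a.+1 (grid T n k).
    apply: (actor_strip_empty T_gt0 cu iown ispike uE uB phiK kn H) => //.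
    by rewrite lexx ltW // grid_lt.
  rewrite /fires !noS /= /input big1 ?mulr0 ?addr0 // => s _.
  by rewrite big1 // => b _; rewrite noS mulr0.
have [b0' b0E] : exists b' : 'I_N, b0 = b'.+1.
  by case: b0 b0N {Sp p1 p0 other} => // b0 /= bN; exists (Ordinal bN).
subst b0.
have spk b s : spikes (thr phi kap n) (y b) (fun s => path_occ n b s k) s =
    ((b, s) == (b0', s0)) && (p.2 <= phi (sgnO s0 * u b0'.+1 (grid T n k))).
  case: eqP => [[-> ->]|ne] /=; last first.
    apply: (has_cell_empty (K := K)) => //; apply: other => // -[e1' e2']; apply: ne.
    by rewrite e2'; congr pair; apply: val_inj.
  rewrite [LHS](has_cell_atom (iota_le _) Sp p1 p0).
  have ll := actor_leftlim T_gt0 cu iown ispike uE uB phiK kn Sp p1 p0 other b0N.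
  apply: (thr_decision phi_ge0 phi_lip lip_ge0 _ _ _ e1 e2).
  - rewrite normr_sgnOM; apply: le_trans Bkap; apply: uB => //.
    by rewrite grid_ge0 // grid_leT // ltnW.
  - by case: Sp => _ /=; rewrite in_itv /= => /andP[].
  - by rewrite sgnO_dist distrC.
  - by rewrite -ll; apply: (gap b0'.+1 s0 p (slab_atom T_gt0 kn b0N Sp p1)).
rewrite (actor_strip_atom T_gt0 cu iown ispike uE uB phiK kn b0N Sp p1 p0 other (aN a)).
set c := p.2 <= _ in spk *.
have fireE : fires (thr phi kap n) (y a) (fun s => path_occ n a s k) = (a == b0') && c.
  rewrite /fires !spk !xpair_eqE.
  by case: s0 {p1 p0 other spk} @c => c; case: (a == b0'); case: c.
rewrite fireE; case: c spk fireE => spk fireE; rewrite ?andbT ?andbF.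
  have -> : (b0'.+1 == a.+1) = (a == b0') by rewrite eqSS eq_sym.
  case: ifP => ab; first by rewrite subrr normr0 shrink_bound.
  rewrite /input card_ord.
  have -> : \sum_(s : bool) \sum_(b < N | b != a) sgnO s *
      (spikes (thr phi kap n) (y b) (fun s => path_occ n b s k) s)%:R = sgnO s0 :> R.
    rewrite (bigD1 s0) //= [X in _ + X]big1 ?addr0; last first.
      move=> s ne; rewrite big1 // => b _; by rewrite spk xpair_eqE (negbTE ne) andbF mulr0.
    rewrite (bigD1 b0') /=; last by rewrite eq_sym ab.
    rewrite spk eqxx mulr1 big1 ?addr0 // => b /andP[_ bb].
    by rewrite spk xpair_eqE (negbTE bb) mulr0.
  by rewrite opprD addrACA subrr addr0.
rewrite /input big1 ?mulr0 ?addr0 // => s _; rewrite big1 // => b _.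
by rewrite spk andbF mulr0.
Qed.

End ActorPathScheme.

(** * The limit process inside a strip *)

Section LimitPath.
Context {R : realType}.
Variables (T : R) (phi : R -> R) (nu : bool -> {measure set (R * R)%type -> \bar R}) (K : nat).
Variables (x0 : R) (u D E : R -> R) (B : R).
Hypothesis T_gt0 : 0 < T.
Hypothesis cu : cadlag u.
Hypothesis iown : forall s t, 0 <= t -> pintegrable (nu s) t (own_jump phi s u).
Hypothesis uE : forall t, 0 <= t ->
  u t = x0 - \sum_(s : bool) pint (nu s) t (own_jump phi s u) + D t.
Hypothesis D0 : D 0 = 0.
Hypothesis DE : forall s t, 0 <= s -> s <= t -> t <= T -> `|D t - D s| <= E t - E s.
Hypothesis uB : forall t, 0 <= t <= T -> `|u t| <= B.
Hypothesis phiK : forall x, `|x| <= B -> phi x < K%:R.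
Hypothesis nu0 : forall s, nu s ([set` `[(0 : R), 0]] `*` [set` `[(0 : R), K%:R[]) = 0%E.

Let own_sup s : supported_below T K (own_jump phi s u).
Proof. exact: (own_jump_supported cu uB phiK). Qed.

Lemma limit_init : u 0 = x0.
Proof.
rewrite uE // D0 addr0 big1 ?subr0 // => s _.
apply: (@pint0 _ _ _ K%:R) => // [|x [/andP[x1 xT] _] Kx]; first exact: iown.
by apply: own_sup => //; rewrite x1 (le_trans xT) // ltW.
Qed.

Definition single_strips n := forall k, (k < 2 ^ n)%N ->
  (forall s, nu s (slab T n k K) = 0%E) \/
  exists s p, [/\ slab T n k K p, nu s [set p] = 1%E,
     nu s (slab T n k K `\ p) = 0%E & nu (~~ s) (slab T n k K) = 0%E].

Section Strip.
Variables (n k : nat).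
Hypothesis kn : (k < 2 ^ n)%N.
Let g := grid T n.

Let g0 : 0 <= g k. Proof. exact: grid_ge0. Qed.
Let gT : g k.+1 <= T. Proof. exact: grid_leT. Qed.

Lemma limit_strip_empty s t : (forall s, nu s (slab T n k K) = 0%E) ->
  g k <= s -> s <= t -> t <= g k.+1 -> u t = u s + (D t - D s).
Proof.
move=> H ks st tk; have s0 := le_trans g0 ks; have t0 := le_trans s0 st.
have E1 sg : pint (nu sg) t (own_jump phi sg u) = pint (nu sg) s (own_jump phi sg u).
  by apply: (pint_strip_empty T_gt0 kn (@own_sup sg)) => //; exact: iown.
by rewrite (uE s0) (uE t0); under eq_bigr do rewrite E1; ring.
Qed.

Variables (s0 : bool) (p : R * R).
Hypothesis Sp : slab T n k K p.
Hypothesis p1 : nu s0 [set p] = 1%E.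
Hypothesis p0 : nu s0 (slab T n k K `\ p) = 0%E.
Hypothesis other : nu (~~ s0) (slab T n k K) = 0%E.

Let kp : g k < p.1 <= g k.+1.
Proof. by case: Sp => /=; rewrite in_itv. Qed.

Let cross t : g k <= t <= g k.+1 ->
  u t = u (g k) + (D t - D (g k)) - (if p.1 <= t then own_jump phi s0 u p else 0).
Proof.
move=> /andP[kt tk]; have t0 := le_trans g0 kt.
have E1 : pint (nu s0) t (own_jump phi s0 u) = pint (nu s0) (g k) (own_jump phi s0 u)
    + (if p.1 <= t then own_jump phi s0 u p else 0).
  rewrite (pint_strip_atom T_gt0 kn (@own_sup s0) (lexx _) kt tk (iown s0 t0) Sp p1 p0).
  by case/andP: kp => -> _.
have E2 : pint (nu (~~ s0)) t (own_jump phi (~~ s0) u) = pint (nu (~~ s0)) (g k) (own_jump phi (~~ s0) u).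
  by apply: (pint_strip_empty T_gt0 kn (@own_sup _)) => //; exact: iown.
rewrite (uE g0) (uE t0) !sum_bool; move: E1 E2.
by case: (s0) => /= -> ->; ring.
Qed.

Lemma limit_strip_before t : g k <= t < p.1 -> u t = u (g k) + (D t - D (g k)).
Proof.
move=> /andP[kt tp]; rewrite cross; last by rewrite kt (le_trans (ltW tp)) //; case/andP: kp.
by rewrite leNgt tp subr0.
Qed.

(** For an accepted atom this difference is, up to sign, the value of the path at [t]: after the
    reset only the drift since the atom remains. *)
Lemma limit_leftlim t : p.1 <= t <= g k.+1 ->
  `|leftlim u p.1 - (u (g k) + (D t - D (g k)))| <= E t - E (g k).
Proof.
move=> /andP[pt tk]; have /andP[kp' _] := kp.
have tT := le_trans tk gT.
apply: (leftlim_le cu g0 kp') => r /andP[kr rp].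
rewrite limit_strip_before ?kr // opprD addrACA subrr add0r opprB addrA subrK.
have r0 := le_trans g0 kr; have rt := le_trans (ltW rp) pt.
rewrite distrC; apply: le_trans (DE r0 rt tT) _; rewrite lerD2l lerN2.
have := DE g0 kr (le_trans rt tT); have := normr_ge0 (D r - D (g k)); lra.
Qed.

Lemma limit_leftlim_start : `|leftlim u p.1 - u (g k)| <= E (g k.+1) - E (g k).
Proof.
have /andP[kp' pk] := kp.
apply: (leftlim_le cu g0 kp') => r /andP[kr rp].
rewrite limit_strip_before ?kr // addrAC subrr add0r.
have r0 := le_trans g0 kr; have rk := le_trans (ltW rp) pk.
apply: le_trans (DE g0 kr (le_trans rk gT)) _; rewrite lerD2r.
have := DE r0 rk gT; have := normr_ge0 (D (g k.+1) - D r); lra.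
Qed.

Lemma limit_strip_after t : p.1 <= t <= g k.+1 ->
  (p.2 <= phi (sgnO s0 * leftlim u p.1) -> `|u t| <= E t - E (g k)) /\
  (~~ (p.2 <= phi (sgnO s0 * leftlim u p.1)) -> u t = u (g k) + (D t - D (g k))).
Proof.
move=> pt; have /andP[pt' tk] := pt; have /andP[kp' _] := kp.
have kt : g k <= t <= g k.+1 by rewrite (le_trans (ltW kp')).
rewrite (cross kt) pt' /own_jump; split=> [->|/negbTE ->]; last by rewrite mulr0 subr0.
by rewrite mulr1 distrC; apply: limit_leftlim.
Qed.

End Strip.

(** Resets never increase the potential beyond the drift of their strip, so the initial value plus
    the variation of the drift dominates. The bound [B] of the section is an arbitrary one for the
    path; here it is traded for one given by the initial value and [E]. *)
Lemma limit_bound n : single_strips n -> forall t, 0 <= t <= T -> `|u t| <= `|x0| + (E t - E 0).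
Proof.
move=> sing.
have EE s t : 0 <= s -> s <= t -> t <= T -> E s <= E t.
  move=> s0 st tT; have := DE s0 st tT; have := normr_ge0 (D t - D s); lra.
have inc x y z (st : 0 <= y) : y <= z -> z <= T -> `|x| <= `|x0| + (E y - E 0) ->
    `|x + (D z - D y)| <= `|x0| + (E z - E 0).
  move=> yz zT xb; have := ler_normD x (D z - D y); have := DE st yz zT; lra.
have key k : (k <= 2 ^ n)%N -> forall t, 0 <= t <= grid T n k -> `|u t| <= `|x0| + (E t - E 0).
  elim: k => [|k IH] kn t.
    rewrite grid0 => /andP[t0 t1]; have -> : t = 0 by apply/eqP; rewrite eq_le t1.
    by rewrite limit_init subrr addr0.
  move=> /andP[t0 tk]; case: (leP t (grid T n k)) => tk'.
    by apply: IH; [exact: ltnW|rewrite t0].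
  have gk0 := @grid_ge0 _ _ T_gt0 n k.
  have tT : t <= T := le_trans tk (grid_leT T_gt0 kn).
  have uk : `|u (grid T n k)| <= `|x0| + (E (grid T n k) - E 0).
    by apply: IH; [exact: ltnW|rewrite lexx gk0].
  case: (sing k kn) => [H|[s [p [Sp p1 p0 other]]]].
    by rewrite (limit_strip_empty kn H (lexx _) (ltW tk') tk); apply: inc (ltW tk') tT uk.
  case: (ltP t p.1) => tp.
    rewrite (limit_strip_before kn Sp p1 p0 other); last by rewrite (ltW tk').
    exact: inc (ltW tk') tT uk.
  have [f1 f2] := limit_strip_after kn Sp p1 p0 other (t := t) (introT andP (conj tp tk)).
  case: (boolP (p.2 <= phi (sgnO s * leftlim u p.1))) => fire; last first.
    by rewrite (f2 fire); apply: inc (ltW tk') tT uk.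
  apply: le_trans (f1 fire) _; have := EE _ _ (lexx 0) gk0 (le_trans (ltW tk') tT).
  have := normr_ge0 x0; lra.
by move=> t tT; apply: (key (2 ^ n)%N) => //; rewrite gridT.
Qed.

Variables (kap lip c : R).
Hypothesis phi_ge0 : forall x, 0 <= phi x.
Hypothesis lip_ge0 : 0 <= lip.
Hypothesis phi_lip : forall x y, `|phi (clip kap x) - phi (clip kap y)| <= lip * `|x - y|.
Hypothesis Bkap : B <= kap.
Hypothesis phi_K : forall x, phi (clip kap x) + 2 <= K%:R.
Hypothesis c_ge0 : 0 <= c.
Hypothesis E_lip : forall s t, 0 <= s -> s <= t -> t <= T -> E t - E s <= c * (t - s).

Definition limit_occ n s k j := nu s (cell T n k j) != 0%E.

(** Again errors do not accumulate: without firing both sides receive the same drift, and at a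
    common reset the scheme is 0 while the path carries at most the drift of one strip,
    [c * T / 2^n]. *)
Lemma limit_path_scheme (x0n : nat -> R) :
  (exists n0, forall n, (n0 <= n)%N -> single_strips n) ->
  (forall n, `|x0n n - x0| <= 1 / 2 ^+ n) ->
  exists n1, forall n, (n1 <= n)%N -> forall k, (k <= 2 ^ n)%N ->
    `|limit_scheme (thr phi kap n) (fun k => D (grid T n k.+1) - D (grid T n k)) (x0n n)
        (limit_occ n) k - u (grid T n k)| <= (1 + c * T) / 2 ^+ n.
Proof.
move=> [n0 sing] x0P.
(* The pair of measures is viewed as a system with one actor, to which [atom_gap] applies. *)
have iso : simple_strips T (fun _ => nu) 1 n0 K.
  move=> k kn; case: (sing n0 (leqnn _) k kn) => [H|[s [p [Sp p1 p0 other]]]]; first by left.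
  right; exists 1%N, s, p; split => // a' s' aN ne.
  have a1 : a' = 1%N by apply/eqP; rewrite eqn_leq andbC.
  suff -> : s' = ~~ s by [].
  by case: s' s ne {Sp p1 p0 other} => -[] // ne; exfalso; apply: ne; rewrite a1.
have [gam gam0 gap] := atom_gap T_gt0 (fun _ s p => phi (sgnO s * leftlim u p.1)) iso.
have cT0 : 0 <= c * T by rewrite mulr_ge0 // ltW.
(* Error at the moment of decision: [1 + c T] for the scheme at the start of the strip, and another
   [c T] for the drift from there to the atom. *)
have C0 : 0 <= 1 + 2 * (c * T) by lra.
have [n1 Hn1] := eventually_small lip_ge0 C0 gam0.
exists (maxn n0 n1) => n; rewrite geq_max => /andP[n0n n1n].
have [e1 e2] := Hn1 n n1n.
have iota_le y : (thr phi kap n y <= K * 2 ^ n)%N by apply: thr_le.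
have q0 : 0 < (2 ^+ n)^-1 :> R by rewrite invr_gt0 two_gt0.
elim=> [|k IH] kn /=.
  rewrite grid0 limit_init; apply: le_trans (x0P n) _.
  by rewrite ler_pM2r //; lra.
have {}IH := IH (ltnW kn).
set y := limit_scheme _ _ _ _ _ in IH *.
have Ek : E (grid T n k.+1) - E (grid T n k) <= c * T / 2 ^+ n.
  apply: le_trans (E_lip (grid_ge0 T_gt0 _ _) (ltW (grid_lt T_gt0 _ _)) (grid_leT T_gt0 kn)) _.
  by rewrite gridS addrC addKr mulrA.
have nofire : fires (thr phi kap n) y (fun s => limit_occ n s k) = false ->
    u (grid T n k.+1) = u (grid T n k) + (D (grid T n k.+1) - D (grid T n k)) ->
    `|(if fires (thr phi kap n) y (fun s => limit_occ n s k) then 0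
       else y + (D (grid T n k.+1) - D (grid T n k))) - u (grid T n k.+1)| <= (1 + c * T) / 2 ^+ n.
  by move=> -> ->; rewrite opprD addrACA subrr addr0.
case: (sing n n0n k kn) => [H|[s0 [p [Sp p1 p0 other]]]].
  have noS s : spikes (thr phi kap n) y (fun s => limit_occ n s k) s = false.
    by apply: (has_cell_empty (K := K)) => //; apply: H.
  apply: nofire; first by rewrite /fires !noS.
  by apply: (limit_strip_empty kn H) => //; rewrite ltW // grid_lt.
have ll := limit_leftlim_start kn Sp p1 p0 other.
have spk s : spikes (thr phi kap n) y (fun s => limit_occ n s k) s =
    (s == s0) && (p.2 <= phi (sgnO s0 * leftlim u p.1)).
  case: eqP => [->|ne] /=; last first.
    apply: (has_cell_empty (K := K)) => //.
    by have -> : s = ~~ s0 by case: s s0 ne {Sp p1 p0 other ll} => -[].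
  rewrite [LHS](has_cell_atom (iota_le _) Sp p1 p0).
  apply: (thr_decision phi_ge0 phi_lip lip_ge0 _ _ _ e1 e2).
  - rewrite normr_sgnOM; apply: le_trans Bkap; apply: (leftlim_bounded cu _ uB).
    case: Sp => /=; rewrite in_itv /= => /andP[h1 h2] _.
    by rewrite (le_trans (grid_ge0 T_gt0 _ _) (ltW h1)) (le_trans h2 (grid_leT T_gt0 kn)).
  - by case: Sp => _ /=; rewrite in_itv /= => /andP[].
  - rewrite sgnO_dist (_ : leftlim u p.1 - y = (leftlim u p.1 - u (grid T n k)) - (y - u (grid T n k))); last by ring.
    apply: le_trans (ler_normB _ _) _.
    have -> : (1 + 2 * (c * T)) / 2 ^+ n = c * T / 2 ^+ n + (1 + c * T) / 2 ^+ n by ring.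
    by apply: lerD => //; apply: le_trans ll Ek.
  - by apply: (gap 1%N s0 p (slab_atom T_gt0 kn _ Sp p1)).
have fireE : fires (thr phi kap n) y (fun s => limit_occ n s k) =
    (p.2 <= phi (sgnO s0 * leftlim u p.1)).
  by rewrite /fires !spk; case: (s0); case: (_ <= _).
have pk : p.1 <= grid T n k.+1 <= grid T n k.+1.
  by rewrite lexx andbT; case: Sp => /=; rewrite in_itv /= => /andP[].
have [f1 f2] := limit_strip_after kn Sp p1 p0 other pk.
case: (boolP (p.2 <= phi (sgnO s0 * leftlim u p.1))) => fire.
  rewrite fireE fire sub0r normrN; apply: le_trans (f1 fire) (le_trans Ek _).
  by rewrite ler_pM2r //; lra.
by apply: nofire; [rewrite fireE (negbTE fire)|exact: f2].
Qed.

End LimitPath.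

Lemma simple_single_strips (R : realType) (T : R) mu N n K a : (1 <= a <= N)%N ->
  simple_strips T mu N n K -> single_strips T (mu a) K n.
Proof.
move=> aN H k kn; case: (H k kn) => [z|[b [s [p [bN Sp p1 p0 other]]]]].
  by left => s; apply: z.
have [ab|ab] := eqVneq a b.
  subst b; right; exists s, p; split => //; apply: other => // -[].
  by case: s {p1 p0}.
by left=> s'; apply: other => // -[ab']; rewrite ab' eqxx in ab.
Qed.

(** * The limit solution and the self-consistent scheme *)

Section ClippedRate.
Context {R : realType}.
Variable phi : R -> R.
Hypothesis phi_ge0 : forall x, 0 <= phi x.
Hypothesis phi_ll : locally_lipschitz phi.

Lemma clipped_constants K : 0 <= K -> exists lip S : R, [/\ 0 <= lip, 0 <= S,
  forall x y, `|phi (clip K x) - phi (clip K y)| <= lip * `|x - y| &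
  forall x, phi (clip K x) <= S].
Proof.
move=> K0; have [l Hl] := phi_ll K; exists `|l|, (phi 0 + `|l| * K).
have H x y : `|phi (clip K x) - phi (clip K y)| <= `|l| * `|clip K x - clip K y|.
  by apply: le_trans (Hl _ _ (clip_norm _ K0) (clip_norm _ K0)) _; rewrite ler_wpM2r // ler_norm.
split => //; first by rewrite addr_ge0 // mulr_ge0.
  by move=> x y; apply: le_trans (H x y) _; rewrite ler_wpM2l // clip_lip.
move=> x; have c0 : clip K 0 = 0 by apply: clip_id; rewrite normr0.
have := H x 0; rewrite c0 subr0 => h1.
have : `|l| * `|clip K x| <= `|l| * K by rewrite ler_wpM2l // clip_norm.
have := ler_norm (phi (clip K x) - phi 0); lra.
Qed.

Lemma thr_clip_eq K K' n x : `|x| <= K -> `|x| <= K' -> thr phi K n x = thr phi K' n x.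
Proof. by move=> h1 h2; rewrite /thr !clip_id. Qed.

Section LevelEstimates.
Variables (K lip S T : R) (n : nat).
Hypothesis T_gt0 : 0 < T.
Hypothesis lip_ge0 : 0 <= lip.
Hypothesis S_ge0 : 0 <= S.
Hypothesis phi_lip : forall x y, `|phi (clip K x) - phi (clip K y)| <= lip * `|x - y|.
Hypothesis phi_S : forall x, phi (clip K x) <= S.
Let dl := T / 2 ^+ n.
Let w := dl / 2 ^+ n.
Let rate := cell_rate T n.

Let dl_gt0 : 0 < dl. Proof. by rewrite divr_gt0 // two_gt0. Qed.
Let w_gt0 : 0 < w. Proof. by rewrite divr_gt0 // two_gt0. Qed.
Let p_gt0 : 0 < 2 ^+ n :> R. Proof. exact: two_gt0. Qed.

Lemma cell_rate_le : rate <= w.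
Proof. rewrite /rate /cell_rate; have := expR_ge1Dx (- w); rewrite /w /dl; lra. Qed.

Let wthr x : w * (thr phi K n x)%:R <= dl * (phi (clip K x) + n.+1%:R^-1 + (2 ^+ n)^-1)
  /\ dl * (phi (clip K x) + n.+1%:R^-1) <= w * (thr phi K n x)%:R.
Proof.
have r0 : 0 <= 2 ^+ n * (phi (clip K x) + n.+1%:R^-1).
  by rewrite mulr_ge0 ?(ltW p_gt0) // addr_ge0 // invr_ge0.
have /andP[h1 h2] := truncn_itv r0.
have wp : w * 2 ^+ n = dl by rewrite /w divfK ?gt_eqF.
have -> : dl * (phi (clip K x) + n.+1%:R^-1 + (2 ^+ n)^-1) =
   w * (2 ^+ n * (phi (clip K x) + n.+1%:R^-1) + 1).
  by rewrite [LHS]mulrDr [RHS]mulrDr mulr1 [in RHS]mulrA wp.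
have -> : dl * (phi (clip K x) + n.+1%:R^-1) = w * (2 ^+ n * (phi (clip K x) + n.+1%:R^-1)).
  by rewrite [RHS]mulrA wp.
rewrite /thr; split; rewrite ler_pM2l //; last exact: ltW.
by rewrite -natr1 lerD2r.
Qed.

Lemma rate_thr_le x (s : R) : phi (clip K x) <= s -> rate * (thr phi K n x)%:R <= dl * (s + 2).
Proof.
move=> xs; apply: le_trans (_ : _ <= w * (thr phi K n x)%:R) _.
  by rewrite ler_wpM2r // cell_rate_le.
have [+ _] := wthr x => /le_trans; apply; rewrite ler_pM2l //.
have i1 : n.+1%:R^-1 <= 1 :> R by rewrite invf_le1 ?ltr0n // ler1n.
have i2 : (2 ^+ n)^-1 <= 1 :> R by rewrite invf_le1 // exprn_ege1 // ler1n.
move: i1 i2; set j := n.+1%:R^-1; set q := (2 ^+ n)^-1; lra.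
Qed.

(** Up to one cell, the thresholded cells have area [dl] times rate plus margin; the margins cancel
    in the difference and the rounding costs one cell area [w]. Over 2^n strips these sum to
    [T / 2^n]. *)
Lemma thr_lip_le x y : rate * `|(thr phi K n x)%:R - (thr phi K n y)%:R| <=
  dl * lip * `|x - y| + w.
Proof.
apply: le_trans (_ : _ <= w * `|(thr phi K n x)%:R - (thr phi K n y)%:R|) _.
  by rewrite ler_wpM2r // cell_rate_le.
have [x1 x2] := wthr x; have [y1 y2] := wthr y.
have dw : dl * (2 ^+ n)^-1 = w by [].
have := phi_lip x y; rewrite ler_norml => /andP[l1 l2].
have l1' : dl * - (lip * `|x - y|) <= dl * (phi (clip K x) - phi (clip K y)) by rewrite ler_pM2l.
have l2' : dl * (phi (clip K x) - phi (clip K y)) <= dl * (lip * `|x - y|) by rewrite ler_pM2l.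
rewrite -[w in w * _](gtr0_norm w_gt0) -normrM mulrBr ler_norml -mulrA.
move: x1 x2 y1 y2 l1' l2'; rewrite !mulrDr dw mulrN; set j := dl * n.+1%:R^-1.
set z := dl * (lip * _); set tx := w * _; set ty := w * _.
by rewrite mulrN => *; apply/andP; split; lra.
Qed.

(** Cell probabilities are exponential in the area, so the firing probability is [1 - exp(-v)] with
    [v] the total area of the cells. It lies between [v - v^2] and [v], and [v] is [dl * phi] up to
    margin and rounding. *)
Lemma fire_prob_approx x : `|fire_prob rate (thr phi K n) x - dl * phi (clip K x)| <=
  dl * (n.+1%:R^-1 + (2 ^+ n)^-1 + dl * (S + 2) ^+ 2).
Proof.
set v := w * (thr phi K n x)%:R.
have fE : fire_prob rate (thr phi K n) x = 1 - expR (- v).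
  by rewrite /fire_prob /rate /cell_rate subKr -expRM_natl mulrN mulrC.
have v0 : 0 <= v by rewrite mulr_ge0 // ltW.
have e1 := expR_ge1Dx (- v).
have e2 : expR (- v) <= 1 - v + v ^+ 2.
  rewrite expRN -[leLHS]mul1r ler_pdivrMr ?expR_gt0 //.
  have := expR_ge1Dx v => ev.
  have q0 : 0 <= 1 - v + v ^+ 2.
    by have := sqr_ge0 (v - 2^-1); rewrite !expr2; lra.
  apply: le_trans (ler_wpM2l q0 ev).
  have : 0 <= v * (v * v) by exact: (mulr_ge0 v0 (mulr_ge0 v0 v0)).
  rewrite expr2; lra.
have [x1 x2] := wthr x; rewrite -/v in x1 x2.
have vS : v <= dl * (S + 2).
  apply: le_trans x1 _; rewrite ler_pM2l //.
  have i1 : n.+1%:R^-1 <= 1 :> R by rewrite invf_le1 ?ltr0n // ler1n.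
  have i2 : (2 ^+ n)^-1 <= 1 :> R by rewrite invf_le1 // exprn_ege1 // ler1n.
  have := phi_S x; move: i1 i2; set j := n.+1%:R^-1; set q := (2 ^+ n)^-1; lra.
have v2 : v ^+ 2 <= dl * (dl * (S + 2) ^+ 2).
  have -> : dl * (dl * (S + 2) ^+ 2) = (dl * (S + 2)) ^+ 2 by rewrite exprMn mulrA expr2.
  by rewrite ler_sqr ?nnegrE // (le_trans v0).
have i0 : 0 <= dl * n.+1%:R^-1 by rewrite mulr_ge0 ?invr_ge0 // ltW.
have q0 : 0 <= dl * (2 ^+ n)^-1 by rewrite mulr_ge0 ?invr_ge0 // ltW.
rewrite fE ler_norml; move: x1 x2 v2 e1 e2 i0 q0; rewrite !mulrDr.
set j := dl * n.+1%:R^-1; set q := dl * (2 ^+ n)^-1; set z := dl * (dl * _).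
by move=> *; apply/andP; split; lra.
Qed.

Lemma thr_small_le x (s : R) : phi (clip K x) <= s ->
  (thr phi K n x <= (Num.truncn (2 ^+ n * (s + 1))).+1)%N.
Proof.
move=> xs; rewrite /thr ltnS; apply: le_truncn; rewrite ler_pM2l // lerD //.
by rewrite invf_le1 ?ltr0n // ler1n.
Qed.

Lemma small_rate_le (s : R) : 0 <= s ->
  (2 ^ n)%:R * (2 * ((Num.truncn (2 ^+ n * (s + 1))).+1%:R * rate)) <= 2 * T * (s + 2).
Proof.
move=> s0; have r0 : 0 <= 2 ^+ n * (s + 1) by rewrite mulr_ge0 ?(ltW p_gt0) // addr_ge0.
have /andP[h1 _] := truncn_itv r0.
set c := Num.truncn _ in h1 *.
have h2 : c.+1%:R * rate <= c.+1%:R * w by rewrite ler_wpM2l // cell_rate_le.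
have h3 : c.+1%:R * w <= (2 ^+ n * (s + 1) + 1) * w.
  by rewrite ler_wpM2r ?(ltW w_gt0) // -natr1 lerD2r.
have h4 : (2 ^+ n * (s + 1) + 1) * w <= (2 ^+ n * (s + 2)) * w.
  rewrite ler_wpM2r ?(ltW w_gt0) // -subr_ge0.
  have -> : 2 ^+ n * (s + 2) - (2 ^+ n * (s + 1) + 1) = 2 ^+ n - 1 :> R by ring.
  by rewrite subr_ge0 exprn_ege1 // ler1n.
rewrite natrX; apply: le_trans (_ : _ <= 2 ^+ n * (2 * (2 ^+ n * (s + 2) * w))) _.
  rewrite ler_pM2l // ler_pM2l //; lra.
rewrite le_eqVlt; apply/orP; left; apply/eqP; rewrite /w /dl; field.
by rewrite gt_eqF.
Qed.

End LevelEstimates.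
End ClippedRate.

Lemma pow_le_expR (R : realType) (c : R) n : 0 <= c -> (1 + c / 2 ^+ n) ^+ (2 ^ n) <= expR c.
Proof.
move=> c0; have q0 : 0 <= c / 2 ^+ n by rewrite shrink_bound.
apply: (@le_trans _ _ (expR (c / 2 ^+ n) ^+ (2 ^ n))).
  by rewrite lerXn2r ?nnegrE ?addr_ge0 ?expR_ge0 // expR_ge1Dx.
by rewrite -expRM_natl natrX mulrC divfK // gt_eqF // two_gt0.
Qed.

Lemma eq_mean_field (R : realType) (A : finType) (m J q : nat) p0 (rate : R) (thr thr' : R -> nat)
   (x0 : 'I_q.+2 -> R) (h B : R) :
  (forall k c (a : A), (k < m)%N -> `|mean_field (m := m) (J := J) p0 rate thr x0 h k c a| <= B) ->
  (forall x, `|x| <= B -> thr x = thr' x) ->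
  forall k c (a : A), (k <= m)%N ->
    mean_field (m := m) (J := J) p0 rate thr x0 h k c a = mean_field p0 rate thr' x0 h k c a.
Proof.
move=> HB ht; elim=> [//|k IH] c a km /=.
have ht' c' s : thr (sgnO s * mean_field (m := m) (J := J) p0 rate thr x0 h k c' a) =
   thr' (sgnO s * mean_field (m := m) (J := J) p0 rate thr x0 h k c' a).
  by apply: ht; rewrite normr_sgnOM HB.
rewrite -IH ?(ltnW km) // (eq_fires (thr' := thr') (oc' := fun s => occ c a s k)) //.
case: ifP => // _; congr (_ + _ * _); apply: eq_bigr => s _; congr (_ * _).
by apply: eq_Ex => c'; rewrite -IH ?(ltnW km) // /fire_prob ht'.
Qed.

Section LebesgueIncrement.
Context {R : realType}.
Variables (f : R -> R).
Hypothesis fi : forall t, 0 <= t -> (@lebesgue_measure R).-integrable (Icc0 t) (fun s => (f s)%:E).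

Definition prim t : R := fine (\int[@lebesgue_measure R]_(s in Icc0 t) (f s)%:E)%E.

Lemma prim_incr s t : 0 <= s -> s <= t ->
  (forall m, (forall x, s <= x <= t -> m <= f x) -> m * (t - s) <= prim t - prim s) /\
  (forall M, (forall x, s <= x <= t -> f x <= M) -> prim t - prim s <= M * (t - s)).
Proof.
move=> s0 st; have t0 := le_trans s0 st.
have mI : measurable (`]s, t] : set R) by exact: measurable_itv.
have ms : measurable (Icc0 s : set R) by exact: measurable_itv.
have mt : measurable (Icc0 t : set R) by exact: measurable_itv.
have U : Icc0 t = Icc0 s `|` `]s, t].
  apply/seteqP; split => x; rewrite /Icc0 /= !in_itv /=.
    move=> /andP[x0 xt]; case: (leP x s) => xs; [left; by rewrite x0|right; by rewrite xt].
  by move=> [/andP[-> xs]|/andP[sx ->]]; [rewrite (le_trans xs st)|rewrite (le_trans s0 (ltW sx))].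
have sub1 : Icc0 s `<=` Icc0 t by rewrite U; apply: subsetUl.
have sub2 : `]s, t] `<=` Icc0 t by rewrite U; apply: subsetUr.
have i1 : (@lebesgue_measure R).-integrable (Icc0 s) (fun s => (f s)%:E) by exact: fi.
have i2 : (@lebesgue_measure R).-integrable `]s, t] (fun s => (f s)%:E).
  by apply: integrableS (fi t0).
have E : prim t - prim s = fine (\int[@lebesgue_measure R]_(x in `]s, t]) (f x)%:E)%E.
  rewrite /prim U integral_setU //.
  - by rewrite fineD ?integrable_fin_num // [X in X - _]addrC addrK.
  - by rewrite -U; exact: measurable_int (fi t0).
  - apply/disj_setPS => x; rewrite /Icc0 /= !in_itv /= => -[/andP[_ xs] /andP[sx _]].
    by move: (lt_le_trans sx xs); rewrite ltxx.
have L : lebesgue_measure (`]s, t] : set R) = (t - s)%:E.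
  rewrite lebesgue_measure_itv /= lte_fin; case: ltP => [_|ts]; first by rewrite EFinB.
  by rewrite (_ : t = s) ?subrr //; apply/eqP; rewrite eq_le st ts.
have finL : (lebesgue_measure (`]s, t] : set R) < +oo)%E by rewrite L ltry.
have ic c : (@lebesgue_measure R).-integrable `]s, t] (fun=> c%:E).
  by apply/integrableP; split => //; rewrite integral_cst //= L -EFinM ltry.
rewrite E; split=> m Hf; rewrite -lee_fin fineK ?integrable_fin_num // EFinM -L -integral_cst //;
  (apply: le_integral => //; try exact: ic); move=> x; rewrite inE /= in_itv /= lee_fin => /andP[sx xt];
  by apply: Hf; rewrite (ltW sx).
Qed.

Lemma prim0 : prim 0 = 0.
Proof.
by rewrite /prim /Icc0 set_itv1 integral_set1.
Qed.

End LebesgueIncrement.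

Lemma Expectation_dist (d : measure_display) (Omega : measurableType d) (R : realType)
    (P : probability Omega R) (f g : Omega -> R) (b : R) :
  P.-integrable setT (fun w => (f w)%:E) -> P.-integrable setT (fun w => (g w)%:E) ->
  (\int[P]_w (`|f w - g w|)%:E <= b%:E)%E ->
  `|fine (\int[P]_w (f w)%:E)%E - fine (\int[P]_w (g w)%:E)%E| <= b.
Proof.
move=> fi gi H; rewrite -fineB ?integrable_fin_num //.
rewrite -integralB_EFin //; rewrite -lee_fin; apply: le_trans H.
have fgi := integrableB measurableT fi gi.
rewrite -fine_abse; last exact: integrable_fin_num.
rewrite fineK; last by rewrite abse_fin_num; exact: integrable_fin_num.
apply: le_trans (le_abse_integral _ _ _) _ => //.
exact: measurable_int fgi.
Qed.

Lemma measurable_finite_valued (d : measure_display) (Omega : measurableType d) (R : realType)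
    (V : finType) (X : Omega -> V) (F : V -> R) :
  (forall v, measurable [set w | X w = v]) -> measurable_fun setT (fun w => F (X w)).
Proof.
move=> mX _ B mB; rewrite setTI.
rewrite (_ : _ @^-1` B = \bigcup_(v in [set v | B (F v)]) [set w | X w = v]).
  by apply: fin_bigcup_measurable => // v _; apply: mX.
by apply/seteqP; split => [w Bw|w [v Bv Xv]]; [exists (X w)|rewrite /preimage /= (Xv : X w = v)].
Qed.

Lemma measurable_runmax (d : measure_display) (Omega : measurableType d) (R : realType)
    (M : nat -> Omega -> R) n :
  (forall k, (k <= n)%N -> measurable_fun setT (M k)) ->
  measurable_fun setT (fun w => runmax (fun k => M k w) n).
Proof.
elim: n => [|n IH] mM /=; first exact: mM.
by apply: measurable_maxr; [apply: IH => k kn; apply: mM; apply: leqW|apply: mM].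
Qed.

Lemma bounded_integrable (d : measure_display) (Omega : measurableType d) (R : realType)
    (P : probability Omega R) (f : Omega -> R) (M : R) :
  measurable_fun setT f -> (forall w, `|f w| <= M) -> P.-integrable setT (fun w => (f w)%:E).
Proof.
move=> mf fM; apply: le_integrable (finite_measure_integrable_cst P M measurableT) => //.
  exact/measurable_EFinP.
by move=> w _; rewrite /= lee_fin (le_trans (fM w)) // ler_norm.
Qed.

Lemma runmax_ge0 (R : realType) (M : nat -> R) n : (forall k, 0 <= M k) -> 0 <= runmax M n.
Proof. by move=> M0; apply: le_trans (M0 0%N) (runmax_ge _ _). Qed.

Lemma sum_le_prefix (R : realType) (F : nat -> R) l k : (l <= k)%N -> (forall i, 0 <= F i) ->
  \sum_(i < l) F i <= \sum_(i < k) F i.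
Proof.
move=> lk F0; rewrite -(big_mkord xpredT F) -(big_mkord xpredT F).
by rewrite [leRHS](big_cat_nat (n := l)) //= lerDl sumr_ge0.
Qed.

Section GridConfiguration.
Context {R : realType} {d : measure_display} {Omega : measurableType d}.
Variables (PN : nat -> bool -> rmeasure (R := R) (Omega := Omega)) (U0 : nat -> nat -> Omega -> R).
Variables (T L : R) (N : nat).
Hypothesis L_gt0 : 0 < L.

Definition init_size n : nat := Num.truncn (2 * L * 2 ^+ n).

(** The cap at [L] puts every code in the interval of radius [L], including those beyond the range
    of the rounding, as the bound on initial values is required for all codes. *)
Definition init_val n (v : 'I_(init_size n).+2) : R := Num.min L (v%:R / 2 ^+ n - L).

Definition gconf n K (w : Omega) := conf PN U0 T L N n (K * 2 ^ n) (init_size n) w.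

Definition init_approx n (x : R) : R := Num.min L ((Num.truncn ((x + L) * 2 ^+ n))%:R / 2 ^+ n - L).

Lemma init_val_norm n v : `|@init_val n v| <= L.
Proof.
rewrite ler_norml /init_val ge_min lexx /= andbT le_min; apply/andP; split; first by have := L_gt0; lra.
have : 0 <= v%:R / 2 ^+ n :> R by rewrite divr_ge0 // ltW // two_gt0.
lra.
Qed.

Lemma init_approx_dist n x : `|x| <= L -> `|init_approx n x - x| <= 1 / 2 ^+ n.
Proof.
rewrite ler_norml => /andP[x1 x2]; have p0 := @two_gt0 R n.
have xL : 0 <= x + L by lra.
have := truncn_itv (mulr_ge0 xL (ltW p0)).
rewrite /init_approx; set c := Num.truncn _.
rewrite -ler_pdivrMr // -ltr_pdivlMr // -(natr1 c) mulrDl => /andP[h1 h2].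
rewrite minEle; case: ifP => h; last by rewrite ler_norml; apply/andP; split; lra.
by rewrite ler_norml; apply/andP; split; lra.
Qed.

Lemma init_gconf n K w (a : 'I_N) : `|U0 N a.+1 w| <= L ->
  init (@init_val n) (gconf n K w) a = init_approx n (U0 N a.+1 w).
Proof.
rewrite ler_norml => /andP[x1 x2]; have p0 := @two_gt0 R n.
rewrite /init /gconf ffunE /conf_at /= /init_val /init_approx; congr (Num.min L (_%:R / _ - L)).
rewrite /init_code inordK // ltnS; apply: leqW; rewrite /init_size.
by apply: le_truncn; rewrite ler_pM2r //; lra.
Qed.

Lemma occ_gconf n K w (a : 'I_N) s k j : (k < 2 ^ n)%N -> (j < K * 2 ^ n)%N ->
  occ (gconf n K w) a s k j = (PN a.+1 s w (cell T n k j) != 0%E).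
Proof.
move=> kn jK; rewrite -[k]/(val (Ordinal kn)) -[j]/(val (Ordinal jK)) occE ffunE /conf_at /= /occ_code.
case: ifP => // z0; apply/eqP => /(congr1 val); rewrite /= inordK //.
Qed.

Lemma limit_scheme_gconf (tr : R -> nat) D x0 n K w (a : 'I_N) k :
  (forall x, (tr x <= K * 2 ^ n)%N) -> (k <= 2 ^ n)%N ->
  limit_scheme tr D x0 (occ (gconf n K w) a) k =
  limit_scheme tr D x0 (fun s k j => PN a.+1 s w (cell T n k j) != 0%E) k.
Proof.
move=> trK; elim: k => //= k IH kn; rewrite -IH ?(ltnW kn) //.
rewrite (eq_fires (thr' := tr) (oc' := fun s j => PN a.+1 s w (cell T n k j) != 0%E)) //.
by move=> s j jt; rewrite occ_gconf //; apply: leq_trans jt (trK _).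
Qed.

End GridConfiguration.

Section LimitSolution.
Context {R : realType} {d : measure_display} {Omega : measurableType d}.
Variables (P : probability Omega R) (PN : nat -> bool -> rmeasure (R := R) (Omega := Omega)).
Variables (U0 : nat -> nat -> Omega -> R).
Hypothesis PNP : forall a o, (1 <= a)%N -> poisson_random_measure P (PN a o).
Hypothesis indep : indep_inputs P PN U0.
Hypothesis mU0 : forall N a, (2 <= N)%N -> (1 <= a <= N)%N -> measurable_fun setT (U0 N a).
Hypothesis idU0 : forall N a N' a', (2 <= N)%N -> (1 <= a <= N)%N ->
         (2 <= N')%N -> (1 <= a' <= N')%N ->
         forall B : set R, measurable B ->
           P (U0 N a @^-1` B) = P (U0 N' a' @^-1` B).
Variables (phi : R -> R) (L T h : R) (N : nat) (a : 'I_N) (U : R -> Omega -> R).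
Hypothesis phi_ge0 : forall x, 0 <= phi x.
Hypothesis phi_ll : locally_lipschitz phi.
Hypothesis h_gt0 : 0 < h.
Hypothesis L_gt0 : 0 < L.
Hypothesis T_gt0 : 0 < T.
Hypothesis N2 : (2 <= N)%N.
Hypothesis U0L : {ae P, forall w, `|U0 N a.+1 w| <= L}.
Hypothesis Usol : is_limit_solution P phi h (PN a.+1) (U0 N a.+1) U.

Let e s t := Ephi P phi s U t.
Let Dr t := h * \sum_(s : bool) sgnO s * prim (e s) t.
Let En t := h * \sum_(s : bool) prim (e s) t.

Let mU t : 0 <= t -> measurable_fun setT (U t). Proof. by case: Usol => H _; apply: H. Qed.

Let iphi s t : 0 <= t -> P.-integrable setT (fun w => (phi (sgnO s * U t w))%:E).
Proof. by case: Usol => _ [H _]; apply: H. Qed.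

Let ei s t : 0 <= t -> (@lebesgue_measure R).-integrable (Icc0 t) (fun x => (e s x)%:E).
Proof. by case: Usol => _ [_ [H _]]; apply: H. Qed.

Let e_ge0 s t : 0 <= e s t.
Proof. by apply: fine_ge0; apply: integral_ge0 => w _; rewrite lee_fin. Qed.

Let Dr0 : Dr 0 = 0.
Proof. by rewrite /Dr big1 ?mulr0 // => s _; rewrite prim0 mulr0. Qed.

Let En0 : En 0 = 0.
Proof. by rewrite /En big1 ?mulr0 // => s _; rewrite prim0. Qed.

Let prim_mono s x y : 0 <= x -> x <= y -> 0 <= prim (e s) y - prim (e s) x.
Proof.
move=> x0 xy; have [H _] := prim_incr (@ei s) x0 xy.
by have := H 0 (fun z _ => e_ge0 s z); rewrite mul0r.
Qed.

Let DrEn x y : 0 <= x -> x <= y -> y <= T -> `|Dr y - Dr x| <= En y - En x.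
Proof.
move=> x0 xy _; rewrite /Dr /En -!mulrBr normrM (gtr0_norm h_gt0) ler_pM2l // -!sumrB.
apply: le_trans (ler_norm_sum _ _ _) _; apply: ler_sum => s _.
by rewrite -mulrBr normr_sgnOM ger0_norm // prim_mono.
Qed.

Let En_ge0 t : 0 <= t -> 0 <= En t.
Proof.
move=> t0; have := @prim_mono true 0 t (lexx 0) t0; have := @prim_mono false 0 t (lexx 0) t0.
rewrite !prim0 !subr0 => p1 p2; rewrite /En sum_bool; apply: mulr_ge0; first exact: ltW.
exact: (addr_ge0 p2 p1).
Qed.

Let U_eq : {ae P, forall w, cadlag (fun t => U t w) /\ forall t, 0 <= t ->
   (forall s, pintegrable (PN a.+1 s w) t (own_jump phi s (fun t => U t w))) /\
   U t w = U0 N a.+1 w - \sum_(s : bool) pint (PN a.+1 s w) t (own_jump phi s (fun t => U t w)) + Dr t}.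
Proof.
case: Usol => _ [_ [_ H]]; move: H; apply: filterS => w [cU H]; split => //.
Qed.

(** This bound depends on the given solution through its integrated mean rates, so it must not enter
    the final constant. *)
Definition limit_B : R := L + En T.

Let aN : (1 <= a.+1 <= N)%N. Proof. by rewrite /= ltn_ord. Qed.

Lemma limit_B_ge0 : 0 <= limit_B.
Proof. by rewrite addr_ge0 ?(ltW L_gt0) // En_ge0 // ltW. Qed.

(** A cadlag path has some bound, hence a level [K] and a grid with simple strips, all depending on
    [w]; [limit_bound] turns this random bound into a deterministic one. *)
Lemma limit_ae_bound : {ae P, forall w, forall t, 0 <= t <= T -> `|U t w| <= limit_B}.
Proof.
have Hs := ae_simple_strips PNP indep T_gt0 N; have Hz := ae_zero_time PNP N.
near=> w.
have [cU UE] : cadlag (fun t => U t w) /\ forall t, 0 <= t ->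
   (forall s, pintegrable (PN a.+1 s w) t (own_jump phi s (fun t => U t w))) /\
   U t w = U0 N a.+1 w - \sum_(s : bool) pint (PN a.+1 s w) t (own_jump phi s (fun t => U t w)) + Dr t.
  by near: w.
have simple : forall K, exists n0, forall n, (n0 <= n)%N ->
  simple_strips T (fun a o => PN a o w) N n K by near: w.
have z0 : forall K : nat, forall a o, (1 <= a <= N)%N ->
  PN a o w ([set` `[(0 : R), 0]] `*` [set` `[(0 : R), K%:R[]) = 0%E by near: w.
have w0 : `|U0 N a.+1 w| <= L by near: w.
have [B HB] := cadlag_bounded T cU.
have B0 : 0 <= B by apply: le_trans (normr_ge0 _) (HB 0 _); rewrite lexx ltW.
have [lip [S [_ _ _ phiS]]] := clipped_constants phi_ge0 phi_ll B0.
pose K := (Num.truncn S).+1.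
have phiK x : `|x| <= B -> phi x < K%:R.
  by move=> xB; have := phiS x; rewrite clip_id // => /le_lt_trans; apply; apply: truncnS_gt.
have [n0 Hn0] := simple K.
have sing := simple_single_strips aN (Hn0 n0 (leqnn _)).
move=> t tT; have := limit_bound T_gt0 cU (fun s t t0 => (UE t t0).1 s) (fun t t0 => (UE t t0).2)
  Dr0 DrEn HB phiK (fun s => z0 K a.+1 s aN) sing tT.
move=> /le_trans; apply; rewrite En0 subr0 /limit_B lerD //.
by have /andP[t0 tT'] := tT; have := DrEn t0 tT' (lexx T); have := normr_ge0 (Dr T - Dr t); lra.
Unshelve. all: by end_near. Qed.

Section Kappa.
Variables (kap lip S : R) (K : nat).
Hypothesis kapB : limit_B <= kap.
Hypothesis lip_ge0 : 0 <= lip.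
Hypothesis S_ge0 : 0 <= S.
Hypothesis phi_lip : forall x y, `|phi (clip kap x) - phi (clip kap y)| <= lip * `|x - y|.
Hypothesis phi_S : forall x, phi (clip kap x) <= S.
Hypothesis SK : S + 2 <= K%:R.

Let phiU s t w : `|U t w| <= limit_B -> phi (sgnO s * U t w) = phi (clip kap (sgnO s * U t w)).
Proof. by move=> UB; rewrite clip_id // normr_sgnOM (le_trans UB). Qed.

Lemma Ephi_le s t : 0 <= t <= T -> e s t <= S.
Proof.
move=> tT; have /andP[t0 _] := tT.
rewrite -lee_fin /e /Ephi fineK ?integrable_fin_num //; last exact: iphi.
apply: (@le_trans _ _ (\int[P]_w S%:E)%E).
  apply: ae_ge0_le_integral => //.
  - by move=> w _; rewrite lee_fin.
  - exact: measurable_int (iphi s t0).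
  - have := limit_ae_bound; apply: filterS => w Hw _.
    by rewrite lee_fin phiU // Hw.
rewrite integral_cst // -[leRHS]mule1; apply: lee_wpmul2l; rewrite ?lee_fin //.
exact: probability_le1.
Qed.

Let c := 2 * (h * S).

Let c_ge0 : 0 <= c. Proof. by rewrite !mulr_ge0 // ltW. Qed.

Let En_lip x y : 0 <= x -> x <= y -> y <= T -> En y - En x <= c * (y - x).
Proof.
move=> x0 xy yT; rewrite /En -mulrBr /c mulrAC mulrCA ler_pM2l //.
have H s : prim (e s) y - prim (e s) x <= S * (y - x).
  have [_ H] := prim_incr (@ei s) x0 xy; apply: H => z /andP[xz zy].
  by apply: Ephi_le; rewrite (le_trans x0 xz) (le_trans zy yT).
rewrite -sumrB; apply: le_trans (ler_sum _ (fun s _ => H s)) _.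
by rewrite sumr_const card_bool -mulr_natl; lra.
Qed.

Definition drift_incr n k := Dr (grid T n k.+1) - Dr (grid T n k).

Local Notation Idx n := ('I_N * option (bool * 'I_(2 ^ n) * 'I_(K * 2 ^ n)))%type.
Local Notation Conf n := {ffun Idx n -> 'I_(init_size L n).+2}.

Definition conf_scheme n k (c0 : Conf n) :=
  limit_scheme (thr phi kap n) (drift_incr n) (init (@init_val _ L n) c0 a) (occ c0 a) k.

Definition scheme_path n k w := conf_scheme k (gconf PN U0 T L N n K w).

Let phi_K x : phi (clip kap x) + 2 <= K%:R.
Proof. by apply: le_trans SK; rewrite lerD2r. Qed.

Let thrK n x : (thr phi kap n x <= K * 2 ^ n)%N.
Proof. by apply: thr_le. Qed.

Lemma scheme_path_cvg : {ae P, forall w, exists n1, forall n, (n1 <= n)%N -> forall k, (k <= 2 ^ n)%N ->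
   `|U (grid T n k) w - scheme_path n k w| <= (1 + c * T) / 2 ^+ n}.
Proof.
have Hs := ae_simple_strips PNP indep T_gt0 N; have Hz := ae_zero_time PNP N.
have Hb := limit_ae_bound.
near=> w.
have [cU UE] : cadlag (fun t => U t w) /\ forall t, 0 <= t ->
   (forall s, pintegrable (PN a.+1 s w) t (own_jump phi s (fun t => U t w))) /\
   U t w = U0 N a.+1 w - \sum_(s : bool) pint (PN a.+1 s w) t (own_jump phi s (fun t => U t w)) + Dr t.
  by near: w.
have simple : forall K, exists n0, forall n, (n0 <= n)%N ->
  simple_strips T (fun a o => PN a o w) N n K by near: w.
have z0 : forall K : nat, forall a o, (1 <= a <= N)%N ->
  PN a o w ([set` `[(0 : R), 0]] `*` [set` `[(0 : R), K%:R[]) = 0%E by near: w.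
have w0 : `|U0 N a.+1 w| <= L by near: w.
have HB : forall t, 0 <= t <= T -> `|U t w| <= limit_B by near: w.
have phiK x : `|x| <= limit_B -> phi x < K%:R.
  move=> xB; have := phi_K x; rewrite clip_id; last exact: le_trans xB kapB.
  lra.
have [n0 Hn0] := simple K.
have sing : exists n0, forall n, (n0 <= n)%N -> single_strips T (fun s => PN a.+1 s w) K n.
  by exists n0 => n /Hn0; apply: simple_single_strips aN.
have [n1 Hn1] := limit_path_scheme T_gt0 cU (fun s t t0 => (UE t t0).1 s) (fun t t0 => (UE t t0).2)
  Dr0 DrEn HB phiK (fun s => z0 K a.+1 s aN) phi_ge0 lip_ge0 phi_lip kapB phi_K c_ge0 En_lip
  (x0n := fun n => init_approx L n (U0 N a.+1 w)) sing (fun n => init_approx_dist n w0).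
exists n1 => n n1n k kn; rewrite distrC; apply: le_trans (Hn1 n n1n k kn).
rewrite /scheme_path /conf_scheme limit_scheme_gconf // init_gconf //.
Unshelve. all: by end_near. Qed.

Let dl n := T / 2 ^+ n.
Let dl_ge0 n : 0 <= dl n. Proof. by rewrite divr_ge0 ?ltW // two_gt0. Qed.

Let mconf n (c0 : {ffun _}) : measurable [set w | gconf PN U0 T L N n K w = c0].
Proof. exact: (measurable_conf PNP mU0). Qed.

Lemma measurable_scheme_path n k : measurable_fun setT (scheme_path n k).
Proof.
apply: (measurable_finite_valued (X := gconf PN U0 T L N n K) (@conf_scheme n k)).
exact: mconf.
Qed.

Lemma drift_incr_sum n k : (k <= 2 ^ n)%N -> \sum_(i < k) `|drift_incr n i| <= En (grid T n k).
Proof.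
elim: k => [|k IH] kn; first by rewrite big_ord0 En_ge0 // grid_ge0.
rewrite big_ord_recr /=; have := IH (ltnW kn).
have := @DrEn (grid T n k) (grid T n k.+1) (grid_ge0 T_gt0 _ _)
  (grid_le T_gt0 n (leqnSn k)) (grid_leT T_gt0 kn).
by rewrite -/(drift_incr n k); set A1 := `|_|; set A2 := \sum_(_ < _) _; lra.
Qed.

Lemma conf_scheme_bound n k (c0 : Conf n) : (k <= 2 ^ n)%N -> `|conf_scheme k c0| <= limit_B.
Proof.
move=> kn; apply: le_trans (limit_scheme_bound _ _ _ _ (init_val_norm L_gt0 _)) _.
rewrite lerD2l; apply: le_trans (drift_incr_sum kn) _.
have := DrEn (grid_ge0 T_gt0 n k) (grid_leT T_gt0 kn) (lexx T).
by have := normr_ge0 (Dr T - Dr (grid T n k)); lra.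
Qed.

Let P_neq0 n i s : (P [set w | PN a.+1 s w (slab T n i K) != 0%E] <= (dl n * K%:R)%:E)%E.
Proof.
have iS := @intensity_slab _ _ T_gt0 n i K.
have := @prm_neq0_le _ _ _ _ _ (PNP s (ltn0Sn a)) _ (@measurable_slab _ T n i K).
by rewrite iS ltry => /(_ isT).
Qed.

Let mhit n i s : measurable [set w | PN a.+1 s w (slab T n i K) != 0%E].
Proof.
have fS : (intensity (slab T n i K) < +oo)%E by rewrite intensity_slab // ltry.
have := prm_measurable_preimage (PNP s (ltn0Sn a)) (@measurable_slab _ T n i K) fS
  (measurableC (emeasurable_set1 0%E)).
by congr (measurable _); apply/seteqP; split => w /= /eqP.
Qed.

Definition path_gap n w := runmax (fun k => `|U (grid T n k) w - scheme_path n k w|) (2 ^ n).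

Lemma measurable_path_gap n : measurable_fun setT (path_gap n).
Proof.
apply: measurable_runmax => k kn; apply: measurableT_comp => //; apply: measurable_funB.
  by apply: mU; apply: grid_ge0.
exact: measurable_scheme_path.
Qed.

(** Dominated convergence: [2 * limit_B] dominates, since [limit_B] bounds the scheme on every
    configuration and the solution almost surely. *)
Lemma path_gap_cvg0 : (\int[P]_w (path_gap n w)%:E)%E @[n --> \oo] --> 0%E.
Proof.
have B0 := limit_B_ge0.
have mG n : measurable_fun setT (fun w => (path_gap n w)%:E).
  by apply/measurable_EFinP; exact: measurable_path_gap.
have cG : {ae P, forall w, setT w -> (path_gap n w)%:E @[n --> \oo] --> 0%E}.
  have := scheme_path_cvg; apply: filterS => w [n1 H] _.
  apply: (@squeeze_cvge _ _ _ _ (cst 0%E) _ (fun n => ((1 + c * T) / 2 ^+ n)%:E)).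
  + exists n1 => // n /= n1n; rewrite !lee_fin; apply/andP; split; first by apply: runmax_ge0.
    by apply: runmax_le => k kn; exact: H.
  + exact: cvg_cst.
  + by apply: cvg_EFin; [exact: nearW|exact: cvg_halves].
have bG : {ae P, forall w n, setT w -> (`|(path_gap n w)%:E| <= (2 * limit_B)%:E)%E}.
  have := limit_ae_bound; apply: filterS => w H n _; rewrite lee_fin ger0_norm ?runmax_ge0 //.
  apply: runmax_le => k kn; rewrite mulr_natl mulr2n.
  apply: le_trans (ler_normB _ _) _; apply: lerD; last exact: conf_scheme_bound.
  by apply: H; rewrite grid_ge0 // (grid_leT T_gt0).
have [_ _] := dominated_convergence measurableT mG (measurable_cst 0%E) cG
  (finite_measure_integrable_cst P (2 * limit_B) measurableT) bG.
by rewrite integral0.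
Qed.

Let gap n := fine (\int[P]_w (path_gap n w)%:E)%E.

Let path_gap_ge0 n w : 0 <= path_gap n w. Proof. exact: runmax_ge0. Qed.

(** Inside a strip the solution moves by its drift alone, unless an atom below level [K] is present;
    then the crude bound on its size is paid. *)
Let ae_step : {ae P, forall w, forall n i t, (i < 2 ^ n)%N -> grid T n i <= t <= grid T n i.+1 ->
  `|U t w - U (grid T n i) w| <= c * dl n + 2 * limit_B *
    (\1_[set w | PN a.+1 true w (slab T n i K) != 0%E] w + \1_[set w | PN a.+1 false w (slab T n i K) != 0%E] w)}.
Proof.
have B0 := limit_B_ge0.
have Hb := limit_ae_bound; have := U_eq; apply: filterS2 Hb => w HB [cU UE] n i t ni /andP[it ti].
have gi0 := grid_ge0 T_gt0 n i; have t0 := le_trans gi0 it.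
have tT := le_trans ti (grid_leT T_gt0 ni).
have cd : 0 <= c * dl n by rewrite mulr_ge0.
have U2 : `|U t w - U (grid T n i) w| <= 2 * limit_B.
  rewrite mulr_natl mulr2n; apply: le_trans (ler_normB _ _) _; apply: lerD; apply: HB.
    by rewrite t0.
  by rewrite gi0 (le_trans it).
have I s : \1_[set w | PN a.+1 s w (slab T n i K) != 0%E] w = (PN a.+1 s w (slab T n i K) != 0%E)%:R :> R.
  by rewrite indicE; congr (nat_of_bool _)%:R; apply/idP/idP; rewrite inE.
rewrite !I.
have [z1|z1] := eqVneq (PN a.+1 true w (slab T n i K)) 0%E; last first.
  by rewrite /=; case: (PN a.+1 false w _ != 0%E) => /=; lra.
have [z2|z2] /= := eqVneq (PN a.+1 false w (slab T n i K)) 0%E; last by lra.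
have phiK x : `|x| <= limit_B -> phi x < K%:R.
  move=> xB; have := phi_K x; rewrite clip_id; last exact: le_trans xB kapB.
  lra.
have z s : PN a.+1 s w (slab T n i K) = 0%E by case: s.
rewrite (limit_strip_empty T_gt0 cU (fun s t t0 => (UE t t0).1 s) (fun t t0 => (UE t t0).2) HB phiK ni z (lexx _) it ti).
rewrite addrC addKr addr0 mulr0 addr0; apply: le_trans (DrEn gi0 it tT) _.
apply: le_trans (En_lip gi0 it tT) _; rewrite ler_wpM2l // lerBlDl.
by move: ti; rewrite gridS.
Qed.

Lemma path_gap_integrable n : P.-integrable setT (fun w => (path_gap n w)%:E).
Proof.
have mG : measurable_fun setT (fun w => (path_gap n w)%:E).
  by apply/measurable_EFinP; exact: measurable_path_gap.
apply/integrableP; split => //.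
apply: (@le_lt_trans _ _ (\int[P]_w (cst (2 * limit_B)%:E) w)%E); last first.
  rewrite integral_cst //. by rewrite [X in (_ * X)%E]probability_setT mule1 ltry.
apply: ae_ge0_le_integral => //.
- by apply: measurableT_comp.
- by move=> w _; rewrite lee_fin mulr_ge0 // limit_B_ge0.
have := limit_ae_bound; apply: filterS => w H _; rewrite lee_fin ger0_norm ?path_gap_ge0 //.
apply: runmax_le => k kn; rewrite mulr_natl mulr2n.
apply: le_trans (ler_normB _ _) _; apply: lerD; last exact: conf_scheme_bound.
by apply: H; rewrite grid_ge0 // (grid_leT T_gt0).
Qed.

Let step_gap n := c * dl n + 4 * limit_B * (dl n * K%:R) + gap n.

(** The drift integrates the mean rate over all times of a strip, while the scheme is known at its
    start: the cost is the motion within the strip, plus the probability of an atom for either sign,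
    plus the gap at the grid time. *)
Let int_step n i t : (i < 2 ^ n)%N -> grid T n i <= t <= grid T n i.+1 ->
  (\int[P]_w (`|U t w - scheme_path n i w|)%:E <= (step_gap n)%:E)%E.
Proof.
move=> ni tI; have t0 : 0 <= t by case/andP: tI => it _; apply: le_trans it; exact: grid_ge0.
have B0 := limit_B_ge0; have cd : 0 <= c * dl n by rewrite mulr_ge0.
pose hit s w : R := \1_[set w | PN a.+1 s w (slab T n i K) != 0%E] w.
have h0 s w : 0 <= hit s w by rewrite /hit indicE.
have mh s : measurable_fun setT (hit s) by apply: measurable_indic; exact: mhit.
have ih s : (\int[P]_w (hit s w)%:E <= (dl n * K%:R)%:E)%E.
  by rewrite /hit integral_indic ?setIT //; exact: P_neq0.
pose F w := ((c * dl n)%:E + (2 * limit_B)%:E * ((hit true w)%:E + (hit false w)%:E) + (path_gap n w)%:E)%E.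
have mG : measurable_fun setT (fun w => (path_gap n w)%:E).
  by apply/measurable_EFinP; exact: measurable_path_gap.
have mH : measurable_fun setT (fun w => (hit true w)%:E + (hit false w)%:E)%E.
  by apply: emeasurable_funD; apply/measurable_EFinP.
have H0 w : (0 <= (hit true w)%:E + (hit false w)%:E)%E by rewrite adde_ge0 ?lee_fin.
have m2 : measurable_fun setT (fun w => (2 * limit_B)%:E * ((hit true w)%:E + (hit false w)%:E))%E.
  by apply: measurable_funeM.
have p2 w : (0 <= (2 * limit_B)%:E * ((hit true w)%:E + (hit false w)%:E))%E.
  by rewrite mule_ge0 // lee_fin mulr_ge0.
have m3 : measurable_fun setT (fun w => (c * dl n)%:E + (2 * limit_B)%:E * ((hit true w)%:E + (hit false w)%:E))%E.
  by apply: emeasurable_funD => //.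
have p3 w : (0 <= (c * dl n)%:E + (2 * limit_B)%:E * ((hit true w)%:E + (hit false w)%:E))%E.
  by rewrite adde_ge0 // lee_fin.
apply: (@le_trans _ _ (\int[P]_w F w)%E).
  apply: ae_ge0_le_integral => //.
  - apply/measurable_EFinP; apply: measurableT_comp => //; apply: measurable_funB; first exact: mU.
    exact: measurable_scheme_path.
  - by move=> w _; rewrite adde_ge0 // lee_fin path_gap_ge0.
  - exact: emeasurable_funD.
  have := ae_step; apply: filterS => w Hw _; 
  rewrite (_ : F w = (c * dl n + 2 * limit_B * (hit true w + hit false w) + path_gap n w)%:E) // lee_fin.
  rewrite -(subrK (U (grid T n i) w) (U t w)) -addrA; apply: le_trans (ler_normD _ _) _.
  apply: lerD; first exact: Hw.
  by apply: (runmax_ge (fun k => `|U (grid T n k) w - scheme_path n k w|)); exact: ltnW.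
rewrite ge0_integralD //; last by move=> w _; rewrite lee_fin path_gap_ge0.
rewrite [X in (_ + X)%E](_ : _ = (gap n)%:E); last first.
  by rewrite /gap fineK // integrable_fin_num // path_gap_integrable.
rewrite /step_gap EFinD; apply: leeD => //.
rewrite ge0_integralD //.
rewrite EFinD; apply: leeD.
  by rewrite integral_cst // [X in (_ * X)%E]probability_setT mule1.
rewrite ge0_integralZl //; last by rewrite lee_fin mulr_ge0.
rewrite ge0_integralD //; try by [move=> w _; rewrite lee_fin|apply/measurable_EFinP].
rewrite (_ : 4 * limit_B * _ = 2 * limit_B * (dl n * K%:R + dl n * K%:R)); last by ring.
rewrite [leRHS]EFinM; apply: lee_wpmul2l; first by rewrite lee_fin mulr_ge0.
by rewrite [leRHS]EFinD; apply: leeD; exact: ih.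
Qed.

Local Notation law n := (@coord_law _ _ _ P U0 T L N n (K * 2 ^ n) (init_size L n)).
Local Notation plaw n := (fun i : Idx n => law n i.2).

Let Ex_phi n i s : Ex (plaw n) (fun c0 => phi (clip kap (sgnO s * conf_scheme i c0))) =
  fine (\int[P]_w (phi (clip kap (sgnO s * scheme_path n i w)))%:E)%E.
Proof.
pose F (c0 : Conf n) := phi (clip kap (sgnO s * conf_scheme i c0)).
have F0 c0 : 0 <= F c0 := phi_ge0 _.
by have := integral_conf PNP indep mU0 idU0 L T_gt0 N2 F0; rewrite /F => ->.
Qed.

Let e_scheme n i s t : (i < 2 ^ n)%N -> grid T n i <= t <= grid T n i.+1 ->
  `|e s t - Ex (plaw n) (fun c0 => phi (clip kap (sgnO s * conf_scheme i c0)))| <= lip * step_gap n.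
Proof.
move=> ni tI; have t0 : 0 <= t by case/andP: tI => it _; apply: le_trans it; exact: grid_ge0.
have tT : t <= T by case/andP: tI => _ ti; apply: le_trans ti (grid_leT T_gt0 ni).
have mX := measurable_scheme_path n i.
have mg : measurable_fun setT (fun w => phi (clip kap (sgnO s * scheme_path n i w))).
  apply: (measurable_finite_valued (X := gconf PN U0 T L N n K)
    (fun c0 : Conf n => phi (clip kap (sgnO s * conf_scheme i c0)))).
  exact: mconf.
have md : measurable_fun setT (fun w => (`|U t w - scheme_path n i w|)%:E).
  by apply/measurable_EFinP; apply: measurableT_comp => //; apply: measurable_funB => //; exact: mU.
rewrite Ex_phi; apply: Expectation_dist.
- exact: iphi.
- by apply: (@bounded_integrable _ _ _ _ _ S) => // w; rewrite ger0_norm.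
apply: (@le_trans _ _ (\int[P]_w (lip%:E * (`|U t w - scheme_path n i w|)%:E))%E).
  have mf : measurable_fun setT (fun w => phi (sgnO s * U t w)).
    by apply/measurable_EFinP; apply: measurable_int (iphi s t0).
  apply: ae_ge0_le_integral => //.
  - by apply/measurable_EFinP; apply: measurableT_comp => //; exact: measurable_funB.
  - by move=> w _; rewrite mule_ge0 ?lee_fin.
  - exact: measurable_funeM.
  have := limit_ae_bound; apply: filterS => w Hw _.
  rewrite -EFinM lee_fin phiU; last by apply: Hw; rewrite t0.
  by apply: le_trans (phi_lip _ _) _; rewrite -mulrBr normr_sgnOM.
rewrite ge0_integralZl //.
by rewrite EFinM; apply: lee_wpmul2l; rewrite ?lee_fin //; exact: int_step.
Qed.

Let fire_gap n := n.+1%:R^-1 + (2 ^+ n)^-1 + dl n * (S + 2) ^+ 2.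

(** The drift of the solution is almost self-consistent for the scheme that it drives: [step_gap]
    replaces the solution by the scheme inside the mean rate, and [fire_gap] replaces the rate over
    a strip by the firing probability. *)
Let drift_bound n : drift_defect (law n) (cell_rate T n) (thr phi kap n)
     (@init_val _ L n) h (drift_incr n) a <= 2 * h * T * (lip * step_gap n + fire_gap n).
Proof.
have p0 := @coord_law_ge0 _ _ _ P U0 T L N n (K * 2 ^ n) (init_size L n) T_gt0.
have p1 := @coord_law_sum1 _ _ _ P U0 mU0 T L N n (K * 2 ^ n) (init_size L n) N2.
have fine_step i s : (i < 2 ^ n)%N ->
  `|(prim (e s) (grid T n i.+1) - prim (e s) (grid T n i)) -
    Ex (plaw n) (fun c0 => fire_prob (cell_rate T n) (thr phi kap n) (sgnO s * conf_scheme i c0))| <=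
  dl n * (lip * step_gap n + fire_gap n).
  move=> ni; set q := Ex _ _.
  pose m0 := Ex (plaw n) (fun c0 => phi (clip kap (sgnO s * conf_scheme i c0))).
  have gd : grid T n i.+1 - grid T n i = dl n by rewrite gridS addrC addKr.
  have g0 := grid_ge0 T_gt0 n i; have gl := grid_le T_gt0 n (leqnSn i).
  have [lo up] := prim_incr (@ei s) g0 gl.
  have H1 : `|(prim (e s) (grid T n i.+1) - prim (e s) (grid T n i)) - dl n * m0| <= dl n * (lip * step_gap n).
    have {lo}lo := lo (m0 - lip * step_gap n); have {up}up := up (m0 + lip * step_gap n).
    rewrite gd in lo up.
    rewrite ler_norml; apply/andP; split.
      have : (m0 - lip * step_gap n) * dl n <= prim (e s) (grid T n i.+1) - prim (e s) (grid T n i).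
        apply: lo => x xI; have := e_scheme s ni xI; rewrite -/m0 ler_norml => /andP[+ _].
        by set b := lip * _; lra.
      by move=> H; rewrite lerBrDr [leLHS]addrC -mulrBr mulrC.
    have : prim (e s) (grid T n i.+1) - prim (e s) (grid T n i) <= (m0 + lip * step_gap n) * dl n.
      apply: up => x xI; have := e_scheme s ni xI; rewrite -/m0 ler_norml => /andP[_ +].
      by set b := lip * _; lra.
    by move=> H; rewrite lerBlDr [leRHS]addrC -mulrDr mulrC.
  have H2 : `|dl n * m0 - q| <= dl n * fire_gap n.
    rewrite distrC /q /m0 -ExZ -ExB; apply: le_trans (normr_Ex _ _) _; first by move=> *; exact: p0.
    rewrite -[leRHS](Ex_cst (p := plaw n)); last by move=> ?; exact: p1.
    apply: le_Ex => [*|c0]; first exact: p0.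
    exact: (fire_prob_approx phi_ge0 _ T_gt0 phi_S).
  rewrite mulrDr -(subrK (dl n * m0) (prim _ _ - _)) -addrA; apply: le_trans (ler_normD _ _) _.
  exact: lerD.
rewrite /drift_defect.
apply: (@le_trans _ _ (\sum_(i < 2 ^ n) h * (2 * (dl n * (lip * step_gap n + fire_gap n))))).
  apply: ler_sum => i _.
  rewrite /drift_incr /Dr -!mulrBr normrM (gtr0_norm h_gt0) ler_pM2l // -!sumrB.
  apply: le_trans (ler_norm_sum _ _ _) _.
  apply: le_trans (_ : _ <= \sum_(s : bool) dl n * (lip * step_gap n + fire_gap n)) _.
    by apply: ler_sum => s _; rewrite -!mulrBr normr_sgnOM; exact: fine_step.
  by rewrite sumr_const card_bool mulr_natl.
rewrite sumr_const card_ord -[_ *+ (2 ^ n)]mulr_natl natrX /dl.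
rewrite le_eqVlt; apply/orP; left; apply/eqP; field.
by rewrite gt_eqF // two_gt0.
Qed.

Definition conf_field n k (c0 : Conf n) : R :=
  mean_field (law n) (cell_rate T n) (thr phi kap n) (@init_val _ L n) h k c0 a.

Definition field_gap n w :=
  runmax (fun k => `|U (grid T n k) w - conf_field k (gconf PN U0 T L N n K w)|) (2 ^ n).

Let MB := 2 * L + 4 * h * (T * (S + 2)).
Let Cc := 4 * h + 2 * (limit_B + MB).

Let MB_ge0 : 0 <= MB.
Proof. by rewrite !(addr_ge0, mulr_ge0) //; apply: ltW. Qed.

Let Cc_ge0 : 0 <= Cc.
Proof.
apply: addr_ge0; first by rewrite mulr_ge0 // ltW.
apply: mulr_ge0 => //; apply: addr_ge0 => //; exact: limit_B_ge0.
Qed.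

Lemma conf_field_bound n k (c0 : Conf n) : (k <= 2 ^ n)%N -> `|conf_field k c0| <= MB.
Proof.
move=> kn; have p0 := @coord_law_ge0 _ _ _ P U0 T L N n (K * 2 ^ n) (init_size L n) T_gt0.
have p1 := @coord_law_sum1 _ _ _ P U0 mU0 T L N n (K * 2 ^ n) (init_size L n) N2.
have pr := @coord_law_rate _ _ _ P U0 T L N n (K * 2 ^ n) (init_size L n).
have := mean_field_bound (thr := thr phi kap n) (x0 := @init_val _ L n) (s0 := T / 2 ^+ n * (S + 2))
  p0 p1 pr (cell_rate_bounds n T_gt0) (@thrK n) (fun v => init_val_norm L_gt0 v) h_gt0
  (fun x _ => rate_thr_le phi_ge0 n T_gt0 (phi_S x)) a c0 kn.
rewrite -/(conf_field k c0) /MB natrX.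
rewrite (_ : 4 * h * 2 ^+ n * _ = 4 * h * (T * (S + 2))) //; field.
by rewrite gt_eqF // two_gt0.
Qed.

Let limit_gap n (c0 : Conf n) := runmax (fun k => `|conf_scheme k c0 - conf_field k c0|) (2 ^ n).

Let limit_gap_mean n : Ex (plaw n) (@limit_gap n) <=
  (2 * (2 * h * T * (lip * step_gap n + fire_gap n)) + Cc * dl n) * expR (Cc * (T * lip)).
Proof.
have p0 := @coord_law_ge0 _ _ _ P U0 T L N n (K * 2 ^ n) (init_size L n) T_gt0.
have p1 := @coord_law_sum1 _ _ _ P U0 mU0 T L N n (K * 2 ^ n) (init_size L n) N2.
have pr := @coord_law_rate _ _ _ P U0 T L N n (K * 2 ^ n) (init_size L n).
have B0 : 0 <= limit_B + MB by rewrite addr_ge0 // limit_B_ge0.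
have lp0 : 0 <= T / 2 ^+ n * lip by apply: mulr_ge0 => //; exact: dl_ge0.
have HB (c0 : Conf n) k : (k <= 2 ^ n)%N -> `|conf_scheme k c0 - conf_field k c0| <= limit_B + MB.
  move=> kn; apply: le_trans (ler_normB _ _) _; apply: lerD.
    exact: (conf_scheme_bound c0 kn).
  exact: conf_field_bound.
apply: le_trans (limit_mean_field_dist p0 p1 pr (cell_rate_bounds n T_gt0) (@thrK n) h_gt0 lp0
  (thr_lip_le phi_ge0 n T_gt0 phi_lip) B0 HB) _.
rewrite -/Cc.
have E : (1 + Cc * (T / 2 ^+ n * lip)) ^+ (2 ^ n) <= expR (Cc * (T * lip)).
  rewrite (_ : Cc * (T / 2 ^+ n * lip) = Cc * (T * lip) / 2 ^+ n); last by ring.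
  by apply: pow_le_expR; rewrite !mulr_ge0 //; apply: ltW.
have E2 : Cc * (2 ^ n)%:R * (T / 2 ^+ n / 2 ^+ n) = Cc * dl n.
  by rewrite natrX /dl; field; rewrite gt_eqF // two_gt0.
rewrite E2; apply: ler_pM => //.
- apply: addr_ge0; last by rewrite mulr_ge0.
  by apply: mulr_ge0 => //; apply: sumr_ge0 => i _.
- by rewrite exprn_ge0 // addr_ge0 // mulr_ge0.
- by rewrite lerD2r ler_pM2l // drift_bound.
Qed.

Lemma measurable_field_gap n : measurable_fun setT (field_gap n).
Proof.
apply: measurable_runmax => k kn; apply: measurableT_comp => //; apply: measurable_funB.
  by apply: mU; apply: grid_ge0.
by apply: (measurable_finite_valued (X := gconf PN U0 T L N n K) (@conf_field n k)); exact: mconf.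
Qed.

(** The scheme driven by the drift of the solution is the intermediate: it approaches the solution
    by dominated convergence, and the self-consistent scheme because its defect vanishes. *)
Lemma field_gap_cvg0 : (\int[P]_w (field_gap n w)%:E)%E @[n --> \oo] --> 0%E.
Proof.
have gap0 : gap n @[n --> \oo] --> (0 : R) by exact: fine_cvg path_gap_cvg0.
pose vb n := gap n + (2 * (2 * h * T * (lip * step_gap n + fire_gap n)) + Cc * dl n) * expR (Cc * (T * lip)).
have dl0 : dl n @[n --> \oo] --> (0 : R) by exact: cvg_halves.
have step0 : step_gap n @[n --> \oo] --> (0 : R).
  rewrite (_ : 0 = c * 0 + 4 * limit_B * (0 * K%:R) + 0); last by ring.
  apply: cvgD => //; apply: cvgD; first exact: cvgMr.
  by apply: cvgMr; exact: cvgMl.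
have fire0 : fire_gap n @[n --> \oo] --> (0 : R).
  rewrite (_ : 0 = 0 + 0 + 0 * (S + 2) ^+ 2); last by ring.
  apply: cvgD; last exact: cvgMl.
  apply: cvgD; first exact: cvg_harmonic.
  by have := @cvg_halves R 1; under eq_fun do rewrite mul1r.
have vb0 : vb n @[n --> \oo] --> (0 : R).
  rewrite (_ : 0 = 0 + (2 * (2 * h * T * (lip * 0 + 0)) + Cc * 0) * expR (Cc * (T * lip))); last by ring.
  apply: cvgD => //; apply: cvgMl; apply: cvgD; last exact: cvgMr.
  by apply: cvgMr; apply: cvgMr; apply: cvgD => //; exact: cvgMr.
apply: (@squeeze_cvge _ _ _ _ (cst 0%E) _ (fun n => (vb n)%:E)); last 2 first.
- exact: cvg_cst.
- by apply: cvg_EFin; [exact: nearW|].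
apply: nearW => n; apply/andP; split.
  by apply: integral_ge0 => w _; rewrite lee_fin runmax_ge0.
have mG : measurable_fun setT (fun w => (path_gap n w)%:E).
  by apply/measurable_EFinP; exact: measurable_path_gap.
have l0 c0 : 0 <= @limit_gap n c0 by exact: runmax_ge0.
have mL : measurable_fun setT (fun w => (limit_gap (gconf PN U0 T L N n K w))%:E).
  apply/measurable_EFinP.
  by apply: (measurable_finite_valued (X := gconf PN U0 T L N n K) (@limit_gap n)); exact: mconf.
apply: (@le_trans _ _ (\int[P]_w ((path_gap n w)%:E + (limit_gap (gconf PN U0 T L N n K w))%:E))%E).
  apply: ge0_le_integral => //.
  - by move=> w _; rewrite lee_fin runmax_ge0.
  - by apply/measurable_EFinP; exact: measurable_field_gap.
  - exact: emeasurable_funD.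
  move=> w _; rewrite -EFinD lee_fin; apply: runmax_le => k kn.
  rewrite -(subrK (scheme_path n k w) (U _ w)) -addrA; apply: le_trans (ler_normD _ _) _.
  apply: lerD; first exact: (runmax_ge (fun k => `|U (grid T n k) w - scheme_path n k w|)).
  exact: (runmax_ge (fun k => `|scheme_path n k w - conf_field k (gconf PN U0 T L N n K w)|)).
rewrite ge0_integralD //; try (by move=> w _; rewrite lee_fin).
have il := integral_conf PNP indep mU0 idU0 L T_gt0 N2 l0.
rewrite [X in (_ + X)%E](_ : _ = (Ex (plaw n) (@limit_gap n))%:E) //.
rewrite [X in (X + _)%E](_ : _ = (gap n)%:E); last first.
  by rewrite /gap fineK // integrable_fin_num // path_gap_integrable.
by rewrite -EFinD lee_fin lerD2l; exact: limit_gap_mean.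
Qed.

End Kappa.
End LimitSolution.

(** * Propagation of chaos *)

Section FiniteWorldBound.
Context {R : realType}.
Variables (phi : R -> R) (r S4 lip SM : R).
Hypothesis phi_ge0 : forall x, 0 <= phi x.
Hypothesis r_gt0 : 0 < r.
Hypothesis S4_ge0 : 0 <= S4.
Hypothesis phi_S4 : forall x, phi (clip (4 * r) x) <= S4.

(** Per actor, [mean_cells] bounds the expected number of occupied small cells: two signs, time [r],
    and height [S4] plus one for the margin of the threshold and one for rounding. [good_level] is
    [2L + 4hZ/N] with [Z/N] at most [mean_cells + 1]; [bad_level] adds the [2L] of the actor scheme
    to the bound on the self-consistent one. *)
Definition mean_cells : R := 2 * r * (S4 + 2).
Definition good_level : R := 2 * r + 4 * r * (mean_cells + 1).
Definition bad_level : R := good_level + 2 * r.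

Hypothesis lip_ge0 : 0 <= lip.
Hypothesis SM_ge0 : 0 <= SM.
Hypothesis phi_lip : forall x y, `|phi (clip good_level x) - phi (clip good_level y)| <= lip * `|x - y|.
Hypothesis phi_SM : forall x, phi (clip good_level x) <= SM.

(** The coefficient [4h + 2B] of the comparison, with [h <= r] and with [B] twice [good_level], as
    both schemes stay below it. In [chaos_const] the three contributions are the mismatches on bad
    configurations, the fluctuations and the crude bound on bad configurations; [grid_const]
    collects the rounding errors. *)
Let Ga := 4 * r + 4 * good_level.

Definition grid_const : R := Ga * r * expR (Ga * (r * lip)).
Definition chaos_const : R :=
  (Ga * (r * (SM + 2) * mean_cells) + 4 * r * (6 * (r * (SM + 2)) + 1)) * expR (Ga * (r * lip)) +
  (bad_level + 4 * r * (mean_cells + 1)) * mean_cells.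

Let r0 : 0 <= r. Proof. exact: ltW. Qed.

Lemma mean_cells_ge0 : 0 <= mean_cells.
Proof. by rewrite /mean_cells !(mulr_ge0, addr_ge0). Qed.

Lemma good_level_ge : 4 * r <= good_level.
Proof.
have H : 0 <= r * mean_cells by rewrite mulr_ge0 // mean_cells_ge0.
rewrite /good_level mulrDr mulr1 -(mulrA 4); move: H; set z := r * _; have := r0; lra.
Qed.

Let gl_ge0 : 0 <= good_level. Proof. by apply: le_trans good_level_ge; rewrite mulr_ge0. Qed.
Let Ga_ge0 : 0 <= Ga. Proof. by rewrite addr_ge0 // mulr_ge0. Qed.
Let bl_ge0 : 0 <= bad_level. Proof. by rewrite addr_ge0 // mulr_ge0. Qed.

Variables (L T h : R) (N n J q : nat).
Hypothesis h_gt0 : 0 < h.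
Hypothesis L_gt0 : 0 < L.
Hypothesis T_gt0 : 0 < T.
Hypothesis hr : h <= r.
Hypothesis Lr : L <= r.
Hypothesis Tr : T <= r.
Hypothesis N_gt0 : (0 < N)%N.

Definition small_levels : nat := (Num.truncn (2 ^+ n * (S4 + 1))).+1.

Hypothesis thrJ : forall x, (thr phi good_level n x <= J)%N.
Hypothesis levelsJ : (small_levels <= J)%N.
Variable p0 : option (bool * 'I_(2 ^ n) * 'I_J) -> 'I_q.+2 -> R.
Hypothesis p0_ge0 : forall i v, 0 <= p0 i v.
Hypothesis p0_sum1 : forall i, \sum_v p0 i v = 1.
Hypothesis p0_rate : forall x, \sum_(v | v != ord0) p0 (Some x) v = cell_rate T n.
Variable x0 : 'I_q.+2 -> R.
Hypothesis x0L : forall v, `|x0 v| <= L.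

Let Conf := {ffun 'I_N * option (bool * 'I_(2 ^ n) * 'I_J) -> 'I_q.+2}.
Let tr := thr phi good_level n.
Let rate := cell_rate T n.
Let Y (c : Conf) k a := actor_scheme tr h (init x0 c) (occ c) k a.
Let mf (c : Conf) k a := mean_field p0 rate tr x0 h k c a.

Definition cells_below (c : Conf) : R := small_cells R (occ c) small_levels (2 ^ n).
Definition good_conf (c : Conf) : bool := cells_below c <= N%:R * (mean_cells + 1).

(* On a bad configuration the potentials are only bounded linearly in the number
   of occupied small cells. *)
Definition chaos_gap (a : 'I_N) (c : Conf) : R :=
  (good_conf c)%:R * runmax (fun k => `|Y c k a - mf c k a|) (2 ^ n) +
  (~~ good_conf c)%:R * (bad_level + 4 * r / N%:R * cells_below c).

Lemma phi_small x : `|x| <= 4 * h -> phi (clip good_level x) <= S4.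
Proof.
move=> xh; have x4 : `|x| <= 4 * r by apply: le_trans xh _; rewrite ler_pM2l.
by rewrite (clip_id (le_trans x4 good_level_ge)) -(clip_id x4) phi_S4.
Qed.

Lemma thr_small x : `|x| <= 4 * h -> (tr x <= small_levels)%N.
Proof. by move=> xh; apply: thr_small_le; apply: phi_small. Qed.

Lemma good_conf_bound (x1 : 'I_N -> R) oc k a : (forall a, `|x1 a| <= L) -> 
  small_cells R oc small_levels k <= N%:R * (mean_cells + 1) ->
  `|actor_scheme tr h x1 oc k a| <= good_level.
Proof.
move=> x1L small; apply: le_trans (actor_scheme_bound _ h_gt0 x1L thr_small _ _) _.
rewrite card_ord /good_level; apply: lerD; first by rewrite ler_pM2l.
have N0 : 0 < N%:R :> R by rewrite ltr0n.
have mu1 : 0 <= mean_cells + 1 by rewrite addr_ge0 // mean_cells_ge0.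
apply: (@le_trans _ _ (4 * h / N%:R * (N%:R * (mean_cells + 1)))).
  by rewrite ler_wpM2l // divr_ge0 // mulr_ge0 // ltW.
by rewrite mulrA divfK ?gt_eqF // ler_wpM2r // ler_pM2l.
Qed.

(** Here the expected number of small cells takes the place of [Z/N], so the level chosen for good
    configurations serves on all of them. *)
Lemma mean_field_good (c : Conf) k a : (k <= 2 ^ n)%N -> `|mf c k a| <= good_level.
Proof.
move=> kn; apply: le_trans (mean_field_bound (s0 := T / 2 ^+ n * (S4 + 2)) p0_ge0 p0_sum1 p0_rate
  (cell_rate_bounds n T_gt0) thrJ x0L h_gt0 _ _ _ kn) _.
  by move=> x /phi_small xS; exact: rate_thr_le.
rewrite natrX (_ : 4 * h * 2 ^+ n * _ = 4 * h * (T * (S4 + 2))); last first.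
  by field; rewrite gt_eqF // two_gt0.
rewrite /good_level; apply: lerD; first by rewrite ler_pM2l.
have h1 : 4 * h * (T * (S4 + 2)) <= 4 * r * (r * (S4 + 2)).
  apply: ler_pM; rewrite ?mulr_ge0 ?addr_ge0 ?(ltW h_gt0) ?(ltW T_gt0) ?ler_pM2l ?ler_wpM2r ?addr_ge0 //.
apply: le_trans h1 _; rewrite ler_pM2l ?mulr_gt0 // /mean_cells.
have : 0 <= r * (S4 + 2) by rewrite mulr_ge0 // addr_ge0.
lra.
Qed.

Lemma mean_chaos_gap a :
  Ex (fun i => p0 i.2) (chaos_gap a) <= chaos_const / Num.sqrt N%:R + grid_const / 2 ^+ n.
Proof.
have N0 : 0 < N%:R :> R by rewrite ltr0n.
set sN := Num.sqrt N%:R.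
have s0 : 0 < sN by rewrite sqrtr_gt0.
have ss : sN * sN = #|'I_N|%:R by rewrite card_ord -expr2 sqr_sqrtr // ltW.
have s1 : 1 <= sN by rewrite -[leLHS]sqrtr1 ler_sqrt // ler1n.
have Ns : 1 / N%:R <= sN^-1.
  by rewrite div1r lef_pV2 ?posrE // -[X in _ <= X%:R]card_ord -ss ler_peMl // ltW.
have mu_ge0 := mean_cells_ge0.
have e0 := expR_ge0 (Ga * (r * lip)).
have rate01 := cell_rate_bounds n T_gt0.
have N0' : (0 < #|'I_N|)%N by rewrite card_ord.
have mu0P : (2 ^ n)%:R * (2 * (small_levels%:R * cell_rate T n)) <= mean_cells.
  apply: le_trans (small_rate_le n T_gt0 S4_ge0) _.
  by rewrite /mean_cells ler_wpM2r ?addr_ge0 // ler_pM2l.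
have cells al ga := Ex_many_small_cells p0_ge0 p0_sum1 p0_rate rate01 levelsJ N0' mu0P (al := al) (ga := ga).
have bad_le : Ex (fun i => p0 i.2) (fun c : Conf => (~~ good_conf c)%:R) <= mean_cells / N%:R.
  have := cells 1 0 ler01 (lexx 0); rewrite card_ord; rewrite [X in _ <= X * _ / _](_ : _ = 1) ?mul1r; last by rewrite mul0r addr0.
  apply: le_trans.
  rewrite le_eqVlt; apply/orP; left; apply/eqP; apply: eq_Ex => c.
  by rewrite /good_conf mul0r mul0r addr0 mulr1.
set kap := T / 2 ^+ n * (SM + 2).
have d0 : 0 < T / 2 ^+ n by rewrite divr_gt0 // two_gt0.
have kap0 : 0 < kap by rewrite mulr_gt0 // ltr_wpDl.
have B0 : 0 <= 2 * good_level by rewrite mulr_ge0.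
have goodB (c : Conf) k b : good_conf c -> (k <= 2 ^ n)%N -> `|Y c k b - mf c k b| <= 2 * good_level.
  move=> gc kn; rewrite mulr_natl mulr2n; apply: le_trans (ler_normB _ _) _; apply: lerD.
    apply: good_conf_bound => [b'|]; first exact: x0L.
    have gc' : cells_below c <= N%:R * (mean_cells + 1) := gc.
    exact: le_trans (small_cells_homo _ _ _ kn) gc'.
  exact: mean_field_good.
have lp0 : 0 <= T / 2 ^+ n * lip by rewrite mulr_ge0 // ltW.
have main := actor_mean_field_dist p0_ge0 p0_sum1 p0_rate rate01 thrJ h_gt0 lp0
  (thr_lip_le phi_ge0 n T_gt0 phi_lip) kap0 (fun x => rate_thr_le phi_ge0 n T_gt0 (phi_SM x))
  s0 ss B0 goodB s1 a (leqnn (2 ^ n)).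
rewrite /chaos_gap ExD.
have bad_part : Ex (fun i => p0 i.2) (fun c : Conf => (~~ good_conf c)%:R * (bad_level + 4 * r / N%:R * cells_below c))
  <= (bad_level + 4 * r * (mean_cells + 1)) * mean_cells / sN.
  have r4 : 0 <= 4 * r by rewrite mulr_ge0.
  have := cells bad_level (4 * r) bl_ge0 r4; rewrite card_ord => /le_trans; apply.
  rewrite ler_wpM2l ?div1r // ?mulr_ge0 // ?addr_ge0 // ?mulr_ge0 // ?addr_ge0 //.
  by rewrite -div1r.
apply: le_trans (lerD main bad_part) _.
set pbad := Ex _ _ in bad_le *.
set G := 4 * h + 2 * (2 * good_level).
have GGa : G <= Ga by rewrite /G /Ga mulrA -natrM lerD2r ler_pM2l.
have G0 : 0 <= G by rewrite addr_ge0 // mulr_ge0 // ltW.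
have S20 : 0 <= SM + 2 by rewrite addr_ge0.
have TSr : T * (SM + 2) <= r * (SM + 2) by rewrite ler_wpM2r.
have TS0 : 0 <= T * (SM + 2) by rewrite mulr_ge0 // ltW.
have pbad0 : 0 <= pbad by apply: Ex_ge0 => // c; rewrite ler0n.
have pbadN : pbad <= mean_cells / sN.
  by apply: le_trans bad_le _; rewrite ler_wpM2l // -div1r.
have two0 := @two_gt0 R n.
(* Summed over the 2^n strips, the rounding error of one cell area each becomes [T / 2^n], and the
   bound [kap] on a strip becomes [T * (SM + 2)]. *)
have E1 : G * (2 ^ n)%:R * (T / 2 ^+ n / 2 ^+ n + kap * pbad) = G * (T / 2 ^+ n + T * (SM + 2) * pbad).
  by rewrite natrX /kap; field; rewrite gt_eqF.
have E2 : (2 ^ n)%:R * kap = T * (SM + 2) by rewrite natrX /kap; field; rewrite gt_eqF.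
have E3 : (1 + G * (T / 2 ^+ n * lip)) ^+ (2 ^ n) <= expR (Ga * (r * lip)).
  rewrite (_ : G * (T / 2 ^+ n * lip) = G * (T * lip) / 2 ^+ n); last by ring.
  apply: le_trans (pow_le_expR _ _) _; first by rewrite !mulr_ge0 // ltW.
  by rewrite ler_expR ler_pM // ?mulr_ge0 ?ler_wpM2r // ltW.
rewrite E1 E2.
apply: (@le_trans _ _ ((Ga * (r / 2 ^+ n + r * (SM + 2) * (mean_cells / sN)) +
    4 * r / sN * (6 * (r * (SM + 2)) + 1)) * expR (Ga * (r * lip)) +
    (bad_level + 4 * r * (mean_cells + 1)) * mean_cells / sN)).
  rewrite lerD2r; apply: ler_pM => //.
  - apply: addr_ge0; first by rewrite mulr_ge0 // addr_ge0 ?mulr_ge0 // ltW.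
    by rewrite mulr_ge0 ?divr_ge0 ?mulr_ge0 ?addr_ge0 ?mulr_ge0 // ltW.
  - by rewrite exprn_ge0 // addr_ge0 // mulr_ge0.
  apply: lerD.
    apply: ler_pM => //; first by rewrite addr_ge0 ?mulr_ge0 // ltW.
    apply: lerD; first by rewrite ler_wpM2r // invr_ge0 ltW.
    exact: ler_pM.
  have Q1 : 0 <= 4 * h / sN by rewrite divr_ge0 ?mulr_ge0 // ltW.
  have Q2 : 0 <= 6 * (T * (SM + 2)) + 1 by rewrite addr_ge0 // mulr_ge0.
  have Q3 : 4 * h / sN <= 4 * r / sN by rewrite ler_wpM2r ?invr_ge0 ?(ltW s0) // ler_pM2l.
  have Q4 : 6 * (T * (SM + 2)) + 1 <= 6 * (r * (SM + 2)) + 1 by rewrite lerD2r ler_pM2l.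
  exact: ler_pM Q1 Q2 Q3 Q4.
rewrite /chaos_const /grid_const le_eqVlt; apply/orP; left; apply/eqP; field.
by rewrite !gt_eqF.
Qed.

End FiniteWorldBound.

(** * Passage to the limit in the mesh *)

Import HBNNSimple.

(* [f] may be non-measurable: its integral is still the supremum of the integrals
   of the simple functions below it. *)
Lemma integral_le_ae (d : measure_display) (Omega : measurableType d) (R : realType)
    (P : {measure set Omega -> \bar R}) (f g : Omega -> \bar R) :
  (forall w, 0 <= f w)%E -> (forall w, 0 <= g w)%E -> measurable_fun setT g ->
  {ae P, forall w, (f w <= g w)%E} -> (\int[P]_w f w <= \int[P]_w g w)%E.
Proof.
move=> f0 g0 mg fg; rewrite [leLHS]ge0_integralTE //; apply: ge_ereal_sup => _ [k kf <-].
rewrite -integralT_nnsfun; apply: ae_ge0_le_integral => //.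
- by move=> w _; rewrite lee_fin; apply: fun_ge0.
- by apply/measurable_EFinP.
by move: fg; apply: filterS => w fgw _; apply: le_trans fgw.
Qed.

Lemma le_limn_einf (R : realType) (u : nat -> \bar R) x n1 :
  (forall n, (n1 <= n)%N -> (x <= u n)%E) -> (x <= limn_einf u)%E.
Proof.
move=> H; rewrite limn_einf_lim; apply: lime_ge; first exact: is_cvg_einfs.
exists n1 => // n /= n1n; apply: le_ereal_inf_tmp => _ [m /= nm <-].
by apply: H; apply: leq_trans nm.
Qed.

Lemma limn_einf_le (R : realType) (u b : nat -> \bar R) l :
  (forall n, (u n <= b n)%E) -> b n @[n --> \oo] --> l -> (limn_einf u <= l)%E.
Proof.
move=> ub bl; rewrite limn_einf_lim -(cvg_lim _ bl) //; apply: lee_lim; first exact: is_cvg_einfs.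
  by apply/cvg_ex; exists l.
by apply: nearW => n; apply: le_trans (ub n); apply: ereal_inf_lbound; exists n => /=.
Qed.

(** [f] will be a supremum over a continuum of times; measurability is carried by the approximations
    [W n]. *)
Lemma Fatou_ae (d : measure_display) (Omega : measurableType d) (R : realType)
    (P : {measure set Omega -> \bar R}) (f : Omega -> \bar R) (W : nat -> Omega -> \bar R)
    (b : nat -> \bar R) (l : \bar R) :
  (forall w, 0 <= f w)%E -> (forall n w, 0 <= W n w)%E -> (forall n, measurable_fun setT (W n)) ->
  {ae P, forall w, (f w <= limn_einf (W ^~ w))%E} ->
  (forall n, \int[P]_w W n w <= b n)%E -> b n @[n --> \oo] --> l -> (\int[P]_w f w <= l)%E.
Proof.
move=> f0 W0 mW fW Wb bl.
apply: (@le_trans _ _ (\int[P]_w limn_einf (W ^~ w))%E).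
  apply: integral_le_ae => //.
    by move=> w; apply: (@le_limn_einf _ _ _ 0).
  apply: (emeasurable_fun_cvg (fun m w => einfs (W ^~ w) m)).
    exact: measurable_fun_einfs.
  by move=> w _; rewrite limn_einf_lim; apply: is_cvg_einfs.
apply: le_trans (fatou P measurableT mW _) _ => //.
exact: limn_einf_le Wb bl.
Qed.

Lemma grid_refine (R : realType) (T : R) m n k : (m <= n)%N -> grid T n (k * 2 ^ (n - m)) = grid T m k.
Proof.
move=> mn; have E : 2 ^+ n = 2 ^+ (n - m) * 2 ^+ m :> R by rewrite -exprD subnK.
rewrite /grid natrM natrX E; field.
by rewrite !gt_eqF // two_gt0.
Qed.

Lemma eventually_halves (R : realType) (C eta : R) : 0 < eta ->
  exists n1, forall n, (n1 <= n)%N -> C / 2 ^+ n < eta.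
Proof.
move=> e0; have := @cvgr_lt _ _ _ _ _ _ (@cvg_halves R C) eta e0.
by case=> n1 _ H; exists n1 => n; apply: H.
Qed.

(** By right continuity [s] is approached by a grid point of some generation [m], which remains a
    grid point of all later generations; so the grid bound eventually reaches it, from a rank that
    depends on [s] and [eta]. *)
Lemma grid_approx_path (R : realType) (T : R) (f : R -> R) (W : nat -> R) : 0 < T ->
  (forall t, 0 <= t -> f x @[x --> at_right t] --> f t) ->
  (exists n1, forall n, (n1 <= n)%N -> forall k, (k <= 2 ^ n)%N -> `|f (grid T n k)| <= 1 / 2 ^+ n + W n) ->
  forall s, 0 <= s <= T -> forall eta, 0 < eta -> exists n1, forall n, (n1 <= n)%N -> `|f s| <= W n + eta.
Proof.
move=> T0 cf [n1 Hn1] s /andP[s0 sT] eta eta0.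
have e2 : 0 < eta / 2 by rewrite divr_gt0.
have [n2 Hn2] := eventually_halves 1 e2.
suff [t [m [k [km tk ft]]]] : exists t m k, [/\ (k <= 2 ^ m)%N, t = grid T m k & `|f s - f t| <= eta / 2].
  exists (maxn m (maxn n1 n2)) => n; rewrite !geq_max => /and3P[mn n1n n2n].
  have kn : (k * 2 ^ (n - m) <= 2 ^ n)%N by rewrite -[in leqRHS](subnKC mn) expnD leq_mul2r km orbT.
  have := Hn1 n n1n _ kn; rewrite grid_refine // -tk => H1; have := Hn2 n n2n => H2.
  have := ler_normD (f s - f t) (f t); rewrite subrK => H3.
  move: H1 H2 H3 ft; set b := 1 / _; set A1 := `|f s|; set A2 := `|f t|; set A3 := `|_ - _|; lra.
(* The endpoint [T] has no grid point on its right within the horizon, but it is one itself. *)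
move: sT; rewrite le_eqVlt => /orP[/eqP ->|sT].
  exists T, 0%N, 1%N; split => //; first by rewrite /grid mulr1 expr0 divr1.
  by rewrite subrr normr0 ltW.
have := @cvgr_dist_le _ _ _ _ _ _ _ (cf s s0) _ e2 => -[e /= ep He].
have [m Hm] := eventually_halves T ep.
have p0 := @two_gt0 R m.
pose k := Num.truncn (s * 2 ^+ m / T).
have /andP[k1 k2] : k%:R <= s * 2 ^+ m / T < k.+1%:R.
  by apply: truncn_itv; rewrite divr_ge0 ?mulr_ge0 // ltW.
exists (grid T m k.+1), m, k.+1; split => //.
  rewrite -(ltr_nat R) natrX; apply: le_lt_trans k1 _.
  by rewrite ltr_pdivrMr // mulrC ltr_pM2l.
have g1 : s < grid T m k.+1 by rewrite /grid ltr_pdivlMr // -ltr_pdivrMl // mulrC.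
have g2 : grid T m k <= s by rewrite /grid ler_pdivrMr // mulrC -ler_pdivlMr.
apply: He => //=; rewrite ltr_norml; have := Hm m (leqnn m).
move: g1 g2; rewrite gridS; set x := T / _ => *; apply/andP; split; lra.
Qed.

Lemma eq_small_cells (R : realType) (A : finType) (oc oc' : A -> bool -> nat -> nat -> bool) J0 k :
  (forall a s i j, (i < k)%N -> (j < J0)%N -> oc a s i j = oc' a s i j) ->
  small_cells R oc J0 k = small_cells R oc' J0 k.
Proof.
move=> H; rewrite /small_cells; apply: eq_bigr => i _; apply: eq_bigr => b _; apply: eq_bigr => s _.
by apply: eq_bigr => j _; rewrite H.
Qed.

Section SupBound.
Context {R : realType} {d : measure_display} {Omega : measurableType d}.
Variables (P : probability Omega R) (PN : nat -> bool -> rmeasure (R := R) (Omega := Omega)).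
Variables (U0 : nat -> nat -> Omega -> R).
Hypothesis PNP : forall a o, (1 <= a)%N -> poisson_random_measure P (PN a o).
Hypothesis indep : indep_inputs P PN U0.
Hypothesis mU0 : forall N a, (2 <= N)%N -> (1 <= a <= N)%N -> measurable_fun setT (U0 N a).
Hypothesis idU0 : forall N a N' a', (2 <= N)%N -> (1 <= a <= N)%N ->
         (2 <= N')%N -> (1 <= a' <= N')%N ->
         forall B : set R, measurable B ->
           P (U0 N a @^-1` B) = P (U0 N' a' @^-1` B).
Variables (phi : R -> R) (L T h : R) (N : nat) (a : 'I_N).
Variables (UN : nat -> R -> Omega -> R) (U : R -> Omega -> R).
Hypothesis phi_ge0 : forall x, 0 <= phi x.
Hypothesis phi_ll : locally_lipschitz phi.
Hypothesis h_gt0 : 0 < h.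
Hypothesis L_gt0 : 0 < L.
Hypothesis T_gt0 : 0 < T.
Hypothesis N2 : (2 <= N)%N.
Hypothesis U0L : {ae P, forall w, forall b : 'I_N, `|U0 N b.+1 w| <= L}.
Hypothesis UNsys : is_actor_system P phi h N PN (U0 N) UN.
Hypothesis Usol : is_limit_solution P phi h (PN a.+1) (U0 N a.+1) U.
Variables (r S4 lip SM : R).
Hypothesis r_gt0 : 0 < r.
Hypothesis S4_ge0 : 0 <= S4.
Hypothesis phi_S4 : forall x, phi (clip (4 * r) x) <= S4.
Hypothesis lip_ge0 : 0 <= lip.
Hypothesis SM_ge0 : 0 <= SM.
Let M := good_level r S4.
Hypothesis phi_lip : forall x y, `|phi (clip M x) - phi (clip M y)| <= lip * `|x - y|.
Hypothesis phi_SM : forall x, phi (clip M x) <= SM.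
Hypothesis hr : h <= r.
Hypothesis Lr : L <= r.
Hypothesis Tr : T <= r.

Variables (kap lipk Sk : R) (K : nat).
Hypothesis kapB : limit_B P phi L T h U <= kap.
Hypothesis kapM : M <= kap.
Hypothesis lipk_ge0 : 0 <= lipk.
Hypothesis Sk_ge0 : 0 <= Sk.
Hypothesis phi_lipk : forall x y, `|phi (clip kap x) - phi (clip kap y)| <= lipk * `|x - y|.
Hypothesis phi_Sk : forall x, phi (clip kap x) <= Sk.
Hypothesis SkK : Sk + 2 <= K%:R.
Hypothesis S4K : S4 + 2 <= K%:R.

Let M_ge0 : 0 <= M.
Proof. by apply: le_trans (good_level_ge r_gt0 S4_ge0); rewrite mulr_ge0 // ltW. Qed.

Let p_gt0 n : 0 < 2 ^+ n :> R := @two_gt0 R n.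

Let phi_M_K x : phi (clip M x) + 2 <= K%:R.
Proof.
apply: le_trans SkK; rewrite lerD2r; apply: le_trans (phi_Sk (clip M x)).
rewrite [X in _ <= phi X]clip_id //; exact: le_trans (clip_norm _ M_ge0) kapM.
Qed.

Let thrJ n x : (thr phi M n x <= K * 2 ^ n)%N. Proof. exact: thr_le. Qed.

Let levelsJ n : (small_levels S4 n <= K * 2 ^ n)%N.
Proof.
have r0 : 0 <= 2 ^+ n * (S4 + 1) by rewrite mulr_ge0 ?addr_ge0 ?(ltW (p_gt0 n)).
have /andP[h1 _] := truncn_itv r0.
rewrite /small_levels -(ler_nat R) -natr1 natrM natrX.
have t1 : 1 <= 2 ^+ n :> R by rewrite exprn_ege1 // ler1n.
have : (S4 + 2) * 2 ^+ n <= K%:R * 2 ^+ n by rewrite ler_pM2r.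
move: h1; set c := _%:R; set D := K%:R * _; rewrite mulrDl mulrDr mulr1 mulrC; lra.
Qed.

Local Notation law n := (@coord_law _ _ _ P U0 T L N n (K * 2 ^ n) (init_size L n)).
Let law_ge0 n := @coord_law_ge0 _ _ _ P U0 T L N n (K * 2 ^ n) (init_size L n) T_gt0.
Let law_sum1 n := @coord_law_sum1 _ _ _ P U0 mU0 T L N n (K * 2 ^ n) (init_size L n) N2.
Let law_rate n := @coord_law_rate _ _ _ P U0 T L N n (K * 2 ^ n) (init_size L n).
Local Notation x0v n := (@init_val _ L n).
Let x0vL n v : `|@init_val _ L n v| <= L := init_val_norm L_gt0 v.

Let Cgap n w := chaos_gap phi r S4 T h (law n) (x0v n) a (gconf PN U0 T L N n K w).
Let Fgap n w := field_gap P PN U0 phi L T h a U kap K n w.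

Let N_gt0 : (0 < N)%N. Proof. exact: ltnW. Qed.

(** Here [kap] disappears: the self-consistent scheme stays in the interval of radius [M], where
    clipping at [M] and at [kap] agree. The same scheme is thus close to the solution and to the
    actors. *)
Lemma conf_field_good n k c : (k <= 2 ^ n)%N ->
  conf_field (K := K) P U0 phi T h a kap k c =
  mean_field (law n) (cell_rate T n) (thr phi M n) (x0v n) h k c a.
Proof.
move=> kn; apply/esym; apply: (eq_mean_field (B := M)) => //.
  move=> k' c' b kn'; have := mean_field_good phi_ge0 r_gt0 S4_ge0 phi_S4 h_gt0 T_gt0 hr Lr Tr
    (@thrJ n) (@law_ge0 n) (@law_sum1 n) (@law_rate n) (@x0vL n) c' b (ltnW kn').
  exact.
by move=> x xM; apply: thr_clip_eq => //; apply: le_trans kapM.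
Qed.

Let fields_gap n k w : (k <= 2 ^ n)%N ->
  `|mean_field (law n) (cell_rate T n) (thr phi M n) (x0v n) h k (gconf PN U0 T L N n K w) a -
    U (grid T n k) w| <= Fgap n w.
Proof.
move=> kn; rewrite -conf_field_good // distrC.
exact: (runmax_ge (fun k => `|U (grid T n k) w - conf_field P U0 phi T h a kap k (gconf PN U0 T L N n K w)|)).
Qed.

(** The path follows the scheme clipped at a level [B] that depends on [w]. On a good configuration
    this is the scheme clipped at [M], to which the mean estimate applies; on a bad one only sizes
    are compared. *)
Lemma ae_grid_close : {ae P, forall w, exists n1, forall n, (n1 <= n)%N -> forall k, (k <= 2 ^ n)%N ->
  `|UN a.+1 (grid T n k) w - U (grid T n k) w| <= 1 / 2 ^+ n + (Cgap n w + Fgap n w)}.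
Proof.
have [_ sys] := UNsys.
have Hs := ae_simple_strips PNP indep T_gt0 N; have Hz := ae_zero_time PNP N.
near=> w.
have sysw : forall b, (1 <= b <= N)%N ->
     cadlag (fun t => UN b t w) /\
     forall t, 0 <= t ->
       (forall o, pintegrable (PN b o w) t (own_jump phi o (fun s => UN b s w))) /\
       (forall o b', (1 <= b' <= N)%N -> b' != b ->
          pintegrable (PN b' o w) t (spike phi o (fun s => UN b' s w))) /\
       UN b t w = U0 N b w
         - \sum_(o : bool) pint (PN b o w) t (own_jump phi o (fun s => UN b s w))
         + h / N%:R * \sum_(o : bool) \sum_(1 <= b' < N.+1 | b' != b)
              sgnO o * pint (PN b' o w) t (spike phi o (fun s => UN b' s w)) by near: w.
have simple : forall K, exists n0, forall n, (n0 <= n)%N ->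
  simple_strips T (fun a o => PN a o w) N n K by near: w.
have z0 : forall K : nat, forall a o, (1 <= a <= N)%N ->
  PN a o w ([set` `[(0 : R), 0]] `*` [set` `[(0 : R), K%:R[]) = 0%E by near: w.
have w0 : forall b : 'I_N, `|U0 N b.+1 w| <= L by near: w.

have cu b : (1 <= b <= N)%N -> cadlag (fun t => UN b t w) by move=> bN; case: (sysw b bN).
have iown b s t : (1 <= b <= N)%N -> 0 <= t ->
    pintegrable (PN b s w) t (own_jump phi s (fun t => UN b t w)).
  by move=> bN t0; have [_ H] := sysw b bN; have [H1 _] := H t t0.
have ispike b s t : (1 <= b <= N)%N -> 0 <= t ->
    pintegrable (PN b s w) t (spike phi s (fun t => UN b t w)).
  (* Integrability of the spikes of [b] is part of the equation of another actor, which exists since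
     [N >= 2]. *)
  move=> bN t0; have [b' b'N bb'] : exists2 b', (1 <= b' <= N)%N & b != b'.
    by have [->|b1] := eqVneq b 1%N; [exists 2%N|exists 1%N; rewrite ?(ltnW N2)].
  by have [_ H] := sysw b' b'N; have [_ [H2 _]] := H t t0; apply: H2.
have uE b t : (1 <= b <= N)%N -> 0 <= t -> UN b t w = U0 N b w
         - \sum_(s : bool) pint (PN b s w) t (own_jump phi s (fun s => UN b s w))
         + h / N%:R * \sum_(s : bool) \sum_(1 <= b' < N.+1 | b' != b)
              sgnO s * pint (PN b' s w) t (spike phi s (fun s => UN b' s w)).
  by move=> bN t0; have [_ H] := sysw b bN; have [_ [_ H3]] := H t t0.
have /choice [Bf HBf] : forall b : 'I_N, exists B, forall t, 0 <= t <= T -> `|UN b.+1 t w| <= B.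
  by move=> b; apply: cadlag_bounded; apply: cu; rewrite /= ltn_ord.
(* The summand [M] guarantees [M <= B], so that both clippings agree up to [M]. *)
pose B := M + \sum_(b < N) `|Bf b|.
have sB : 0 <= \sum_(b < N) `|Bf b| by apply: sumr_ge0.
have MB : M <= B by rewrite lerDl.
have B0 : 0 <= B := le_trans M_ge0 MB.
have uB b t : (1 <= b <= N)%N -> 0 <= t <= T -> `|UN b t w| <= B.
  case: b => // b /= bN /(HBf (Ordinal bN)) /le_trans; apply; apply: le_trans (ler_norm _) _.
  rewrite /B (bigD1 (Ordinal bN)) //= addrCA lerDl addr_ge0 //; exact: sumr_ge0.
have [lw [Sw [lw0 Sw0 phi_lw phi_Sw]]] := clipped_constants phi_ge0 phi_ll B0.
pose Kw := (Num.truncn (Sw + 2)).+1.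
have phi_Kw x : phi (clip B x) + 2 <= Kw%:R.
  by apply: ltW; apply: le_lt_trans (truncnS_gt (Sw + 2)); rewrite lerD2r.
pose x1 n (b : 'I_N) := init_approx L n (U0 N b.+1 w).
have [n1 Hn1] := actor_path_scheme T_gt0 cu iown ispike uE uB (fun b s => z0 Kw b s) (simple Kw)
  phi_ge0 lw0 phi_lw (lexx B) phi_Kw (x0n := x1) (fun n b => init_approx_dist n (w0 b)).
exists n1 => n n1n k kn; have := Hn1 n n1n k a kn.
pose oc := path_occ (N := N) T (fun b s => PN b s w) n.
rewrite -/oc; set Z := actor_scheme _ _ _ _ _ _ => HZ.
pose c := gconf PN U0 T L N n K w.
have x1E : init (x0v n) c = x1 n by apply/funext => b; rewrite init_gconf.
have ocE b s i j : (i < 2 ^ n)%N -> (j < K * 2 ^ n)%N -> occ c b s i j = oc b s i j by exact: occ_gconf.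
have cellsE : cells_below S4 c = small_cells R oc (small_levels S4 n) (2 ^ n).
  by apply: eq_small_cells => b s i j i2 jS; apply: ocE => //; apply: leq_trans jS (levelsJ n).
have x1L b : `|x1 n b| <= L by rewrite -x1E; exact: x0vL.
have fieldU := @fields_gap n k w kn.
pose mk := mean_field (law n) (cell_rate T n) (thr phi M n) (x0v n) h k c a.
rewrite -/c -/mk in fieldU.
rewrite /Cgap /chaos_gap -/c; have [gc|bc] := boolP (good_conf r S4 c); rewrite /= mul0r ?addr0 ?add0r [1%:R * _]mul1r.
  have ZE : Z = actor_scheme (thr phi M n) h (init (x0v n) c) (occ c) k a.
    apply/esym; rewrite /Z -x1E; apply: (eq_actor_scheme (B := M) (n := 2 ^ n)) => //.
    - move=> k' b k'n; apply: (good_conf_bound r_gt0 S4_ge0 phi_S4 (n := n) h_gt0 hr Lr N_gt0).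
        by move=> b'; exact: x0vL.
      by apply: le_trans gc; apply: small_cells_homo; exact: ltnW.
    - by move=> x xM; apply: thr_clip_eq => //; apply: le_trans MB.
    - by move=> k' b s j x k'n jt; apply: ocE => //; apply: leq_trans jt (thrJ _ _).
  have HY := runmax_ge (fun k => `|actor_scheme (thr phi M n) h (init (x0v n) c) (occ c) k a -
    mean_field (law n) (cell_rate T n) (thr phi M n) (x0v n) h k c a|) kn.
  rewrite -ZE -/mk in HY.
  have := ler_normD (UN a.+1 (grid T n k) w - Z) ((Z - mk) + (mk - U (grid T n k) w)).
  rewrite (_ : _ - Z + _ = UN a.+1 (grid T n k) w - U (grid T n k) w); last by ring.
  move=> /le_trans; apply; rewrite [in leLHS]distrC; apply: lerD => //.
  by apply: le_trans (ler_normD _ _) _; apply: lerD.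
(* On a bad configuration the bound linear in the small cells is used for the actors, and the
   uniform bound [M] for the self-consistent scheme. *)
have ZB : `|Z| <= 2 * L + 4 * h / N%:R * cells_below S4 c.
  have thrS x : `|x| <= 4 * h -> (thr phi B n x <= small_levels S4 n)%N.
    move=> xh; have xM : `|x| <= M.
      by apply: le_trans (good_level_ge r_gt0 S4_ge0); apply: le_trans xh _; rewrite ler_pM2l.
    rewrite (thr_clip_eq _ _ (le_trans xM MB) xM).
    exact: (thr_small r_gt0 S4_ge0 phi_S4 n hr xh).
  have := actor_scheme_bound oc h_gt0 x1L thrS k a.
  rewrite card_ord -/Z => /le_trans; apply.
  rewrite lerD2l ler_wpM2l ?divr_ge0 ?mulr_ge0 ?(ltW h_gt0) // cellsE; exact: small_cells_homo.
have mkM : `|mk| <= M.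
  exact: (mean_field_good phi_ge0 r_gt0 S4_ge0 phi_S4 h_gt0 T_gt0 hr Lr Tr
    (@thrJ n) (@law_ge0 n) (@law_sum1 n) (@law_rate n) (@x0vL n) c a kn).
have Z0 : 0 <= cells_below S4 c by rewrite cellsE /small_cells; do 4 (apply: sumr_ge0 => ? _).
have hrN : 4 * h / N%:R * cells_below S4 c <= 4 * r / N%:R * cells_below S4 c.
  by rewrite ler_wpM2r // ler_wpM2r ?invr_ge0 // ler_pM2l.
have := ler_normD (UN a.+1 (grid T n k) w - Z) (Z + ((mk - U (grid T n k) w) - mk)).
rewrite (_ : _ - Z + _ = UN a.+1 (grid T n k) w - U (grid T n k) w); last by ring.
move=> /le_trans; apply; rewrite [in leLHS]distrC; apply: lerD => //.
apply: le_trans (ler_normD _ _) _; apply: le_trans (lerD ZB (ler_normB _ _)) _.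
apply: le_trans (lerD (lexx _) (lerD fieldU mkM)) _.
rewrite /bad_level -/M; move: hrN Lr; set x := _ * cells_below _ _; set y := _ * cells_below _ _; lra.
Unshelve. all: by end_near. Qed.

Let chaos_gap_ge0 n c : 0 <= chaos_gap phi r S4 T h (law n) (x0v n) a c.
Proof.
have r0 := ltW r_gt0; apply: addr_ge0; apply: mulr_ge0 => //; first exact: runmax_ge0.
apply: addr_ge0; first by rewrite /bad_level -/M addr_ge0 // mulr_ge0.
apply: mulr_ge0; first by rewrite divr_ge0 // mulr_ge0.
by rewrite /cells_below /small_cells; do 4 (apply: sumr_ge0 => ? _).
Qed.

Let Cgap_ge0 n w : 0 <= Cgap n w. Proof. exact: chaos_gap_ge0. Qed.

Let Fgap_ge0 n w : 0 <= Fgap n w. Proof. exact: runmax_ge0. Qed.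

Let mF n : measurable_fun setT (fun w => (Fgap n w)%:E).
Proof. by apply/measurable_EFinP; exact: (measurable_field_gap PNP mU0 L T_gt0 N2 Usol). Qed.

Let mC n : measurable_fun setT (fun w => (Cgap n w)%:E).
Proof.
apply/measurable_EFinP; apply: (measurable_finite_valued (X := gconf PN U0 T L N n K)
  (chaos_gap phi r S4 T h (law n) (x0v n) a)).
exact: (measurable_conf PNP mU0).
Qed.

Lemma sup_bound : (Esup_diff P (UN a.+1) U T <= (chaos_const r S4 lip SM / Num.sqrt N%:R)%:E)%E.
Proof.
set l := chaos_const _ _ _ _ / _.
pose b n := ((l + grid_const r S4 lip / 2 ^+ n)%:E + \int[P]_w (Fgap n w)%:E)%E.
have U0La : {ae P, forall w, `|U0 N a.+1 w| <= L} by move: U0L; apply: filterS => w.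
apply: (@Fatou_ae _ _ _ P _ (fun n w => (Cgap n w)%:E + (Fgap n w)%:E)%E b).
- move=> w; apply: (@le_trans _ _ (`|UN a.+1 0 w - U 0 w|)%:E); first by rewrite lee_fin.
  by apply: ereal_sup_ubound; exists 0 => //=; rewrite /Icc0 /= in_itv /= lexx ltW.
- by move=> n w; rewrite adde_ge0 // lee_fin.
- by move=> n; apply: emeasurable_funD.
- have [_ sys] := UNsys; have [_ [_ [_ lim]]] := Usol.
  have aN : (1 <= a.+1 <= N)%N by rewrite /= ltn_ord.
  have close := ae_grid_close.
  have cU : {ae P, forall w, cadlag (fun t => UN a.+1 t w)}.
    by move: sys; apply: filterS => w H; case: (H a.+1 aN).
  have cl : {ae P, forall w, cadlag (fun t => U t w)} by move: lim; apply: filterS => w [].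
  near=> w.
  have cUw : cadlag (fun t => UN a.+1 t w) by near: w.
  have clw : cadlag (fun t => U t w) by near: w.
  have gridw : exists n1, forall n, (n1 <= n)%N -> forall k, (k <= 2 ^ n)%N ->
    `|UN a.+1 (grid T n k) w - U (grid T n k) w| <= 1 / 2 ^+ n + (Cgap n w + Fgap n w) by near: w.
  (* The rank from which the grid bound reaches [s] depends on [s] and [e], but the inferior limit
     does not, and so it dominates the supremum over all times. *)
  apply: ge_ereal_sup => _ [s sT <-]; apply/lee_addgt0Pr => e e0.
  have cD t : 0 <= t -> (UN a.+1 x w - U x w) @[x --> at_right t] --> UN a.+1 t w - U t w.
    by move=> t0; apply: cvgB; [case: cUw => H _|case: clw => H _]; exact: H.
  have sT' : 0 <= s <= T by move: sT; rewrite /Icc0 /= in_itv.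
  have [n1 Hn1] := grid_approx_path T_gt0 cD gridw sT' e0.
  rewrite -leeBlDr //; apply: (@le_limn_einf _ _ _ n1) => n /Hn1 H.
  by rewrite -EFinB -EFinD lee_fin lerBlDr.
- move=> n; rewrite ge0_integralD //; try (by move=> w _; rewrite lee_fin).
  apply: leeD => //.
  rewrite /Cgap (integral_conf PNP indep mU0 idU0 L T_gt0 N2 (@chaos_gap_ge0 n)) lee_fin.
  exact: (mean_chaos_gap phi_ge0 r_gt0 S4_ge0 phi_S4 lip_ge0 SM_ge0 phi_lip phi_SM h_gt0 T_gt0 hr Lr Tr
    N_gt0 (@thrJ n) (levelsJ n) (@law_ge0 n) (@law_sum1 n) (@law_rate n) (@x0vL n)).
- rewrite -[l%:E]adde0; apply: cvgeD => //.
    apply: cvg_EFin; first exact: nearW.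
    rewrite -[X in _ --> X]addr0; apply: cvgD; [exact: cvg_cst|exact: cvg_halves].
  exact: (field_gap_cvg0 PNP indep mU0 idU0 phi_ge0 phi_ll h_gt0 L_gt0 T_gt0 N2 U0La Usol kapB
    lipk_ge0 Sk_ge0 phi_lipk phi_Sk SkK).
Unshelve. all: by end_near. Qed.

End SupBound.

(** The integral of a nonnegative function is the supremum over the simple functions below it, hence
    monotone even between suprema over uncountably many times. *)
Lemma ge0_le_integral_outer (d : measure_display) (Omega : measurableType d) (R : realType)
    (P : {measure set Omega -> \bar R}) (f g : Omega -> \bar R) :
  (forall w, 0 <= f w)%E -> (forall w, f w <= g w)%E -> (\int[P]_w f w <= \int[P]_w g w)%E.
Proof.
move=> f0 fg; have g0 w : (0 <= g w)%E := le_trans (f0 w) (fg w).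
rewrite !ge0_integralTE //; apply: le_ereal_sup => _ [k kf <-].
by exists k => // w; apply: le_trans (fg w).
Qed.

Lemma ae_probability1 (d : measure_display) (Omega : measurableType d) (R : realType)
    (P : probability Omega R) (X : Omega -> R) L : measurable_fun setT X ->
  P [set w | `|X w| <= L] = 1%E -> {ae P, forall w, `|X w| <= L}.
Proof.
move=> mX PX; have mA : measurable [set w | `|X w| <= L].
  rewrite (_ : [set w | _] = (fun w => `|X w|) @^-1` [set` `]-oo, L]]); last first.
    by apply/seteqP; split => w; rewrite /= in_itv.
  by rewrite -[X in measurable X]setTI; apply: (measurableT_comp (@normr_measurable R setT) mX).
exists (~` [set w | `|X w| <= L]); split; first exact: measurableC.
  by rewrite probability_setC // PX subee.
by move=> w /= H.
Qed.

Theorem theorem3 (R : realType) (phi : R -> R) :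
  (forall x, 0 <= phi x) -> locally_lipschitz phi ->
  (* C L T h = C(L,T,h,phi) *)
  exists C : R -> R -> R -> R,
    (forall L T h, 0 < L -> 0 < T -> 0 < h -> 0 < C L T h) /\
    (forall L L' T h, 0 < L -> L <= L' -> 0 < T -> 0 < h -> C L T h <= C L' T h) /\
    (forall L T T' h, 0 < L -> 0 < T -> T <= T' -> 0 < h -> C L T h <= C L T' h) /\
    (forall L T h h', 0 < L -> 0 < T -> 0 < h -> h <= h' -> C L T h <= C L T h') /\
    forall (L T h : R) (d : measure_display) (Omega : measurableType d)
      (P : probability Omega R)
      (PN : nat -> bool -> rmeasure (R := R) (Omega := Omega))
      (U0 : nat -> nat -> Omega -> R)
      (UN : nat -> nat -> R -> Omega -> R)
      (Ul : nat -> nat -> R -> Omega -> R),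
      0 < h -> 0 < L -> 0 < T ->
      (* the N^{a,o} are Poisson random measures with intensity ds dz on R+ x R+ *)
      (forall a o, (1 <= a)%N -> poisson_random_measure P (PN a o)) ->
      (* the N^{a,o} and the U_0^N(a) are all mutually independent *)
      mutual_indep P
        [set i : ((nat * bool) + (nat * nat))%type |
           match i with
           | inl (a, _) => (1 <= a)%N
           | inr (N, a) => (2 <= N)%N /\ (1 <= a <= N)%N
           end]
        (fun i => match i with
                  | inl (a, o) => sigmaRM (PN a o)
                  | inr (N, a) => sigmaRV (U0 N a)
                  end) ->
      (* the U_0^N(a) are identically distributed real random variables *)
      (forall N a, (2 <= N)%N -> (1 <= a <= N)%N -> measurable_fun setT (U0 N a)) ->
      (forall N a N' a', (2 <= N)%N -> (1 <= a <= N)%N ->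
         (2 <= N')%N -> (1 <= a' <= N')%N ->
         forall B : set R, measurable B ->
           P (U0 N a @^-1` B) = P (U0 N' a' @^-1` B)) ->
      (* P(|U_0^N(a)| <= L) = 1 *)
      (forall N a, (2 <= N)%N -> (1 <= a <= N)%N ->
         P [set w | `|U0 N a w| <= L] = 1%E) ->
      (* U^N is the N-actor system *)
      (forall N, (2 <= N)%N -> is_actor_system P phi h N PN (U0 N) (UN N)) ->
      (* U(a) solves the limit equation driven by N^{a,+-} with U_0(a) = U_0^N(a) *)
      (forall N a, (2 <= N)%N -> (1 <= a <= N)%N ->
         is_limit_solution P phi h (PN a) (U0 N a) (Ul N a)) ->
      forall (N a : nat) (t : R), (2 <= N)%N -> (1 <= a <= N)%N -> 0 <= t <= T ->
        (Esup_diff P (UN N a) (Ul N a) t <= (C L T h / Num.sqrt N%:R)%:E)%E.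
Proof.
move=> phi_ge0 phi_ll.
have /choice [cst Hcst] : forall i : nat, exists p : R * R * R,
    [/\ 0 <= p.1.1, forall x, phi (clip (4 * i.+1%:R) x) <= p.1.1, 0 <= p.1.2, 0 <= p.2 &
      (forall x y, `|phi (clip (good_level i.+1%:R p.1.1) x) - phi (clip (good_level i.+1%:R p.1.1) y)|
         <= p.1.2 * `|x - y|) /\
      forall x, phi (clip (good_level i.+1%:R p.1.1) x) <= p.2].
  move=> i; have r0 : 0 < i.+1%:R :> R by rewrite ltr0n.
  have r4 : 0 <= 4 * i.+1%:R :> R by rewrite mulr_ge0.
  have [_ [S4 [_ S40 _ HS4]]] := clipped_constants phi_ge0 phi_ll r4.
  have M0 : 0 <= good_level i.+1%:R S4 := le_trans r4 (good_level_ge r0 S40).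
  have [lip [SM [lip0 SM0 Hlip HSM]]] := clipped_constants phi_ge0 phi_ll M0.
  by exists (S4, lip, SM).
pose c i := chaos_const i.+1%:R (cst i).1.1 (cst i).1.2 (cst i).2.
pose idx (L T h : R) := Num.truncn (Num.max L (Num.max T h)).
(* The constants picked by [choice] need not grow with [i]; absolute values and the sum over an
   initial segment enforce monotonicity, and the 1 makes the result positive. *)
pose C L T h := 1 + \sum_(i < (idx L T h).+1) `|c i|.
have C_mono L T h L' T' h' : Num.max L (Num.max T h) <= Num.max L' (Num.max T' h') -> C L T h <= C L' T' h'.
  move=> H; rewrite /C lerD2l; apply: (@sum_le_prefix _ (fun i => `|c i|)) => //.
  by rewrite ltnS; apply: le_truncn.
exists C; split; last split; last split; last split.
- by move=> L T h *; rewrite /C ltr_pwDl // sumr_ge0.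
- by move=> L L' T h _ LL' *; apply: C_mono; rewrite !(ge_max, le_max) LL' !lexx /= ?orbT.
- by move=> L T T' h _ _ TT' *; apply: C_mono; rewrite !(ge_max, le_max) TT' !lexx /= ?orbT.
- by move=> L T h h' _ _ _ hh'; apply: C_mono; rewrite !(ge_max, le_max) hh' !lexx /= ?orbT.
move=> L T h d Omega P PN U0 UN Ul h0 L0 T0 PNP indep mU0 idU0 U0L UNsys Usol N a t N2 aN /andP[t0 tT].
case: a aN => // a aN; have aN' : (a < N)%N by case/andP: aN.
pose a' := Ordinal aN'; pose i := idx L T h.
have [S40 HS4 lip0 SM0 [Hlip HSM]] := Hcst i.
have maxi : Num.max L (Num.max T h) < i.+1%:R by exact: truncnS_gt.
move: (maxi); rewrite !gt_max => /and3P[Li Ti hi].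
have r0 : 0 < i.+1%:R :> R by rewrite ltr0n.
set M := good_level i.+1%:R (cst i).1.1 in Hlip HSM.
(* This level depends on the solution, as do [lipk], [Sk] and [K], whereas [C] is already fixed;
   none of them occurs in the conclusion of [sup_bound]. *)
pose kap := Num.max (limit_B P phi L T h (Ul N a.+1)) M.
have M0 : 0 <= M by apply: le_trans (good_level_ge r0 S40); rewrite mulr_ge0.
have kapB : limit_B P phi L T h (Ul N a.+1) <= kap by rewrite le_max lexx.
have kapM : M <= kap by rewrite le_max lexx orbT.
have [lipk [Sk [lipk0 Sk0 Hlipk HSk]]] := clipped_constants phi_ge0 phi_ll (le_trans M0 kapM).
pose K := (Num.truncn (Num.max (Sk + 2) ((cst i).1.1 + 2))).+1.
have /ltW : Num.max (Sk + 2) ((cst i).1.1 + 2) < K%:R by exact: truncnS_gt.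
rewrite ge_max => /andP[SkK S4K].
have U0Lae : {ae P, forall w, forall b : 'I_N, `|U0 N b.+1 w| <= L}.
  apply: filter_forall => b.
  have bN : (1 <= b.+1 <= N)%N by rewrite /= ltn_ord.
  by apply: ae_probability1; [exact: mU0|exact: U0L].
have main := sup_bound (a := a') PNP indep mU0 idU0 phi_ge0 phi_ll h0 L0 T0 N2 U0Lae (UNsys N N2)
  (Usol N a.+1 N2 aN) r0 S40 HS4 lip0 SM0 Hlip HSM (ltW hi) (ltW Li) (ltW Ti) kapB kapM
  lipk0 Sk0 Hlipk HSk SkK S4K.
apply: (@le_trans _ _ (Esup_diff P (UN N a.+1) (Ul N a.+1) T)).
  apply: ge0_le_integral_outer => w.
    apply: (@le_trans _ _ (`|UN N a.+1 0 w - Ul N a.+1 0 w|)%:E); first by rewrite lee_fin.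
    by apply: ereal_sup_ubound; exists 0 => //=; rewrite /Icc0 /= in_itv /= lexx.
  apply: le_ereal_sup => _ [s + <-]; rewrite /Icc0 /= in_itv /= => /andP[s0 st].
  by exists s => //; rewrite /= in_itv /= s0 (le_trans st).
apply: le_trans main _; rewrite lee_fin ler_wpM2r ?invr_ge0 ?sqrtr_ge0 //.
apply: le_trans (ler_norm _) _; rewrite -/(c i) /C big_ord_recr /= addrA lerDr.
by rewrite addr_ge0 // sumr_ge0.
Qed.
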